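(* Let $d \geq 2$ and let $G$ be a geographical threshold graph (GTG) on $n$ nodes in the $d$-dimensional toric unit cube $[0,1]^d$ with threshold function $\theta_n = cn/\log n$, and assume $G$ is connected. Suppose the weight distribution satisfies $\mathbb{P}[W \geq x] = O(1/x^{d+\nu})$ for some constant $\nu > 0$, and \[ c \leq \frac{1}{d+3} \min \left\{ \sup_{\alpha \in (0,1/2]} \alpha F^{-1}(\alpha),\ \sup_{\alpha \in (1/2,1)} (1-\alpha) F^{-1}(\alpha) \right\}. \] Then, with high probability, the mixing time of the simple random walk on $G$ satisfies $\tau(1/n) = O\big(n^{2/d} (\log n)^{(d-2)/d}\big)$.
   Context: GTG model: $n$ nodes are placed independently and uniformly at random in the toric unit cube $[0,1]^d$ (distances $r_{ij}$ are toric Euclidean distances). Each node $i$ independently receives a non-negative weight $w_i$ drawn from a continuous probability density $f$ on $\mathbb{R}^+$ with finite mean $\mu$ and finite variance; $F(x)=\mathbb{P}[W\le x]=\int_0^x f(w)\,dw$ is its cdf and $F^{-1}(p)=\inf\{x\in\mathbb{R}^+ : p\le F(x)\}$ the quantile function. Nodes $i,j$ are adjacent iff $(w_i+w_j)/r_{ij}^d \geq \theta_n$. The tail condition $\mathbb{P}[W\ge x]=O(1/x^{d+\nu})$ means there are constants $W_0, C$ with $\mathbb{P}[W\ge x]\le C x^{-(d+\nu)}$ for all $x\ge W_0$. Simple random walk: from node $i$ move to a uniformly random neighbor. Its stationary distribution is $\pi_k=\deg(k)/2|E(G)|$. With $P^t(i,\cdot)$ the distribution at time $t$ started from $i$, $\Delta_i(t)=\frac12\sum_j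 |P^t(i,j)-\pi_j|$, $\tau_i(\delta)=\min\{t : \Delta_i(t')\le\delta \ \forall t'\ge t\}$, and $\tau(\delta)=\max_i \tau_i(\delta)$. ''With high probability'' (whp) means with probability $1-o(1)$ as $n\to\infty$. *)

(* Defs.v *)
From HB Require Import structures.
From mathcomp Require Import all_boot all_order all_algebra.
From mathcomp Require Import all_classical all_reals all_analysis.
Set Implicit Arguments. Unset Strict Implicit. Unset Printing Implicit Defensive.
Import Order.TTheory GRing.Theory Num.Theory.
Local Open Scope classical_set_scope.
Local Open Scope ring_scope.

Section GTG.
Variable R : realType.

Definition tor_dist1 (x y : R) : R := Num.min `|x - y| (1 - `|x - y|).

Definition tor_dist (d : nat) (x y : 'I_d -> R) : R :=
  Num.sqrt (\sum_(k < d) tor_dist1 (x k) (y k) ^+ 2).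

(* GTG adjacency: i ~ j iff i <> j and (w_i + w_j) / r_ij^d >= theta,
   written multiplicatively (r_ij^d * theta <= w_i + w_j). *)
Definition gtg_adj (d n : nat) (pos : 'I_n -> 'I_d -> R) (w : 'I_n -> R)
  (theta : R) : rel 'I_n :=
  fun i j => (i != j) && (theta * tor_dist (pos i) (pos j) ^+ d <= w i + w j).

Definition graph_connected (n : nat) (e : rel 'I_n) : Prop :=
  forall i j, connect e i j.

Definition deg (n : nat) (e : rel 'I_n) (i : 'I_n) : nat := #|[set j | e i j]|.

Definition srw_matrix (n : nat) (e : rel 'I_n) : 'M[R]_n :=
  \matrix_(i, j) (if e i j then ((deg e i)%:R)^-1 else 0).

Definition stationary (n : nat) (e : rel 'I_n) (k : 'I_n) : R :=
  (deg e k)%:R / (\sum_(j < n) deg e j)%:R.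

Definition tv_dist (n : nat) (e : rel 'I_n) (i : 'I_n) (t : nat) : R :=
  2^-1 * \sum_(j < n) `|(srw_matrix e ^+ t) i j - stationary e j|.

(* tau_i(delta) = min {t | Delta_i(t') <= delta for all t' >= t}  (+oo if none) *)
Definition mixing_time_from (n : nat) (e : rel 'I_n) (i : 'I_n) (delta : R)
  : \bar R :=
  ereal_inf [set (t%:R)%:E | t in
    [set t : nat | forall t' : nat, (t <= t')%N -> tv_dist e i t' <= delta]].

Definition mixing_time (n : nat) (e : rel 'I_n) (delta : R) : \bar R :=
  \big[Order.max/-oo%E]_(i < n) mixing_time_from e i delta.

Definition lebR := (@lebesgue_measure R).

Definition Rnn : set R := `[0, +oo[.

(* f is a probability density on R^+ with finite mean and finite variance
   (probability mass 1 is imposed through the model below) *)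
Definition weight_density (f : R -> R) : Prop :=
  (forall x, 0 <= f x) /\ measurable_fun setT f /\
  lebR.-integrable `[0, +oo[ (fun w => (w * f w)%:E) /\
  lebR.-integrable `[0, +oo[ (fun w => (w ^+ 2 * f w)%:E).

Definition cdf (f : R -> R) (x : R) : R :=
  fine (\int[lebR]_(y in `[0, x]) (f y)%:E).

Definition tail (f : R -> R) (x : R) : R :=
  fine (\int[lebR]_(y in `[x, +oo[) (f y)%:E).

Definition quantile (f : R -> R) (p : R) : R :=
  inf [set x : R | 0 <= x /\ p <= cdf f x].

Definition tail_bound (f : R -> R) (s : R) : Prop :=
  exists W0 C : R, 0 < W0 /\ forall x, W0 <= x -> tail f x <= C * x `^ (- s).

Definition indep_fam (d0 : measure_display) (T : measurableType d0)
  (P : probability T R) (I : finType) (Y : I -> T -> R) : Prop :=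
  (forall i, measurable_fun setT (Y i)) /\
  forall B : I -> set R, (forall i, measurable (B i)) ->
    P (\bigcap_i (Y i @^-1` B i)) = (\prod_i fine (P (Y i @^-1` B i)))%:E.

(* the random variables of the model with n nodes:
   coordinate k of the position of node i, and weight of node i *)
Definition gtg_var (n d : nat) (T : Type) (X : nat -> nat -> T -> R)
  (W : nat -> T -> R) (a : ('I_n * 'I_d) + 'I_n) : T -> R :=
  match a with
  | inl ik => X (nat_of_ord ik.1) (nat_of_ord ik.2)
  | inr i => W (nat_of_ord i)
  end.

(* n nodes placed independently and uniformly in [0,1]^d (i.e. all n*d
   coordinates are independent Uniform[0,1]), weights i.i.d. with density f,
   independent of the positions *)
Definition gtg_model (d0 : measure_display) (T : measurableType d0)
  (P : probability T R) (f : R -> R) (d n : nat)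
  (X : nat -> nat -> T -> R) (W : nat -> T -> R) : Prop :=
  indep_fam P (@gtg_var n d T X W) /\
  (forall (i : 'I_n) (k : 'I_d) (B : set R), measurable B ->
     P (X i k @^-1` B) = lebR (B `&` `[0, 1])) /\
  (forall (i : 'I_n) (B : set R), measurable B ->
     P (W i @^-1` B) = (\int[lebR]_(x in B `&` Rnn) (f x)%:E)%E).

Definition gtg_graph (T : Type) (d n : nat) (X : nat -> nat -> T -> R)
  (W : nat -> T -> R) (theta : R) (om : T) : rel 'I_n :=
  @gtg_adj d n (fun (i : 'I_n) (k : 'I_d) => X i k om) (fun i : 'I_n => W i om) theta.

End GTG.

(* Main.v *)
(* The walk is not lazy, so instead of its spectrum we use the Dirichlet form
   E(f, h) = sum over arcs (x, z) of (f x - h z)^2 of the bipartite double cover. One step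
   of the walk lowers the pi-variance of the density p_t = P^t(i,.)/deg by exactly
   E(p_t, p_(t+1)), so a Poincare inequality Var(f) <= K E(f, h) valid for all pairs (f, h)
   bounds the mixing time by O(K log n). It remains to get K = O((n / log n)^(2/d)).

   Cut the torus into M^d ~ n / log n blocks of S^d cells each, with S constant, and call a
   cell good if it contains of order log n nodes of weight at least q, where q > 0 is fixed
   with P[W >= q] > 0; two nodes of adjacent cells are linked as soon as one of them has
   such a weight. With high probability every window of boundedly many blocks has at most
   L < S bad cells (Chernoff, and a union bound over the sets of bad cells). Every pair of
   adjacent blocks then shares hyperplanes without bad cells, which joins the blocks along
   paths of good cells; energies along these paths and the Poincare inequality of the
   discrete torus of side M give the factor M^2.

   Nodes not attached to the good cells of their block are light, hence have short edges,
   and a chain of them that reached far would meet too many bad cells. As the graph is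
   connected such a node reaches the good part within a bounded window, enlarged by the
   longest edges; the tail condition makes the longest edges negligible. Heavy nodes, whose
   degree may be large, are charged to their lighter neighbours: every node has only
   O(log n) neighbours that are at least as heavy. *)
Require Import Defs.
From HB Require Import structures.
From mathcomp Require Import all_boot all_order all_algebra.
From mathcomp Require Import all_classical all_reals all_analysis.
From mathcomp Require Import measurable_realfun ring lra zify.
Set Implicit Arguments.
Unset Strict Implicit.
Unset Printing Implicit Defensive.
Import Order.TTheory GRing.Theory Num.Theory.
Local Open Scope ring_scope.

(** * Energy decay of the random walk *)

(** Pairs [(f, h)] are the price of a walk without laziness: on a bipartite graph a sign function
    [f] and [h = - f] have zero energy, so the inequality has to draw odd cycles from the graph.
    They come from the good cells, whose core nodes, at least three, are mutually adjacent.

    The randomness is reduced to a finite configuration: the cell and the weight level (weight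
    divided by [q], rounded down) of each node. The Poincare inequality is a deterministic
    consequence of two properties of it, [sparse_bad] and [bounded_reach], which fail with
    probability O(1/n).

    In the term of order M^2, each degree factor D of order log n meets an average over order log n
    core nodes, and the logarithms cancel. The comparison of single nodes with their block is crude,
    at cost w^2 D^3 for windows of w blocks; this is affordable since w is of order n^beta with beta
    < 1/d, so that w^2 is polynomially below M^2. On the other hand beta (d + nu) > 1 is required
    for all n weights to stay below the cap; a positive [nu] leaves room between the two. *)

Section WeightedSums.
Variable R : realFieldType.

Lemma cauchy_schwarz_weighted (I : finType) (P : pred I) (w a : I -> R) :
  (forall i, P i -> 0 <= w i) ->
  (\sum_(i | P i) w i * a i) ^+ 2 <=
  (\sum_(i | P i) w i) * \sum_(i | P i) w i * a i ^+ 2.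
Proof.
move=> w0.
(* Lagrange's identity: this double sum of squares is twice the defect in the inequality. *)
have : 0 <= \sum_(i | P i) \sum_(j | P j) w i * w j * (a i - a j) ^+ 2.
  apply: sumr_ge0 => i Pi; apply: sumr_ge0 => j Pj.
  by rewrite mulr_ge0 ?sqr_ge0 // mulr_ge0 ?w0.
have -> : \sum_(i | P i) \sum_(j | P j) w i * w j * (a i - a j) ^+ 2 =
  2 * ((\sum_(i | P i) w i) * (\sum_(i | P i) w i * a i ^+ 2)
     - (\sum_(i | P i) w i * a i) ^+ 2).
  transitivity (\sum_(i | P i) \sum_(j | P j)
     ((w i * a i ^+ 2) * w j - 2 * ((w i * a i) * (w j * a j))
      + w i * (w j * a j ^+ 2))).
    by apply: eq_bigr => i _; apply: eq_bigr => j _; ring.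
  rewrite (eq_bigr (fun i => (w i * a i ^+ 2) * (\sum_(j | P j) w j)
     - 2 * ((w i * a i) * (\sum_(j | P j) w j * a j))
      + w i * (\sum_(j | P j) w j * a j ^+ 2))); last first.
    by move=> i _; rewrite big_split /= sumrB -!mulr_sumr.
  rewrite big_split /= sumrB -!mulr_suml -mulr_sumr -mulr_suml.
  ring.
by rewrite pmulr_rge0 // subr_ge0.
Qed.

Lemma sqr_sum_le_card (I : finType) (P : pred I) (a : I -> R) :
  (\sum_(i | P i) a i) ^+ 2 <= #|P|%:R * \sum_(i | P i) a i ^+ 2.
Proof.
have := @cauchy_schwarz_weighted I P (fun=> 1) a (fun _ _ => ler01).
by under eq_bigr do rewrite mul1r; under [X in _ * X]eq_bigr do rewrite mul1r;
  rewrite sumr_const.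
Qed.

Lemma sum_sqr_pairs (I : finType) (a : I -> R) : (0 < #|I|)%N ->
  \sum_i \sum_j (a i - a j) ^+ 2 =
  2 * #|I|%:R * \sum_i (a i - (\sum_j a j) / #|I|%:R) ^+ 2.
Proof.
move=> I0; pose n : R := #|I|%:R; have n0 : 0 < n by rewrite ltr0n.
have sc (x : R) : \sum_(i : I) x = n * x by rewrite sumr_const mulr_natl.
set s := \sum_j a j; rewrite -/n.
transitivity (2 * n * \sum_i a i ^+ 2 - 2 * s ^+ 2).
  transitivity (\sum_i (n * a i ^+ 2 - 2 * s * a i + \sum_j a j ^+ 2)).
    apply: eq_bigr => i _.
    rewrite (eq_bigr (fun j => a i ^+ 2 - 2 * a i * a j + a j ^+ 2)); last first.
      by move=> j _; ring.
    by rewrite big_split sumrB /= !sc -!mulr_sumr -/s; ring.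
  by rewrite big_split sumrB /= sc -!mulr_sumr -/s; ring.
rewrite [in RHS](eq_bigr (fun j => a j ^+ 2 - 2 * (s / n) * a j + (s / n) ^+ 2)).
  2: by move=> j _; ring.
rewrite big_split sumrB /= !sc -!mulr_sumr -/s.
by field; rewrite lt0r_neq0.
Qed.

End WeightedSums.

Section Markov.
Variables (R : realType) (n : nat) (e : rel 'I_n).
Implicit Types (f h : 'I_n -> R) (x z i j : 'I_n).

(* The Dirichlet form of the bipartite double cover: [f] and [h] live on its two sides. *)
Definition dirichlet f h : R := \sum_x \sum_(z | e x z) (f x - h z) ^+ 2.

(** The centre [c] is existential, since the variance minimises over centres: any centre yields a
    bound on it ([V_min]). *)
Definition poincare (K : R) : Prop := forall f h, exists c : R,
  \sum_x (deg e x)%:R * (f x - c) ^+ 2 <= K * dirichlet f h.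

Lemma degE x : deg e x = #|[pred z | e x z]|.
Proof. by apply: eq_card => z; apply/idP/idP; rewrite !inE /=. Qed.

Hypothesis esym : symmetric e.
Hypothesis deg_gt0 : forall x, (0 < deg e x)%N.

Let dg x : R := (deg e x)%:R.
Let S : R := (\sum_(j < n) deg e j)%:R.
(** Density of [P^t(i, .)] with respect to the degrees. As [e] is symmetric, it evolves by averaging
    over neighbours ([vS]), and its degree-weighted mean stays [S^-1] ([sum_v]). *)
Let v (i : 'I_n) (t : nat) (j : 'I_n) : R := (srw_matrix R e ^+ t) i j / dg j.

Let dg_gt0 x : 0 < dg x. Proof. by rewrite ltr0n. Qed.
Let dg_neq0 x : dg x != 0. Proof. exact: lt0r_neq0. Qed.

Let SE : S = \sum_j dg j. Proof. by rewrite /S natr_sum. Qed.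

Let S_gt0 (i : 'I_n) : 0 < S.
Proof.
rewrite SE (bigD1 i) //= ltr_pwDl //.
by apply: sumr_ge0 => j _; rewrite ltW.
Qed.

Let vS i t j : v i t.+1 j = (dg j)^-1 * \sum_(k | e j k) v i t k.
Proof.
rewrite /v exprSr -[in LHS]mulmxE mxE mulrC; congr (_ * _).
rewrite [RHS]big_mkcond /=; apply: eq_bigr => k _.
by rewrite [in LHS]mxE esym; case: ifP => // _; rewrite mulr0.
Qed.

Let sum_v i t : \sum_j dg j * v i t j = 1.
Proof.
elim: t => [|t IH].
  under eq_bigr do rewrite /v mulrCA divff // mulr1.
  rewrite expr0; transitivity (\sum_j (1%:M : 'M[R]_n) i j) => //.
  rewrite (bigD1 i) //= mxE eqxx big1 ?addr0 // => j ji.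
  by rewrite mxE eq_sym (negbTE ji).
rewrite -[RHS]IH; under eq_bigr do rewrite vS mulrA divff // mul1r.
rewrite (exchange_big_dep xpredT) //=; apply: eq_bigr => k _.
rewrite (eq_bigl (fun j => e k j)); last by move=> j; rewrite esym.
by rewrite sumr_const -degE mulr_natl.
Qed.

Let V i t : R := \sum_j dg j * (v i t j - S^-1) ^+ 2.

Let VE i t (c : R) : \sum_j dg j * (v i t j - c) ^+ 2 =
  \sum_j dg j * v i t j ^+ 2 - 2 * c + c ^+ 2 * S.
Proof.
rewrite (eq_bigr (fun j => dg j * v i t j ^+ 2 - 2 * c * (dg j * v i t j)
    + c ^+ 2 * dg j)); last by move=> j _; ring.
by rewrite big_split /= sumrB -!mulr_sumr sum_v mulr1 -SE.
Qed.

Let V_min i t (c : R) : V i t <= \sum_j dg j * (v i t j - c) ^+ 2.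
Proof.
rewrite /V !VE; have S0 := S_gt0 i.
have Si : S^-1 * S = 1 by rewrite mulVf // lt0r_neq0.
have : 0 <= S * (c - S^-1) ^+ 2 by rewrite mulr_ge0 ?sqr_ge0 ?ltW.
have -> : S * (c - S^-1) ^+ 2 = c ^+ 2 * S - 2 * c * (S^-1 * S) + S^-1 * (S^-1 * S).
  by ring.
have -> : S^-1 ^+ 2 * S = S^-1 * (S^-1 * S) by ring.
by rewrite Si !mulr1; lra.
Qed.

(** Summing [v i t x] over the neighbours [x] of [z] gives [dg z * v i t.+1 z]; hence the cross term
    of the expanded squares is minus twice the square norm at time [t.+1]. *)
Let V_step i t : V i t - V i t.+1 = dirichlet (v i t) (v i t.+1).
Proof.
rewrite /V !VE /dirichlet.
have -> : \sum_x \sum_(z | e x z) (v i t x - v i t.+1 z) ^+ 2 =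
  \sum_x \sum_(z | e x z) v i t x ^+ 2
  - 2 * \sum_x \sum_(z | e x z) (v i t x * v i t.+1 z)
  + \sum_x \sum_(z | e x z) v i t.+1 z ^+ 2.
  rewrite mulr_sumr -sumrB -big_split /=; apply: eq_bigr => x _.
  rewrite mulr_sumr -sumrB -big_split /=; apply: eq_bigr => z _; ring.
have -> : \sum_x \sum_(z | e x z) v i t x ^+ 2 = \sum_x dg x * v i t x ^+ 2.
  by apply: eq_bigr => x _; rewrite sumr_const -degE mulr_natl.
have sw (F : 'I_n -> 'I_n -> R) : \sum_x \sum_(z | e x z) F x z =
    \sum_z \sum_(x | e z x) F x z.
  rewrite (exchange_big_dep xpredT) //=; apply: eq_bigr => z _.
  by apply: eq_bigl => x; rewrite esym.
have -> : \sum_x \sum_(z | e x z) v i t.+1 z ^+ 2 = \sum_x dg x * v i t.+1 x ^+ 2.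
  by rewrite sw; apply: eq_bigr => x _; rewrite sumr_const -degE mulr_natl.
have -> : \sum_x \sum_(z | e x z) v i t x * v i t.+1 z =
    \sum_x dg x * v i t.+1 x ^+ 2.
  rewrite sw.
  apply: eq_bigr => z _; rewrite -mulr_suml.
  have -> : \sum_(x | e z x) v i t x = dg z * v i t.+1 z.
    by rewrite vS mulrA divff ?mul1r.
  by rewrite expr2 mulrA.
ring.
Qed.

(** By [V_step] the variance contracts by [1 - K^-1] per step, from a start of at most 1.
    Cauchy-Schwarz passes to the L1 norm at the cost of the square root of the total degree, which
    is at most [n ^ 2]. *)
Lemma tv_dist_poincare (K : R) i t : 1 <= K -> poincare K ->
  tv_dist R e i t <= 2^-1 * (n%:R * Num.sqrt ((1 - K^-1) ^+ t)).
Proof.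
move=> K1 HK; have K0 : 0 < K by apply: lt_le_trans K1.
have q0 : 0 <= 1 - K^-1 by rewrite subr_ge0 invf_le1.
have Vt : V i t <= (1 - K^-1) ^+ t.
  elim: t => [|t IH].
    rewrite expr0; apply: le_trans (V_min i 0 0) _.
    rewrite (bigD1 i) //= big1 ?addr0 => [|j ji]; last first.
      by rewrite /v expr0 mxE eq_sym (negbTE ji) mul0r subr0 expr0n mulr0.
    rewrite /v expr0 mxE eqxx mul1r subr0 expr2 mulrA divff // mul1r.
    by rewrite invf_le1 // ler1n.
  have [c /= Hc] := HK (v i t) (v i t.+1).
  have := le_trans (V_min i t c) Hc; rewrite -V_step => H.
  rewrite exprS; apply: le_trans (ler_wpM2l q0 IH).
  rewrite mulrBl mul1r lerBrDr -lerBrDl mulrC ler_pdivrMr //.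
  by rewrite mulrC.
rewrite /tv_dist ler_wpM2l ?invr_ge0 //.
rewrite (eq_bigr (fun j => dg j * `|v i t j - S^-1|)); last first.
  move=> j _; rewrite /stationary -/S -[in RHS](ger0_norm (ltW (dg_gt0 j))).
  rewrite -normrM; congr `|_|; rewrite mulrBr /v mulrCA divff // mulr1.
  by [].
rewrite -(@ler_pXn2r _ 2) ?nnegrE //; last first.
  by apply: sumr_ge0 => j _; rewrite mulr_ge0 // ltW.
apply: le_trans (cauchy_schwarz_weighted _ (fun j _ => ltW (dg_gt0 j))) _.
rewrite exprMn sqr_sqrtr ?exprn_ge0 //.
under [X in _ * X]eq_bigr do rewrite real_normK ?num_real //.
apply: ler_pM.
- by rewrite sumr_ge0 // => j _; rewrite ltW.
- by apply: sumr_ge0 => j _; rewrite mulr_ge0 ?sqr_ge0 // ltW.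
- apply: (@le_trans _ _ (\sum_(j < n) n%:R)).
    apply: ler_sum => j _; rewrite ler_nat degE.
    by rewrite -[leqRHS]card_ord max_card.
  by rewrite sumr_const card_ord expr2 mulr_natl.
- exact: Vt.
Qed.

End Markov.

Lemma mixing_time_poincare (R : realType) (n : nat) (e : rel 'I_n) (K T : R) :
  symmetric e -> (forall x, (0 < deg e x)%N) -> 1 <= K -> poincare e K ->
  4 * K * ln n%:R + 1 <= T ->
  (mixing_time e (n%:R^-1) <= T%:E)%E.
Proof.
move=> esym dgt K1 HK HT.
apply: bigmax_le => [|i _]; first by rewrite leNye.
have n0 : (0 : R) < n%:R by rewrite ltr0n (leq_trans _ (ltn_ord i)).
have n1 : (1 : R) <= n%:R by rewrite ler1n (leq_trans _ (ltn_ord i)).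
have K0 : 0 < K by apply: lt_le_trans K1.
have ln0 : 0 <= ln n%:R :> R by rewrite ln_ge0.
have T0 : 0 <= 4 * K * ln n%:R by rewrite !mulr_ge0 // ltW.
pose t0 := (Num.truncn (4 * K * ln n%:R)).+1.
apply: (@le_trans _ _ (t0%:R)%:E); last first.
  rewrite lee_fin (le_trans _ HT) // /t0 -natr1 lerD2r.
  by have /andP[] := truncn_itv T0.
apply: ereal_inf_lbound => /=; exists t0 => //= t' tt'.
apply: (le_trans (tv_dist_poincare esym dgt i t' K1 HK)).
have q0 : 0 <= 1 - K^-1 by rewrite subr_ge0 invf_le1.
(* The factor 4 in the time brings the variance below n^-4, so the L1 bound becomes n^-1 / 2. *)
have H : (1 - K^-1) ^+ t' <= (n%:R ^+ 4)^-1.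
  apply: (@le_trans _ _ (expR (- K^-1) ^+ t')).
    rewrite lerXn2r ?nnegrE ?expR_ge0 //.
    by have := expR_ge1Dx (- K^-1).
  rewrite -expRM_natl -{1}(lnK (x := n%:R)) ?posrE // -expRM_natl -expRN ler_expR.
  rewrite mulrN lerN2 ler_pdivlMr // mulrAC.
  have : t0%:R <= t'%:R :> R by rewrite ler_nat.
  apply: le_trans; have /andP[_ /ltW] := truncn_itv T0; apply: le_trans.
  by rewrite mulrAC.
rewrite mulrA -ler_pdivlMl ?mulr_gt0 // ?invr_gt0 //.
have p0 : 0 <= (2^-1 * n%:R)^-1 * n%:R^-1 :> R.
  by rewrite mulr_ge0 ?invr_ge0 ?mulr_ge0 ?invr_ge0 // ltW.
rewrite -(@ler_pXn2r _ 2) ?nnegrE ?sqrtr_ge0 ?p0 //.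
rewrite sqr_sqrtr ?exprn_ge0 //; apply: le_trans H _.
have -> : (((2^-1 * n%:R)^-1 * n%:R^-1) ^+ 2 : R) = 4 * (n%:R ^+ 4)^-1.
  by field; rewrite lt0r_neq0.
apply: ler_peMl; first by rewrite invr_ge0 exprn_ge0 // ltW.
lra.
Qed.

(** * Energy along paths and Poincare inequality on the discrete torus *)

Section PathEnergy.
Variables (R : realFieldType) (T : finType) (r : rel T) (F eps : T -> R).
Hypothesis eps_ge0 : forall x, 0 <= eps x.
Hypothesis step : forall x y, r x y -> (F x - F y) ^+ 2 <= eps x + eps y.

(** Energies sit on vertices, so a vertex inside the path pays for the two steps it belongs to:
    hence the factor 2. *)
Lemma path_energy x p : path r x p ->
  (F x - F (last x p)) ^+ 2 <= (size p)%:R * (eps x + 2 * \sum_(z <- p) eps z).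
Proof.
elim: p x => [|y p IH] x /=; first by rewrite subrr expr0n mul0r.
move=> /andP[xy yp]; have := IH _ yp; have := step xy.
rewrite big_cons -[(size p).+1%:R]natr1; set k : R := (size p)%:R; set s := \sum_(z <- p) _.
set b := F y - _; set a := F x - F y.
have -> : F x - F (last y p) = a + b by rewrite /a /b; ring.
have k0 : 0 <= k by rewrite ler0n.
have s0 : 0 <= s by apply: sumr_ge0.
have ex := eps_ge0 x; have ey := eps_ge0 y.
have kk : k = 0 \/ 0 < k by case: (ltgtP k 0) k0 => //; auto.
move=> Ha Hb; have Eb : 0 <= eps y + 2 * s by lra.
suff : (a + b) ^+ 2 <= (k + 1) * (a ^+ 2 + (eps y + 2 * s)).
  move/le_trans; apply; apply: ler_wpM2l; lra.
case: kk => [k00|kgt].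
  move: Hb; rewrite k00 mul0r => Hb.
  have /eqP : b ^+ 2 = 0 by apply/eqP; rewrite eq_le Hb sqr_ge0.
  by rewrite sqrf_eq0 => /eqP ->; rewrite addr0 add0r mul1r; lra.
rewrite -(ler_pM2l kgt); have := sqr_ge0 (k * a - b).
have : k * b ^+ 2 <= k * (k * (eps y + 2 * s)) by rewrite ler_wpM2l.
rewrite !expr2; nra.
Qed.

(** The path is first shortened to distinct vertices, all in [P]: its length is then at most [#|P|]
    and its energies sum to at most that of [P]. *)
Lemma connect_energy (P : pred T) x y :
  (forall u v, r u v -> P u && P v) -> connect r x y -> P x ->
  (F x - F y) ^+ 2 <= 2 * #|P|%:R * \sum_(z | P z) eps z.
Proof.
move=> rP /connectP[p0 xp0 ->] Px; case/shortenP: xp0 => p xp up _.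
have Pp : all P (x :: p).
  rewrite /= Px /=; elim: p x xp {up Px} => //= u p IH x /andP[/rP/andP[_ ->]] /=.
  exact: IH.
have su (q : seq T) : uniq q -> all P q -> \sum_(z <- q) eps z <= \sum_(z | P z) eps z.
  move=> uq /allP Pq; rewrite (big_uniq _ uq) /= [leRHS](bigID (mem q)) /=.
  rewrite [X in _ <= X + _](eq_bigl (mem q)) ?lerDl ?sumr_ge0 // => z.
  by rewrite andb_idl //; apply: Pq.
apply: le_trans (path_energy xp) _.
have -> : 2 * #|P|%:R * \sum_(z | P z) eps z = #|P|%:R * (2 * \sum_(z | P z) eps z).
  by rewrite mulrCA mulrA.
have sge (q : seq T) : 0 <= \sum_(z <- q) eps z by apply: sumr_ge0.
apply: ler_pM => //; first by have := eps_ge0 x; have := sge p; lra.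
  rewrite ler_nat; apply: (@leq_trans (size (x :: p))) => //.
  by rewrite cardE uniq_leq_size // => z zp; rewrite mem_enum; move/allP: Pp; apply.
have := su _ up Pp; rewrite big_cons; have := eps_ge0 x; lra.
Qed.

End PathEnergy.

Section Grid.
Variables (R : realFieldType) (d M : nat).
Notation block := {ffun 'I_d -> 'I_M}.
Implicit Types (B C : block) (k : 'I_d) (g : block -> R).

Definition upd (V : Type) (B : {ffun 'I_d -> V}) k (v : V) : {ffun 'I_d -> V} :=
  [ffun j => if j == k then v else B j].

Definition shift k B : block := upd B k (ordS (B k)).

Lemma upd_same (V : Type) (B : {ffun 'I_d -> V}) k v : upd B k v k = v.
Proof. by rewrite ffunE eqxx. Qed.

Lemma upd_other (V : Type) (B : {ffun 'I_d -> V}) k v j : j != k -> upd B k v j = B j.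
Proof. by move=> jk; rewrite ffunE (negbTE jk). Qed.

Lemma upd_id (V : Type) (B : {ffun 'I_d -> V}) k : upd B k (B k) = B.
Proof. by apply/ffunP => j; rewrite ffunE; case: eqP => // ->. Qed.

Lemma upd_upd (V : Type) (B : {ffun 'I_d -> V}) k u v : upd (upd B k u) k v = upd B k v.
Proof. by apply/ffunP => j; rewrite !ffunE; case: eqP. Qed.

Lemma connect_ordS (a b : 'I_M) : connect (fun u v : 'I_M => v == ordS u) a b.
Proof.
have it (j : nat) (c : 'I_M) : connect (fun u v : 'I_M => v == ordS u) c (iter j (@ordS M) c).
  elim: j => //= j IH; apply: (connect_trans IH); exact: connect1.
have val_it (j : nat) (c : 'I_M) : (iter j (@ordS M) c : nat) = ((c + j) %% M)%N.
  elim: j => [|j IH] /=; first by rewrite addn0 modn_small.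
  by rewrite IH addnS -addn1 modnDml addn1.
have -> : b = iter (b + M - a) (@ordS M) a.
  apply: val_inj; rewrite /= val_it.
  have := ltn_ord a; have := ltn_ord b => bM aM.
  have -> : (a + (b + M - a) = b + M)%N by lia.
  by rewrite modnDr modn_small.
exact: it.
Qed.

Lemma line_energy g k C (v : 'I_M) :
  (g C - g (upd C k v)) ^+ 2 <=
  2 * M%:R * \sum_(u : 'I_M) (g (upd C k u) - g (shift k (upd C k u))) ^+ 2.
Proof.
pose G (u : 'I_M) := g (upd C k u).
pose ep (u : 'I_M) := (g (upd C k u) - g (shift k (upd C k u))) ^+ 2.
have := @connect_energy R 'I_M (fun u v => v == ordS u) G ep
  (fun u => sqr_ge0 _) _ predT (C k) v (fun _ _ _ => isT) (connect_ordS _ _) isT.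
rewrite cardT size_enum_ord /G upd_id; apply => u w /eqP ->.
by rewrite /ep /shift upd_same !upd_upd lerDl sqr_ge0.
Qed.

(** Hybrids that turn [B] into [C] one coordinate at a time. *)
Let mix (j : nat) (B C : block) : block := [ffun k : 'I_d => if (k < j)%N then C k else B k].

(** The power [M ^ d.+2] collects the [M ^ d] choices of [C], the length [M] of a line, and the [M]
    starting points on each line. *)
Lemma sum_pair_line g k :
  \sum_(B : block) \sum_(C : block) (g B - g (upd B k (C k))) ^+ 2 <=
  2 * (M ^ d.+2)%:R * \sum_B (g B - g (shift k B)) ^+ 2.
Proof.
apply: (@le_trans _ _ (\sum_(B : block) \sum_(C : block)
   2 * M%:R * \sum_(u : 'I_M) (g (upd B k u) - g (shift k (upd B k u))) ^+ 2)).
  apply: ler_sum => B _; apply: ler_sum => C _; exact: line_energy.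
have cardB : #|{: block}| = (M ^ d)%N by rewrite card_ffun !card_ord.
rewrite (eq_bigr (fun B : block => (M ^ d)%:R * (2 * M%:R) * \sum_(u : 'I_M)
    (g (upd B k u) - g (shift k (upd B k u))) ^+ 2)); last first.
  by move=> B _; rewrite sumr_const cardB -[LHS]mulr_natl mulrA.
rewrite -mulr_sumr.
have -> : \sum_(B : block) \sum_(u : 'I_M) (g (upd B k u) - g (shift k (upd B k u))) ^+ 2
   = M%:R * \sum_(B : block) (g B - g (shift k B)) ^+ 2.
  rewrite pair_bigA /=.
  rewrite (reindex (fun p : block * 'I_M => (upd p.1 k p.2, p.1 k))) /=; last first.
    exists (fun p : block * 'I_M => (upd p.1 k p.2, p.1 k)) => -[B u] _ /=;
    by rewrite upd_same upd_upd upd_id.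
  rewrite (eq_bigr (fun p : block * 'I_M => (g p.1 - g (shift k p.1)) ^+ 2)); last first.
    by move=> [B u] _ /=; rewrite upd_upd upd_id.
  rewrite -(pair_bigA _ (fun (B : block) (u : 'I_M) => (g B - g (shift k B)) ^+ 2)) /=.
  by rewrite mulr_sumr; apply: eq_bigr => B _; rewrite sumr_const card_ord -[LHS]mulr_natl.
rewrite !expnS !natrM; set s := \sum_B _; set m : R := M%:R.
by rewrite le_eqVlt; apply/orP; left; apply/eqP; ring.
Qed.

Lemma grid_poincare g : exists c : R,
  \sum_B (g B - c) ^+ 2 <=
  d%:R * (M ^ 2)%:R * \sum_k \sum_B (g B - g (shift k B)) ^+ 2.
Proof.
have cardB : #|{: block}| = (M ^ d)%N by rewrite card_ffun !card_ord.
have [M0|M0] := posnP (M ^ d)%N.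
  exists 0; rewrite big1 ?mulr_ge0 ?sumr_ge0 // => [k _|B _].
    by apply: sumr_ge0 => B _; rewrite sqr_ge0.
  by have := fintype0 B; rewrite cardB M0 => /(_ erefl).
pose n : R := (M ^ d)%:R; have n0 : 0 < n by rewrite ltr0n.
pose s := \sum_B g B; exists (s / n).
have pairs := sum_sqr_pairs g; rewrite cardB -/n -/s in pairs.
have tel B C : g B - g C = \sum_(j < d) (g (mix j B C) - g (mix j.+1 B C)).
  rewrite -(big_mkord xpredT (fun j => g (mix j B C) - g (mix j.+1 B C))).
  rewrite (eq_bigr (fun j => - (g (mix j.+1 B C) - g (mix j B C)))); last first.
    by move=> j _; rewrite opprB.
  rewrite sumrN telescope_sumr // opprB; congr (g _ - g _).
    by apply/ffunP => k; rewrite ffunE ltn0.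
  by apply/ffunP => k; rewrite ffunE ltn_ord.
have main : \sum_(B : block) \sum_(C : block) (g B - g C) ^+ 2 <=
   d%:R * \sum_k (2 * (M ^ d.+2)%:R * \sum_B (g B - g (shift k B)) ^+ 2).
  apply: (@le_trans _ _ (\sum_(B : block) \sum_(C : block) d%:R * \sum_(k < d)
      (g (mix k B C) - g (mix k.+1 B C)) ^+ 2)).
    apply: ler_sum => B _; apply: ler_sum => C _; rewrite tel.
    have := sqr_sum_le_card predT (fun k : 'I_d => g (mix k B C) - g (mix k.+1 B C)).
    by rewrite cardT size_enum_ord.
  under eq_bigr do rewrite -mulr_sumr; rewrite -[X in X <= _]mulr_sumr; apply: ler_wpM2l => //.
  rewrite (eq_bigr (fun B => \sum_(k < d) \sum_C
      (g (mix k B C) - g (mix k.+1 B C)) ^+ 2)); last first.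
    by move=> B _; rewrite exchange_big.
  rewrite exchange_big /=; apply: ler_sum => k _.
  apply: le_trans (sum_pair_line g k); rewrite !pair_bigA /=.
  (* Exchanging the first [k] coordinates of a pair is an involution; reindexing by it turns
     [mix k B C] into [B] and [mix k.+1 B C] into [upd B k (C k)]. *)
  have mixK (B C : block) : mix k (mix k B C) (mix k C B) = B.
    by apply/ffunP => j; rewrite !ffunE; case: (j < k)%N.
  rewrite (reindex (fun p : block * block => (mix k p.1 p.2, mix k p.2 p.1))) /=; last first.
    exists (fun p : block * block => (mix k p.1 p.2, mix k p.2 p.1)) => -[B C] _ /=;
    by rewrite !mixK.
  apply: ler_sum => -[B C] _ /=; rewrite mixK.
  rewrite (_ : mix k.+1 _ _ = upd B k (C k)) //.
  apply/ffunP => j; rewrite !ffunE ltnS; case: eqP => [->|/eqP jk].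
    by rewrite leqnn ltnn.
  rewrite leq_eqVlt (_ : (j == k :> nat) = false) ?(negbTE jk) //=; last exact: negbTE jk.
  by case: (j < k)%N.
have M0R : 0 < 2 * n by rewrite mulr_gt0.
rewrite -(ler_pM2l M0R) -pairs //; apply: le_trans main _.
rewrite -mulr_sumr !expnS !natrM -/n.
by rewrite le_eqVlt; apply/orP; left; apply/eqP; ring.
Qed.

End Grid.

(** * Cells, blocks and connections through good cells *)

(** Distance on the cycle of length [m]: with truncated subtraction, the sum of both differences is
    [|a - b|]. *)
Definition tdist (m a b : nat) : nat :=
  minn (a - b + (b - a)) (m - (a - b + (b - a))).

Section Cells.
Variables (d M S : nat).
Notation block := {ffun 'I_d -> 'I_M}.
Notation cell := {ffun 'I_d -> 'I_M * 'I_S}.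
Implicit Types (A C : cell) (B : block) (k : 'I_d).

Definition blk A : block := [ffun k => (A k).1].

Definition cellnum A k : nat := ((A k).1 * S + (A k).2)%N.

Definition cadj A C := [forall k, (tdist (M * S) (cellnum A k) (cellnum C k) <= 1)%N].

Variable gd : pred cell.

Definition good_adj (Q : pred block) : rel cell := fun A C =>
  [&& gd A, gd C, cadj A C, Q (blk A) & Q (blk C)].

Lemma cadjC A C : cadj A C = cadj C A.
Proof.
apply: eq_forallb => k; rewrite /tdist.
by rewrite (addnC (cellnum A k - cellnum C k)%N).
Qed.

Lemma good_adj_sym Q : symmetric (good_adj Q).
Proof.
move=> A C; rewrite /good_adj cadjC.
by case: (gd A) (gd C) (Q _) (Q _) => [] [] [] [] //=; rewrite ?andbF.
Qed.

Lemma good_adj_connect_sym Q : connect_sym (good_adj Q).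
Proof. exact: sym_connect_sym (good_adj_sym Q). Qed.

Lemma good_adj_sub (Q Q' : pred block) A C : {subset Q <= Q'} ->
  connect (good_adj Q) A C -> connect (good_adj Q') A C.
Proof.
move=> QQ; apply: connect_sub => u v /and5P[gu gv uv Qu Qv]; apply: connect1.
apply/and5P; split => //; exact: QQ.
Qed.

Lemma cadjxx A : cadj A A.
Proof. by apply/forallP => k; rewrite /tdist subnn min0n. Qed.

Lemma cadj_step A k (u : 'I_M * 'I_S) : u.1 = (A k).1 ->
  ((A k).2 - u.2 + (u.2 - (A k).2) <= 1)%N -> cadj A (upd A k u).
Proof.
move=> u1 u2; apply/forallP => j; have [->|jk] := eqVneq j k.
  by rewrite /cellnum upd_same u1 /tdist; apply: leq_trans (geq_minl _ _) _; lia.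
by rewrite /cellnum upd_other // /tdist subnn min0n.
Qed.

(** Passage from the last layer of a block to the first layer of the next one, including the
    wrap-around to block 0. *)
Lemma cadj_cross A C k : C k = (ordS (A k).1, (C k).2) ->
  ((A k).2 = S.-1 :> nat) -> ((C k).2 = 0 :> nat) ->
  (forall j, j != k -> C j = A j) -> cadj A C.
Proof.
move=> CAk As Cs CA; apply/forallP => j; have [->|jk] := eqVneq j k; last first.
  by rewrite /cellnum CA // /tdist subnn min0n.
rewrite /cellnum As Cs CAk /=; have := ltn_ord (A k).1; have := ltn_ord (A k).2.
move: ((A k).1 : nat) ((A k).2 : nat) => a b bS aM.
have [aM1|aM1] := ltnP a.+1 M.
  rewrite modn_small // /tdist; apply: leq_trans (geq_minl _ _) _.
  rewrite mulSn; lia.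
have -> : M = a.+1 by lia.
rewrite modnn mul0n addn0 /tdist; apply: leq_trans (geq_minr _ _) _.
rewrite mulSn; lia.
Qed.

(* The hypothesis says that the coordinate box spanned by [A] and [C] inside their block
   is good; the walk moves one coordinate at a time towards [C]. *)
Lemma box_connect A C : blk A = blk C ->
  (forall C', blk C' = blk A -> (forall k, A k = C k -> C' k = A k) -> gd C') ->
  connect (good_adj (pred1 (blk A))) A C.
Proof.
pose dist (A : cell) := (\sum_k ((A k).2 - (C k).2 + ((C k).2 - (A k).2)))%N.
have [m] := ubnP (dist A); elim: m A => // m IH A Am bAC good.
have [->|AC] := eqVneq A C; first exact: connect0.
have [k Ak] : exists k, A k != C k.
  apply/existsP; move: AC; apply: contraNT => /existsPn H; apply/eqP/ffunP => k.
  by have /negPn/eqP := H k.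
have b1 j : (A j).1 = (C j).1 by have /ffunP/(_ j) := bAC; rewrite !ffunE.
have nk : ((A k).2 != (C k).2 :> nat).
  apply: contra Ak => /eqP e; apply/eqP.
  by rewrite [LHS]surjective_pairing [RHS]surjective_pairing b1 (val_inj e).
have [u [uA uC]] : exists u : 'I_S, ((A k).2 - u + (u - (A k).2) <= 1)%N /\
    (u - (C k).2 + ((C k).2 - u) < (A k).2 - (C k).2 + ((C k).2 - (A k).2))%N.
  case: (ltngtP (A k).2 (C k).2) nk => // lt _.
    have h : ((A k).2.+1 < S)%N by apply: leq_ltn_trans lt (ltn_ord _).
    by exists (Ordinal h); split => //=; lia.
  have h : ((A k).2.-1 < S)%N by apply: leq_ltn_trans (leq_pred _) (ltn_ord _).
  by exists (Ordinal h); split => //=; lia.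
pose A' := upd A k ((A k).1, u).
have bA' : blk A' = blk A.
  apply/ffunP => j; rewrite !ffunE; by case: eqP => //= ->.
have agree j : A j = C j -> A' j = A j.
  move=> e; rewrite /A' upd_other //; apply: contraNneq Ak => <-; exact/eqP.
have gA : gd A by apply: good.
have gA' : gd A' by apply: good.
apply: (@connect_trans _ _ A').
  apply: connect1; apply/and5P; split => //=; last by rewrite bA'.
  exact: cadj_step.
rewrite -bA'; apply: IH.
- apply: (@leq_trans (dist A)) => //; rewrite /dist (bigD1 k) //= [X in (_ < X)%N](bigD1 k) //=.
  rewrite -addSn; apply: leq_add; first by rewrite upd_same.
  by apply: leq_sum => j jk; rewrite upd_other.
- by rewrite bA'.
- move=> C' bC' H; apply: good; first by rewrite bC'.
  move=> j e; rewrite -(agree j e); apply: H; by rewrite agree.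
Qed.

Section Representatives.
Variables (L : nat) (k0 k1 : 'I_d).
Hypothesis k01 : k0 != k1.
Hypothesis LS : (L < S)%N.
Hypothesis few_bad : forall B k,
  (#|[pred A | ~~ gd A && ((blk A == B) || (blk A == shift k B))]| <= L)%N.

(** A slice of the block orthogonal to direction [k] and free of bad cells. *)
Definition clean k B (a : 'I_S) : Prop :=
  forall A, blk A = B -> (A k).2 = a -> gd A.

(** Pigeonhole: the at most [L < S] bad cells of both blocks cannot meet all [S] slices. One index
    serves both blocks, so that for [j != k] the two slices continue each other. *)
Lemma clean_exists B j k : exists a, clean k B a /\ clean k (shift j B) a.
Proof.
pose bad := [pred A | ~~ gd A && ((blk A == B) || (blk A == shift j B))].
have [a an] : exists a, a \notin [seq (A k).2 | A in bad].
  apply/existsP/contraT => /existsPn H.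
  have : (#|'I_S| <= #|[seq (A k).2 | A in bad]|)%N.
    by apply: subset_leq_card; apply/fintype.subsetP => a _; have /negPn := H a.
  rewrite card_ord leqNgt (leq_ltn_trans (card_size _)) // size_map -cardE.
  exact: leq_ltn_trans (few_bad B j) LS.
exists a; split=> A bA Aa; apply: contraNT an => nA; apply/mapP; exists A => //;
by rewrite mem_enum inE nA /= bA eqxx ?orbT.
Qed.

Let Sgt0 : (0 < S)%N. Proof. exact: leq_ltn_trans LS. Qed.
Let zS : 'I_S := Ordinal Sgt0.

(** A representative lies on clean slices of two directions. The passage to [shift k B] runs in a
    slice clean in both blocks, whose direction [j'] must differ from [k]; to enter it, the
    representative needs a clean slice of a direction other than [j']. *)
Lemma representatives : exists rep : block -> cell,
  [/\ forall B, blk (rep B) = B, forall B, gd (rep B),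
    forall B k, connect (good_adj (pred2 B (shift k B))) (rep B) (rep (shift k B)) &
    forall A, (forall C, blk C = blk A -> gd C) ->
      connect (good_adj (pred1 (blk A))) A (rep (blk A))].
Proof.
have c0 B : exists a, clean k0 B a by have [a []] := clean_exists B k0 k0; exists a.
have c1 B : exists a, clean k1 B a by have [a []] := clean_exists B k0 k1; exists a.
pose rep B : cell := [ffun k => (B k, if k == k0 then xget zS (clean k0 B)
   else if k == k1 then xget zS (clean k1 B) else zS)].
have brep B : blk (rep B) = B by apply/ffunP => k; rewrite !ffunE.
have rep0 B : clean k0 B (rep B k0).2.
  by rewrite ffunE eqxx /=; have [a ca] := c0 B; exact: (xgetI zS ca).
have rep1 B : clean k1 B (rep B k1).2.
  rewrite ffunE [k1 == k0]eq_sym (negbTE k01) eqxx /=.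
  by have [a ca] := c1 B; exact: (xgetI zS ca).
(* Two legs: coordinate [j] moves to its target inside the clean slice of direction [k], then the
   others follow inside the clean slice of direction [j]. *)
have inblock B k j u : k != j -> clean k B (rep B k).2 -> blk u = B ->
    clean j B (u j).2 -> connect (good_adj (pred1 B)) (rep B) u.
  move=> kj ck bu cj; pose v := upd (rep B) j (u j).
  have bv : blk v = B.
    apply/ffunP => i; rewrite !ffunE; case: eqP => [->|_] //=.
    by have /ffunP/(_ j) := bu; rewrite ffunE.
  apply: (@connect_trans _ _ v).
    rewrite -{1}(brep B); apply: box_connect => [|C bC H]; first by rewrite brep bv.
    apply: (ck _ _); first by rewrite bC brep.
    by rewrite H // /v upd_other.
  rewrite -bv; apply: box_connect => [|C bC H]; first by rewrite bv bu.
  apply: (cj _ _); first by rewrite bC bv.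
  by rewrite H /v upd_same.
have two k : exists j j', [/\ j != j', j' != k & forall B, clean j B (rep B j).2].
  have [<-|kk0] := eqVneq k0 k; first by exists k0, k1; split=> //; rewrite eq_sym.
  by exists k1, k0; split=> //; rewrite eq_sym.
exists rep; split => //.
- by move=> B; apply: (rep0 B).
- move=> B k; have [j [j' [jj' j'k cj]]] := two k.
  have [s [sB sB']] := clean_exists B k j'.
  have hS : (S.-1 < S)%N by rewrite prednK.
  (* [u] and [u'] face each other across the common face of the two blocks, both on the slice [s] of
     direction [j']. *)
  pose u : cell := [ffun i => (B i, if i == j' then s else if i == k then Ordinal hS else zS)].
  pose u' : cell := [ffun i => (shift k B i, if i == j' then s else zS)].
  have bu : blk u = B by apply/ffunP => i; rewrite !ffunE.
  have bu' : blk u' = shift k B by apply/ffunP => i; rewrite !ffunE.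
  have uj : (u j').2 = s by rewrite ffunE eqxx.
  have uj' : (u' j').2 = s by rewrite ffunE eqxx.
  apply: (@connect_trans _ _ u).
    apply: (@good_adj_sub (pred1 B)); first by move=> ? /eqP ->; rewrite !inE eqxx.
    by apply: (inblock B j j') => //; rewrite uj.
  apply: (@connect_trans _ _ u').
    apply: connect1; apply/and5P; split => //=; rewrite ?bu ?bu' ?eqxx ?orbT //.
    + exact: (sB u).
    + exact: (sB' u').
    + apply: (@cadj_cross _ _ k).
      * by rewrite !ffunE /= eqxx.
      * by rewrite ffunE /= eq_sym (negbTE j'k) eqxx.
      * by rewrite ffunE /= eq_sym (negbTE j'k).
      * by move=> i ik; rewrite !ffunE (negbTE ik).
  rewrite good_adj_connect_sym; apply: (@good_adj_sub (pred1 (shift k B))).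
    by move=> ? /eqP ->; rewrite !inE eqxx orbT.
  by apply: (inblock (shift k B) j j') => //; rewrite uj'.
- move=> A H; apply: box_connect; first by rewrite brep.
  by move=> C bC _; exact: H.
Qed.

End Representatives.
End Cells.

(** * Block distance on the torus *)

Section Balls.
Variables (d M : nat).
Notation block := {ffun 'I_d -> 'I_M}.
Implicit Types (B C : block) (k : 'I_d).

Definition bdist B C : nat := \max_k tdist M (B k) (C k).

Lemma tdistC m a b : tdist m a b = tdist m b a.
Proof. by rewrite /tdist (addnC (a - b)%N). Qed.

Lemma tdist_triangle m a b c : (a < m)%N -> (b < m)%N -> (c < m)%N ->
  (tdist m a c <= tdist m a b + tdist m b c)%N.
Proof. rewrite /tdist; lia. Qed.

Lemma bdistC B C : bdist B C = bdist C B.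
Proof. by apply: eq_bigr => k _; rewrite tdistC. Qed.

Lemma bdistxx B : bdist B B = 0%N.
Proof. by rewrite /bdist big1 // => k _; rewrite /tdist subnn min0n. Qed.

Lemma bdist_leP B C r :
  reflect (forall k, tdist M (B k) (C k) <= r)%N (bdist B C <= r)%N.
Proof.
rewrite /bdist; apply: (iffP (bigmax_leqP _ _ _)) => H k; [exact: H|by move=> _; exact: H].
Qed.

Lemma bdist_triangle B C D : (bdist B D <= bdist B C + bdist C D)%N.
Proof.
apply/bdist_leP => k.
apply: (leq_trans (tdist_triangle (ltn_ord _) (ltn_ord (C k)) (ltn_ord _))).
by apply: leq_add; exact/bdist_leP.
Qed.

Lemma card_tball (a : 'I_M) r : (#|[pred b : 'I_M | tdist M a b <= r]| <= r.*2.+1)%N.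
Proof.
have [rM|rM] := leqP M r.*2.+1.
  by apply: leq_trans (max_card _) _; rewrite card_ord.
pose f (b : 'I_M) : 'I_(r.*2.+1) := inord (if (a + r < b)%N then b + r - a - M
  else if (b + r < a)%N then b + M + r - a else b + r - a)%N.
rewrite -(card_ord r.*2.+1) -(card_in_imset (f := f)) ?max_card // => b c.
rewrite !inE /tdist => Hb Hc /(congr1 val); have aM := ltn_ord a.
have bM := ltn_ord b; have cM := ltn_ord c.
rewrite /f /= !inordK; try (case: ifP => ?; [|case: ifP => ?]; lia).
by move=> E; apply: val_inj => /=; move: E;
  case: ifP => ?; [|case: ifP => ?]; (case: ifP => ?; [|case: ifP => ?]); lia.
Qed.

Lemma card_ball B r : (#|[pred C | bdist B C <= r]| <= r.*2.+1 ^ d)%N.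
Proof.
pose F k := [pred b : 'I_M | tdist M (B k) b <= r]%N.
have -> : #|[pred C | bdist B C <= r]%N| = #|family F|.
  by apply: eq_card => C; rewrite !inE; apply/bdist_leP/forallP => H k; have := H k; rewrite !inE.
rewrite card_family.
rewrite /image_mem -[X in (_ <= _ ^ X)%N](size_enum_ord d).
elim: (enum 'I_d) => //= k s IH; rewrite expnS leq_mul //; exact: card_tball.
Qed.

Definition shift_adj : rel block := fun C D =>
  [exists k, (D == shift k C) || (C == shift k D)].

Lemma tdist_closer (a b : 'I_M) : a != b -> exists v : 'I_M,
  (v == ordS b) || (b == ordS v) /\ (tdist M a v < tdist M a b)%N.
Proof.
move=> ab; have nab : (a != b :> nat) by [].
have bM := ltn_ord b; have aM := ltn_ord a.
have oS (v : 'I_M) : (ordS v : nat) = if (v.+1 < M)%N then v.+1 else 0%N.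
  rewrite /=; have := ltn_ord v; rewrite leq_eqVlt => /orP[/eqP ->|vM].
    by rewrite modnn ltnn.
  by rewrite modn_small vM.
have oP (v : 'I_M) : (ord_pred v : nat) = if (0 < v)%N then v.-1 else M.-1.
  rewrite /=; have vM := ltn_ord v; case: posnP => [->|v0].
    by rewrite add0n modn_small; lia.
  have -> : (v + M).-1 = (v.-1 + M)%N by lia.
  by rewrite modnDr modn_small; lia.
have [H|H] : (tdist M a (ordS b) < tdist M a b)%N \/
             (tdist M a (ord_pred b) < tdist M a b)%N.
- rewrite oS oP /tdist; case: ifP => ?; case: ifP => ?; lia.
- by exists (ordS b); rewrite eqxx.
- by exists (ord_pred b); rewrite ord_predK eqxx orbT.
Qed.

(** Moving one coordinate of [C] at a time along a shortest arc towards [B] increases no coordinate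
    distance, so the path stays in the ball. *)
Lemma ball_connect B C r : (bdist B C <= r)%N ->
  connect (fun U V => [&& shift_adj U V, bdist B U <= r & bdist B V <= r]%N) B C.
Proof.
pose dist C := (\sum_k tdist M (B k) (C k))%N.
have [m] := ubnP (dist C); elim: m C => // m IH C Cm BC.
have [->|BneC] := eqVneq B C; first exact: connect0.
have [k Bk] : exists k, B k != C k.
  apply/existsP; move: BneC; apply: contraNT => /existsPn H; apply/eqP/ffunP => k.
  by have /negPn/eqP := H k.
have [v [vC dv]] := tdist_closer Bk; pose C' := upd C k v.
have BC' : (bdist B C' <= r)%N.
  apply/bdist_leP => j; have [->|jk] := eqVneq j k.
    rewrite upd_same; apply: leq_trans (ltnW dv) _; exact/bdist_leP.
  by rewrite upd_other //; exact/bdist_leP.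
apply: (@connect_trans _ _ C').
  apply: IH => //; apply: (@leq_trans (dist C)) => //.
  rewrite /dist (bigD1 k) //= [X in (_ < X)%N](bigD1 k) //= -addSn.
  apply: leq_add; first by rewrite upd_same.
  by apply: leq_sum => j jk; rewrite upd_other.
apply: connect1; rewrite BC BC' !andbT; apply/existsP; exists k.
case/orP: vC => /eqP e; apply/orP; [right|left]; apply/eqP/ffunP => j.
  by rewrite /shift /C' e; rewrite !ffunE; case: eqP => // ->.
by rewrite /shift /C' !ffunE eqxx; case: eqP => // ->.
Qed.

End Balls.

(** * Averages over cells *)

Lemma sqr_split (R : realFieldType) (x y z : R) :
  (x - z) ^+ 2 <= 2 * (x - y) ^+ 2 + 2 * (y - z) ^+ 2.
Proof. have := sqr_ge0 (x - 2 * y + z); rewrite !expr2; nra. Qed.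

Section CellAverages.
Variables (R : realType) (n d M S : nat) (e : rel 'I_n).
Notation cell := {ffun 'I_d -> 'I_M * 'I_S}.
Variables (cl : 'I_n -> cell) (lv : 'I_n -> nat) (k0 : nat).
Implicit Types (f h : 'I_n -> R) (A B : cell) (x y z : 'I_n).

Definition core A : pred 'I_n := [pred i | (cl i == A) && (0 < lv i)%N].
Definition good : pred cell := [pred A | (k0 <= #|core A|)%N].
Definition avg f A : R := (\sum_(i | core A i) f i) / #|core A|%:R.
(** Both orders of the pair are included, which makes the roles of [f] and [h] symmetric; summed
    over the nodes, each arc of the double cover is counted at both ends. *)
Definition energy f h x : R := \sum_(z | e x z) ((f x - h z) ^+ 2 + (h x - f z) ^+ 2).
Definition cell_energy f h A : R := \sum_(x | cl x == A) energy f h x.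

Hypothesis esym : symmetric e.
Hypothesis k0_ge3 : (3 <= k0)%N.
Hypothesis core_adj : forall x z, x != z -> cadj (cl x) (cl z) -> (0 < lv z)%N -> e x z.

Let kap : R := k0%:R^-1.

Lemma energyC f h x : energy f h x = energy h f x.
Proof. by apply: eq_bigr => z _; rewrite addrC. Qed.

Lemma energy_ge0 f h x : 0 <= energy f h x.
Proof. by apply: sumr_ge0 => z _; rewrite addr_ge0 ?sqr_ge0. Qed.

Lemma cell_energy_ge0 f h A : 0 <= cell_energy f h A.
Proof. by apply: sumr_ge0 => z _; rewrite energy_ge0. Qed.

Lemma sum_energy f h : \sum_x energy f h x = 2 * dirichlet e f h.
Proof.
rewrite /energy /dirichlet; under eq_bigr do rewrite big_split /=.
rewrite big_split /= mulr2n mulrDl !mul1r; congr (_ + _).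
rewrite (exchange_big_dep xpredT) //=; apply: eq_bigr => z _.
rewrite (eq_bigl (e z)) => [|x]; last by rewrite esym.
by apply: eq_bigr => x _; rewrite -[RHS]sqrrN opprB.
Qed.

Let card_ge3 A : good A -> (3 <= #|core A|)%N.
Proof. exact: leq_trans. Qed.

Let card_gt0 A : good A -> 0 < #|core A|%:R :> R.
Proof. by move=> /card_ge3 H; rewrite ltr0n; apply: leq_trans H. Qed.

Let kap_ge A : good A -> #|core A|%:R^-1 <= kap.
Proof.
move=> gA; rewrite /kap lef_pV2 ?ler_nat ?posrE ?card_gt0 // ltr0n.
exact: leq_trans k0_ge3.
Qed.

Let kap_ge0 : 0 <= kap. Proof. by rewrite invr_ge0. Qed.

Lemma core_sum_le f h A : \sum_(x | core A x) energy f h x <= cell_energy f h A.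
Proof.
rewrite /cell_energy [leRHS]big_mkcond [leLHS]big_mkcond /=; apply: ler_sum => x _.
by rewrite /core /=; case: eqP => //= _; case: ifP => // _; exact: energy_ge0.
Qed.

(** The core nodes of [B] other than [x] and [y] are common neighbours; going through the value of
    [h] there, two steps of the double cover return to the side of [f]. *)
Let two_step f h x y B : cadj (cl x) B -> core B y ->
  (#|core B|%:R - 2) * (f x - f y) ^+ 2 <= 2 * energy f h x + 2 * energy f h y.
Proof.
move=> xB cy; have /andP[/eqP clB ly] := cy.
pose Q := [predD core B & pred2 x y].
have cQ : #|core B|%:R - 2 <= #|Q|%:R :> R.
  rewrite lerBlDl -natrD ler_nat -(cardID (pred2 x y) (core B)) leq_add2r.
  apply: (@leq_trans #|pred2 x y|); last by rewrite card2; case: eqP.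
  by apply: subset_leq_card; apply/fintype.subsetP => z; rewrite !inE => /andP[].
apply: (@le_trans _ _ (#|Q|%:R * (f x - f y) ^+ 2)); first by rewrite ler_wpM2r ?sqr_ge0.
rewrite mulr_natl -sumr_const.
apply: (@le_trans _ _ (\sum_(z in Q) (2 * (f x - h z) ^+ 2 + 2 * (h z - f y) ^+ 2))).
  by apply: ler_sum => z _; exact: sqr_split.
rewrite big_split /= -!mulr_sumr.
have aux (u : 'I_n) (F G : 'I_n -> R) : (forall z, Q z -> e u z) ->
    (forall z, 0 <= F z) -> (forall z, F z <= G z) ->
    \sum_(z in Q) F z <= \sum_(z | e u z) G z.
  move=> Qe F0 FG; rewrite [leLHS]big_mkcond [leRHS]big_mkcond /=; apply: ler_sum => z _.
  case: ifP => [zQ|_]; first by rewrite Qe.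
  by case: ifP => // _; apply: le_trans (FG z).
apply: lerD; rewrite ler_wpM2l //; apply: aux => z; rewrite ?sqr_ge0 //.
- rewrite !inE negb_or => /andP[/andP[zx _] /andP[/eqP zB lz]].
  by apply: core_adj => //; rewrite ?zB // eq_sym.
- by rewrite lerDl sqr_ge0.
- rewrite !inE negb_or => /andP[/andP[_ zy] /andP[/eqP zB lz]].
  by apply: core_adj => //; rewrite ?zB ?clB ?cadjxx // eq_sym.
- by rewrite -sqrrN opprB lerDl sqr_ge0.
Qed.

Let avg_diff f A (v : R) : good A ->
  #|core A|%:R * (v - avg f A) ^+ 2 <= \sum_(y | core A y) (v - f y) ^+ 2.
Proof.
move=> gA; have k_gt0 := card_gt0 gA; set k : R := #|core A|%:R in k_gt0 *.
have E : \sum_(y | core A y) (v - f y) = k * (v - avg f A).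
  rewrite sumrB sumr_const -[X in X - _]mulr_natl -/k /avg -/k.
  by field; rewrite lt0r_neq0.
rewrite -(ler_pM2l k_gt0) mulrA -expr2 -exprMn -E.
exact: sqr_sum_le_card.
Qed.

(** [two_step] averaged over the core. With [k >= 3] core nodes, [k / (k - 2) <= 3], which gives the
    constant 6; the number of common neighbours gives the factor [kap]. *)
Lemma node_avg f h x B : good B -> cadj (cl x) B ->
  (f x - avg f B) ^+ 2 <= 6 * kap * (energy f h x + kap * cell_energy f h B).
Proof.
move=> gB xB; have k_gt0 := card_gt0 gB; have kk := kap_ge gB.
have k3 : 3 <= #|core B|%:R :> R by rewrite ler_nat card_ge3.
have H := avg_diff f (f x) gB.
have H2 : (#|core B|%:R - 2) * \sum_(y | core B y) (f x - f y) ^+ 2 <=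
   2 * #|core B|%:R * energy f h x + 2 * cell_energy f h B.
  rewrite mulr_sumr; apply: (@le_trans _ _
    (\sum_(y | core B y) (2 * energy f h x + 2 * energy f h y))).
    by apply: ler_sum => y cy; exact: two_step.
  rewrite big_split /= sumr_const -mulr_sumr -[X in X + _]mulr_natl mulrCA mulrA lerD2l.
  by rewrite ler_wpM2l // core_sum_le.
have c0 := cell_energy_ge0 f h B; have e0 := energy_ge0 f h x.
set k : R := #|core B|%:R in k_gt0 kk k3 H H2 *.
set q := (f x - avg f B) ^+ 2 in H *; set s := \sum_(y | _) _ in H H2 *.
set en := energy f h x in H2 e0 *; set ce := cell_energy f h B in H2 c0 *.
have q0 : 0 <= q by rewrite sqr_ge0.
have H3 : k * k * q <= 6 * k * en + 6 * ce.
  have : (k - 2) * (k * q) <= (k - 2) * s by rewrite ler_wpM2l //; lra.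
  have : k * (k * q) <= 3 * ((k - 2) * (k * q)).
    rewrite [leRHS]mulrA; apply: ler_wpM2r; last lra.
    by rewrite mulr_ge0 // ltW.
  rewrite mulrA; lra.
apply: (@le_trans _ _ (6 * k^-1 * (en + k^-1 * ce))); last first.
  have ki : 0 <= k^-1 by rewrite invr_ge0 ltW.
  apply: ler_pM => //.
  - by rewrite mulr_ge0.
  - by rewrite addr_ge0 // mulr_ge0.
  - by rewrite ler_wpM2l.
  - by rewrite lerD2l ler_wpM2r.
rewrite -(ler_pM2l (mulr_gt0 k_gt0 k_gt0)).
have -> : k * k * (6 * k^-1 * (en + k^-1 * ce)) = 6 * k * en + 6 * ce.
  by field; rewrite lt0r_neq0.
exact: H3.
Qed.

(** Averaging [node_avg] over the core of [A] gains a second [kap]: two adjacent good cells are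
    joined by at least order [kap ^- 2] edges. *)
Lemma avg_adj f h A B : good A -> good B -> cadj A B ->
  (avg f A - avg f B) ^+ 2 <= 6 * kap ^+ 2 * (cell_energy f h A + cell_energy f h B).
Proof.
move=> gA gB AB; have k_gt0 := card_gt0 gA; have kk := kap_ge gA.
have := avg_diff f (avg f B) gA.
have : \sum_(y | core A y) (avg f B - f y) ^+ 2 <=
   6 * kap * (cell_energy f h A + #|core A|%:R * (kap * cell_energy f h B)).
  apply: (@le_trans _ _ (\sum_(y | core A y)
     6 * kap * (energy f h y + kap * cell_energy f h B))).
    apply: ler_sum => y /andP[/eqP yA _]; rewrite -sqrrN opprB.
    by apply: node_avg => //; rewrite yA.
  rewrite -mulr_sumr ler_wpM2l ?mulr_ge0 // big_split /= sumr_const.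
  by rewrite -[X in _ + X <= _]mulr_natl lerD2r core_sum_le.
rewrite -[X in _ * X <= _ -> _]sqrrN opprB.
have cA := cell_energy_ge0 f h A; have cB := cell_energy_ge0 f h B.
set k : R := #|core A|%:R in k_gt0 kk *; move: (\sum_(y | _) _) => s.
set ca := cell_energy f h A in cA *; set cb := cell_energy f h B in cB *.
move=> H1 H2; have {H1 H2} H := le_trans H2 H1.
rewrite -(ler_pM2l k_gt0); apply: le_trans H _.
have : 1 <= k * kap.
  by rewrite -[leLHS](mulfV (lt0r_neq0 k_gt0)) ler_wpM2l // ltW.
move: kap kap_ge0 {kk} => K K0 kk.
have -> : k * (6 * K ^+ 2 * (ca + cb)) = 6 * K * ((k * K) * ca + k * (K * cb)) by ring.
rewrite ler_wpM2l ?mulr_ge0 // lerD2r.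
exact: ler_peMl.
Qed.

(** The core is a complete graph: [f y - h z] summed over its ordered pairs of distinct nodes is
    [k - 1] times the difference of the sums of [f] and [h]. This is how a value of [h] is exchanged
    for one of [f]. *)
Lemma avg_swap f h A : good A ->
  (avg f A - avg h A) ^+ 2 <= 2 * kap ^+ 2 * cell_energy f h A.
Proof.
move=> gA; have k_gt0 := card_gt0 gA; have kk := kap_ge gA.
have k3 : 3 <= #|core A|%:R :> R by rewrite ler_nat card_ge3.
pose k : R := #|core A|%:R.
pose F := \sum_(i | core A i) f i; pose H := \sum_(i | core A i) h i.
have cQ y : core A y -> #|[predD1 core A & y]|%:R = k - 1.
  move=> cy; rewrite /k [in RHS](cardD1 y).
  have -> : y \in core A by [].
  by rewrite natrD /= addrAC subrr add0r.
have E : \sum_(y | core A y) \sum_(z in [predD1 core A & y]) (f y - h z) = (k - 1) * (F - H).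
  transitivity (\sum_(y | core A y) ((k - 1) * f y + h y - H)).
    apply: eq_bigr => y cy; rewrite sumrB sumr_const -[X in X - _]mulr_natl cQ //.
    rewrite /H [\sum_(i | core A i) h i](bigD1 y) //=.
    have -> : \sum_(z in [predD1 core A & y]) h z = \sum_(i | core A i && (i != y)) h i.
      by apply: eq_bigl => z; rewrite !inE andbC.
    ring.
  rewrite sumrB big_split /= -mulr_sumr sumr_const -[X in _ - X]mulr_natl -/k -/F -/H.
  ring.
have E2 : ((k - 1) * (F - H)) ^+ 2 <= k * ((k - 1) * cell_energy f h A).
  rewrite -E; apply: le_trans (sqr_sum_le_card _ _) _; rewrite ler_wpM2l //.
  apply: (@le_trans _ _ (\sum_(y | core A y) (k - 1) * energy f h y)).
    apply: ler_sum => y cy; apply: le_trans (sqr_sum_le_card _ _) _.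
    rewrite cQ // ler_wpM2l //; first by rewrite subr_ge0 /k; lra.
    rewrite /energy [leLHS]big_mkcond [leRHS]big_mkcond; apply: ler_sum => z _.
    case: ifP => [|_]; last by case: ifP => // _; rewrite addr_ge0 ?sqr_ge0.
    rewrite !inE => /andP[zy /andP[/eqP zA lz]].
    rewrite core_adj ?lerDl ?sqr_ge0 // 1?eq_sym // zA.
    by case/andP: cy => /eqP -> _; rewrite cadjxx.
  rewrite -mulr_sumr ler_wpM2l ?core_sum_le // subr_ge0 /k; lra.
have -> : avg f A - avg h A = (F - H) / k by rewrite /avg mulrBl.
have c0 := cell_energy_ge0 f h A.
rewrite -/k in k_gt0 kk k3.
move: E2; set ce := cell_energy f h A in c0 *; set q := F - H => E2.
have Q2 : k * q ^+ 2 <= 2 * k * ce.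
  have k1 : 0 < k - 1 by lra.
  have : (k - 1) * q ^+ 2 <= k * ce.
    rewrite -(ler_pM2l k1).
    have -> : (k - 1) * ((k - 1) * q ^+ 2) = ((k - 1) * q) ^+ 2 by ring.
    by have -> : (k - 1) * (k * ce) = k * ((k - 1) * ce) by ring.
  have : q ^+ 2 <= (k - 1) * q ^+ 2 by apply: ler_peMl; rewrite ?sqr_ge0 //; lra.
  move=> *; have : k * q ^+ 2 = (k - 1) * q ^+ 2 + q ^+ 2 by ring.
  lra.
rewrite exprMn.
apply: (@le_trans _ _ (2 * ce * k^-1 ^+ 2)); last first.
  rewrite mulrAC ler_wpM2r // ler_wpM2l // lerXn2r // ?nnegrE // invr_ge0.
  exact: ltW.
rewrite ler_wpM2r ?sqr_ge0 //.
by rewrite -(ler_pM2l k_gt0); have -> : k * (2 * ce) = 2 * k * ce by ring.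
Qed.

End CellAverages.

(** * Confinement of badly connected nodes *)

Lemma connect_invariant (T : finType) (r : rel T) (W : pred T) x u :
  connect r x u -> (forall v, connect r x v -> W v) ->
  connect (fun a b => [&& r a b, W a & W b]) x u.
Proof.
move=> /connectP[p xp ->] H; elim/last_ind: p xp => [|p y IH]; first by [].
rewrite rcons_path last_rcons => /andP[xp py].
have cp : connect r x (last x p) by apply/connectP; exists p.
apply: (connect_trans (IH xp)); apply: connect1; rewrite py !H //.
exact: connect_trans cp (connect1 py).
Qed.

(** Discrete intermediate values: steps that rise by at most [J] cannot skip a band of width [J]. *)
Lemma path_level (T : finType) (r : rel T) (dd : T -> nat) J t x p :
  (forall u v, r u v -> dd v <= dd u + J)%N -> path r x p ->
  (dd x < t + J)%N -> (t + J <= dd (last x p))%N ->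
  exists2 v, v \in x :: p & (t <= dd v < t + J)%N.
Proof.
move=> H; elim: p x => [|y p IH] x /=; first by move=> _; lia.
move=> /andP[xy yp] xt pt; have [yt|yt] := ltnP (dd y) (t + J).
  by have [v vp vt] := IH _ yp yt pt; exists v => //; rewrite inE vp orbT.
exists x; rewrite ?inE ?eqxx //; have := H _ _ xy; lia.
Qed.

Lemma bdist_shift d M (B : {ffun 'I_d -> 'I_M}) k : (bdist B (shift k B) <= 1)%N.
Proof.
apply/bdist_leP => j; have [->|jk] := eqVneq j k; last first.
  by rewrite /shift upd_other // /tdist subnn min0n.
rewrite /shift upd_same /= /tdist; have := ltn_ord (B k).
move: (B k : nat) => b bM; have [bM1|h] := ltnP b.+1 M; first by rewrite modn_small //; lia.
have -> : M = b.+1 by lia.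
rewrite modnn; lia.
Qed.

Lemma card_block d M S (B : {ffun 'I_d -> 'I_M}) :
  (#|[pred A : {ffun 'I_d -> 'I_M * 'I_S} | blk A == B]| <= S ^ d)%N.
Proof.
have -> : (S ^ d)%N = #|{: {ffun 'I_d -> 'I_S}}| by rewrite card_ffun !card_ord.
pose F (A : {ffun 'I_d -> 'I_M * 'I_S}) : {ffun 'I_d -> 'I_S} := [ffun k => (A k).2].
rewrite -(card_in_imset (f := F)) ?max_card // => A C.
rewrite !inE => /eqP bA /eqP bC /ffunP H; apply/ffunP => k.
have := H k; rewrite !ffunE => e2.
have : blk A k = blk C k by rewrite bA bC.
by rewrite !ffunE => e1; rewrite [LHS]surjective_pairing [RHS]surjective_pairing e1 e2.
Qed.

Section Confinement.
Variables (n d M S : nat) (e : rel 'I_n).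
Notation block := {ffun 'I_d -> 'I_M}.
Notation cell := {ffun 'I_d -> 'I_M * 'I_S}.
Variables (cl : 'I_n -> cell) (lv : 'I_n -> nat) (k0 L K0 J rho Rw : nat).
Variable rep : block -> cell.
Implicit Types (A : cell) (B : block) (x z u v : 'I_n).

Local Notation good := (good cl lv k0).
Local Notation core := (core cl lv).
Local Notation bl x := (blk (cl x)).

(** Only the cell matters: by [node_avg] even a light node is tied to the core of its cell when that
    cell is good. *)
Definition linked x : bool :=
  good (cl x) && connect (good_adj good (pred1 (bl x))) (cl x) (rep (bl x)).

Definition isolated x : bool := ~~ linked x && [forall z, e x z ==> ~~ linked z].

Hypothesis k0_gt0 : (0 < k0)%N.
Hypothesis J_gt0 : (0 < J)%N.
Hypothesis conn : graph_connected e.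
Hypothesis blk_rep : forall B, blk (rep B) = B.
Hypothesis good_rep : forall B, good (rep B).
Hypothesis rep_full : forall A, (forall C, blk C = blk A -> good C) ->
  connect (good_adj good (pred1 (blk A))) A (rep (blk A)).
Hypothesis heavy_adj : forall x z, x != z -> bl x = bl z -> (K0 <= lv x)%N -> e x z.
Hypothesis light_near : forall x z, e x z -> (lv x < K0)%N -> (lv z < K0)%N ->
  (bdist (bl x) (bl z) <= J)%N.
Hypothesis adj_near : forall x z, e x z -> (bdist (bl x) (bl z) <= rho)%N.
Hypothesis few_bad : forall B,
  (#|[pred A | ~~ good A && (bdist B (blk A) <= Rw)]| <= L)%N.
Hypothesis JRw : (L.+1 * J <= Rw)%N.

Lemma core_rep B : exists z, core (rep B) z.
Proof. by apply/card_gt0P; apply: leq_trans (good_rep B). Qed.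

Lemma core_rep_linked B z : core (rep B) z -> linked z.
Proof.
by case/andP => /eqP cz _; rewrite /linked cz good_rep blk_rep connect0.
Qed.

(** A node of level [K0] or more is adjacent to its whole block, in particular to the core nodes of
    the representative cell, which are linked. *)
Lemma isolated_light x : isolated x -> (lv x < K0)%N.
Proof.
case/andP => nl /forallP H; rewrite ltnNge; apply/negP => Kx.
have [z cz] := core_rep (bl x); have lz := core_rep_linked cz.
have xz : x != z by apply: contraNneq nl => ->.
have := H z; rewrite heavy_adj ?lz //.
by case/andP: cz => /eqP ->; rewrite blk_rep.
Qed.

Lemma unlinked_bad x : ~~ linked x -> exists A, ~~ good A /\ blk A = bl x.
Proof.
move=> nl; have [/existsP[A /andP[nA /eqP bA]]|] :=
  boolP [exists A, ~~ good A && (blk A == bl x)]; first by exists A.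
rewrite negb_exists => /forallP H; case/negP: nl.
have G C : blk C = bl x -> good C.
  by move=> bC; have := H C; rewrite bC eqxx andbT negbK.
by rewrite /linked G //= rep_full.
Qed.

Let iso_adj : rel 'I_n := fun x z => [&& e x z, isolated x & isolated z].

(* A chain of isolated nodes leaving the window would meet a bad cell in each of the
   L + 1 disjoint annuli of width J around its starting block. *)
Lemma isolated_confined x u : isolated x -> connect iso_adj x u ->
  (bdist (bl x) (bl u) <= Rw)%N.
Proof.
move=> ix /connectP[p xp ->]; rewrite leqNgt; apply/negP => far.
pose dd v := bdist (bl x) (bl v).
have stepJ a b : iso_adj a b -> (dd b <= dd a + J)%N.
  case/and3P => ab ia ib; apply: leq_trans (bdist_triangle _ (bl a) _) _.
  by rewrite leq_add2l light_near // isolated_light.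
have isop : all isolated (x :: p).
  rewrite /= ix /=; elim: p x xp {ix far dd stepJ} => //= y p IH x /andP[/and3P[_ _ ->] yp].
  exact: IH yp.
have lev (j : 'I_L.+1) : exists A,
    [/\ ~~ good A, (j * J <= bdist (bl x) (blk A))%N &
        (bdist (bl x) (blk A) < j * J + J)%N].
  have jL : (j * J + J <= L.+1 * J)%N by rewrite addnC -mulSn leq_mul2r ltn_ord orbT.
  have [||v vp /andP[v1 v2]] := path_level (dd := dd) (J := J) (t := (j * J)%N) stepJ xp.
  - by rewrite /dd bdistxx addn_gt0 J_gt0 orbT.
  - by apply: leq_trans jL _; apply: leq_trans JRw _; apply: ltnW.
  have iv : isolated v by move/allP: isop; apply.
  have [A [nA bA]] : exists A, ~~ good A /\ blk A = bl v.
    by apply: unlinked_bad; case/andP: iv.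
  by exists A; rewrite bA.
have [F FP] := fin_all_exists lev.
have Finj : injective F.
  move=> i j Fij; apply: val_inj => /=.
  have [_ i1 i2] := FP i; have [_ j1 j2] := FP j; rewrite Fij in i1 i2.
  have : (i * J < j.+1 * J)%N by rewrite mulSn; lia.
  have : (j * J < i.+1 * J)%N by rewrite mulSn; lia.
  by rewrite !ltn_pmul2r // !ltnS; lia.
have : (L.+1 <= #|[pred A | ~~ good A && (bdist (bl x) (blk A) <= Rw)%N]|)%N.
  rewrite -[L.+1]card_ord -(card_imset _ Finj); apply: subset_leq_card.
  apply/fintype.subsetP => A /imsetP[j _ ->]; have [nF _ F2] := FP j.
  rewrite inE nF /=; apply: leq_trans JRw; apply: leq_trans (ltnW F2) _.
  by rewrite addnC -mulSn leq_mul2r ltn_ord orbT.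
by rewrite ltnNge few_bad.
Qed.

(** The first node [y] that is not isolated follows an isolated one, so it is not linked; hence it
    has a linked neighbour. *)
Lemma exit_path x p : path e x p -> linked (last x p) -> isolated x ->
  exists u y z, [/\ connect iso_adj x u, e u y, e y z & linked z].
Proof.
elim: p x => [|y p IH] x /=; first by move=> _ lx; rewrite /isolated lx.
move=> /andP[xy yp] lp ix; have [iy|] := boolP (isolated y).
  have [u [v [z [yu uv vz lz]]]] := IH _ yp lp iy.
  exists u, v, z; split=> //; apply: connect_trans yu; apply: connect1.
  exact/and3P.
have nly : ~~ linked y by case/andP: ix => _ /forallP/(_ y); rewrite xy.
rewrite /isolated nly /= negb_forall => /existsP[z]; rewrite negb_imply negbK.
by case/andP => yz lz; exists x, y, z.
Qed.

Definition near_adj x : rel 'I_n := fun u v =>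
  [&& e u v, bdist (bl x) (bl u) <= Rw + rho.*2 & bdist (bl x) (bl v) <= Rw + rho.*2]%N.

(** The isolated stretch of a path to a linked node stays within [Rw]; the two edges that leave it
    add at most [rho] each, whence the radius [Rw + rho.*2]. *)
Lemma linked_nearby x : exists z, linked z /\ connect (near_adj x) x z.
Proof.
have near1 u v : e u v -> (bdist (bl x) (bl u) <= Rw + rho)%N -> near_adj x u v.
  move=> uv hu; rewrite /near_adj uv /=; apply/andP; split; first by lia.
  apply: leq_trans (bdist_triangle _ (bl u) _) _.
  by have := adj_near uv; lia.
have [lx|nlx] := boolP (linked x); first by exists x; rewrite connect0.
have [/existsP[z /andP[xz lz]]|nz] := boolP [exists z, e x z && linked z].
  by exists z; split=> //; apply: connect1; apply: near1; rewrite // bdistxx.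
have ix : isolated x.
  rewrite /isolated nlx; apply/forallP => z; rewrite implybE -negb_and.
  by move: nz; rewrite negb_exists => /forallP.
have [c0 cc] := core_rep (bl x).
have /connectP[p xp lp] := conn x c0.
have [|u [y [z [xu uy yz lz]]]] := exit_path xp _ ix.
  by rewrite -lp; exact: core_rep_linked cc.
exists z; split=> //; have du := isolated_confined ix xu.
apply: (@connect_trans _ _ u).
  pose W v := (bdist (bl x) (bl v) <= Rw)%N.
  have := connect_invariant (W := W) xu (fun v => isolated_confined ix).
  apply: connect_sub => a b /and3P[/and3P[ab _ _] Wa _]; apply: connect1.
  by apply: near1 => //; apply: leq_trans Wa _; lia.
apply: (@connect_trans _ _ y); apply: connect1; apply: near1 => //.
  by apply: leq_trans du _; lia.
by apply: leq_trans (bdist_triangle _ (bl u) _) _; apply: leq_add => //; exact: adj_near.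
Qed.

End Confinement.

(** * Poincare inequality for the graph *)

Section CellPoincare.
Variables (R : realType) (n d M S : nat) (e : rel 'I_n).
Notation block := {ffun 'I_d -> 'I_M}.
Notation cell := {ffun 'I_d -> 'I_M * 'I_S}.
Variables (cl : 'I_n -> cell) (lv : 'I_n -> nat) (k0 L K0 J rho Rw D w : nat).
Variables (i0 i1 : 'I_d).
Implicit Types (A : cell) (B : block) (x z u v : 'I_n) (f h : 'I_n -> R).

Local Notation good := (good cl lv k0).
Local Notation core := (core cl lv).
Local Notation bl x := (blk (cl x)).
Local Notation avg := (avg cl lv).
Local Notation R2 := (Rw + rho.*2)%N.

Hypothesis esym : symmetric e.
Hypothesis conn : graph_connected e.
Hypothesis i01 : i0 != i1.
Hypothesis k0_ge3 : (3 <= k0)%N.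
Hypothesis J_gt0 : (0 < J)%N.
Hypothesis LS : (L < S)%N.
Hypothesis core_adj : forall x z, x != z -> cadj (cl x) (cl z) -> (0 < lv z)%N -> e x z.
Hypothesis heavy_adj : forall x z, x != z -> bl x = bl z -> (K0 <= lv x)%N -> e x z.
Hypothesis light_near : forall x z, e x z -> (lv x < K0)%N -> (lv z < K0)%N ->
  (bdist (bl x) (bl z) <= J)%N.
Hypothesis adj_near : forall x z, e x z -> (bdist (bl x) (bl z) <= rho)%N.
Hypothesis few_up : forall x, (#|[pred z | e x z && (lv x <= lv z)]| <= D)%N.
Hypothesis few_in_block : forall B, (#|[pred z | bl z == B]| <= D)%N.
Hypothesis few_bad : forall B,
  (#|[pred A | ~~ good A && (bdist B (blk A) <= Rw)]| <= L)%N.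
Hypothesis JRw : (L.+1 * J <= Rw)%N.
Hypothesis ball_w : forall B, (#|[pred C | bdist B C <= R2]| <= w)%N.

Let kap : R := k0%:R^-1.
Let Sd : R := (S ^ d)%:R.

Let kap_ge0 : 0 <= kap. Proof. by rewrite invr_ge0. Qed.
Let kap_le : kap <= 3^-1.
Proof. by rewrite lef_pV2 ?ler_nat ?posrE // ltr0n; apply: leq_trans k0_ge3. Qed.
Let Sd_ge1 : 1 <= Sd.
Proof. by rewrite ler1n expn_gt0 (leq_ltn_trans _ LS). Qed.

Definition blk_energy f h B : R := \sum_(x | bl x == B) energy e f h x.
Definition win_energy f h B : R := \sum_(C | (bdist B C <= R2)%N) blk_energy f h C.

Let tot f h : R := \sum_x energy e f h x.

Lemma blk_energyC f h B : blk_energy f h B = blk_energy h f B.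
Proof. by apply: eq_bigr => x _; rewrite energyC. Qed.

Lemma win_energyC f h B : win_energy f h B = win_energy h f B.
Proof. by apply: eq_bigr => C _; rewrite blk_energyC. Qed.

Let blk_energy_ge0 f h B : 0 <= blk_energy f h B.
Proof. by apply: sumr_ge0 => x _; exact: energy_ge0. Qed.

Let win_energy_ge0 f h B : 0 <= win_energy f h B.
Proof. by apply: sumr_ge0 => x _. Qed.

Let tot_ge0 f h : 0 <= tot f h.
Proof. by apply: sumr_ge0 => x _; exact: energy_ge0. Qed.

Let sum_blk f h : \sum_B blk_energy f h B = tot f h.
Proof. by rewrite /tot (partition_big (fun x => bl x) xpredT). Qed.

Let sum_cells f h (Q : pred block) :
  \sum_(A | Q (blk A)) cell_energy e cl f h A = \sum_(B | Q B) blk_energy f h B.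
Proof.
have -> : \sum_(A | Q (blk A)) cell_energy e cl f h A =
    \sum_(x | Q (bl x)) energy e f h x.
  rewrite (partition_big cl (fun A => Q (blk A))) //=.
  apply: eq_bigr => A QA; apply: eq_bigl => x.
  by case: eqP => [->|]; rewrite ?QA ?andbF.
rewrite (partition_big (fun x => bl x) Q) //=.
by apply: eq_bigr => B QB; apply: eq_bigl => x; case: eqP => [->|]; rewrite ?QB ?andbF.
Qed.

Let cell_le_blk f h A : cell_energy e cl f h A <= blk_energy f h (blk A).
Proof.
have -> : blk_energy f h (blk A) = \sum_(B | pred1 (blk A) B) blk_energy f h B.
  by rewrite big_pred1_eq.
rewrite -sum_cells (bigD1 A) ?eqxx //= lerDl.
by apply: sumr_ge0 => C _; exact: cell_energy_ge0.
Qed.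

Let sum_win f h : \sum_B win_energy f h B <= w%:R * tot f h.
Proof.
rewrite /win_energy (exchange_big_dep xpredT) //= -sum_blk mulr_sumr.
apply: ler_sum => C _; rewrite sumr_const mulr_natl.
apply: ler_wpMn2l => //; apply: leq_trans (ball_w C).
by apply: subset_leq_card; apply/fintype.subsetP => B; rewrite !inE bdistC.
Qed.

Let sum_nodes (F : block -> R) : (forall B, 0 <= F B) ->
  \sum_x F (bl x) <= D%:R * \sum_B F B.
Proof.
move=> F0; rewrite (partition_big (fun x => bl x) xpredT) //= mulr_sumr.
apply: ler_sum => B _; rewrite (eq_bigr (fun=> F B)); last by move=> x /eqP ->.
by rewrite sumr_const mulr_natl; apply: ler_wpMn2l => //; exact: few_in_block.
Qed.

Let cells_connect f h (Q : pred block) A C : Q (blk A) ->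
  connect (good_adj good Q) A C ->
  (avg f A - avg f C) ^+ 2 <=
  2 * (#|Q|%:R * Sd) * (6 * kap ^+ 2) * \sum_(B | Q B) blk_energy f h B.
Proof.
move=> QA AC; rewrite -sum_cells.
have c6 : 0 <= 6 * kap ^+ 2 by rewrite mulr_ge0 ?sqr_ge0.
have H := connect_energy (F := avg f)
  (eps := fun A => 6 * kap ^+ 2 * cell_energy e cl f h A)
  (P := [pred A | Q (blk A)]) _ _ _ AC QA.
apply: le_trans (H _ _ _) _.
- by move=> U; rewrite mulr_ge0 // cell_energy_ge0.
- move=> U V /and5P[gU gV UV _ _]; rewrite -mulrDr.
  exact: avg_adj.
- by move=> U V /and5P[_ _ _ /= -> ->].
rewrite -mulr_sumr mulrA ler_wpM2r //.
  by apply: sumr_ge0 => U _; exact: cell_energy_ge0.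
rewrite ler_wpM2r // ler_wpM2l //.
rewrite -natrM ler_nat -sum1_card (partition_big (@blk d M S) Q) //=.
apply: (@leq_trans (\sum_(B | Q B) S ^ d)); last by rewrite sum_nat_const.
apply: leq_sum => B _; rewrite sum1dep_card; apply: leq_trans (card_block S B).
by apply: subset_leq_card; apply/fintype.subsetP => U; rewrite !inE => /andP[].
Qed.

(** In order: the arcs of [charge_low], the comparison of nodes with their representative, the
    exchange of [h] for [f], and the torus of blocks. The outer 2 appears because the total energy
    is twice the Dirichlet form. *)
Definition poincare_const : R :=
  2 * (1 + 8 * D%:R * (12 * kap + 36 * Sd * kap ^+ 2 * D%:R +
      112 * Sd * (w ^ 2)%:R * (D ^ 2)%:R)
    + 16 * D%:R ^+ 2 * kap ^+ 2
    + 480 * D%:R ^+ 2 * ((d ^ 2)%:R * Sd * (M ^ 2)%:R * kap ^+ 2)).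

Section WithRepresentatives.
Variable rep : block -> cell.
Hypothesis blk_rep : forall B, blk (rep B) = B.
Hypothesis good_rep : forall B, good (rep B).
Hypothesis rep_full : forall A, (forall C, blk C = blk A -> good C) ->
  connect (good_adj good (pred1 (blk A))) A (rep (blk A)).
Hypothesis rep_adj : forall B k,
  connect (good_adj good (pred2 B (shift k B))) (rep B) (rep (shift k B)).

Let g f B : R := avg f (rep B).
Local Notation linked := (linked cl lv k0 rep).

Let kap2_ge0 : 0 <= kap ^+ 2. Proof. exact: sqr_ge0. Qed.
Let kap2_le : kap ^+ 2 <= 9^-1.
Proof.
have -> : 9^-1 = (3^-1) ^+ 2 :> R by field.
by rewrite lerXn2r ?nnegrE ?invr_ge0.
Qed.

Let Sd_ge0 : 0 <= Sd. Proof. exact: le_trans ler01 Sd_ge1. Qed.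

Let rep_step f h B k : (g f B - g f (shift k B)) ^+ 2 <=
  24 * Sd * kap ^+ 2 * (blk_energy f h B + blk_energy f h (shift k B)).
Proof.
have Q0 : pred2 B (shift k B) (blk (rep B)) by rewrite /= blk_rep eqxx.
apply: le_trans (cells_connect f h Q0 (rep_adj B k)) _.
apply: ler_pM.
- by rewrite !mulr_ge0.
- by apply: sumr_ge0.
- have -> : 24 * Sd * kap ^+ 2 = 2 * (2 * Sd) * (6 * kap ^+ 2) by ring.
  rewrite ler_wpM2r ?mulr_ge0 // ler_wpM2l // ler_wpM2r // ler_nat card2.
  by case: eqP.
- rewrite (bigD1 B) /= ?eqxx // lerD2l.
  (* For [M = 1] a shift fixes every block and the two blocks coincide. *)
  have [->|nB] := eqVneq (shift k B) B.
    rewrite big1 // => C /andP[/orP[/eqP ->|/eqP ->]]; by rewrite eqxx.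
  rewrite (bigD1 (shift k B)) /=; last by rewrite eqxx orbT.
  rewrite big1 ?addr0 // => C /andP[/andP[/orP[/eqP ->|/eqP ->]]];
  by rewrite eqxx.
Qed.

Let block_poincare f h : exists c : R, \sum_B (g f B - c) ^+ 2 <=
  48 * (d ^ 2)%:R * Sd * (M ^ 2)%:R * kap ^+ 2 * tot f h.
Proof.
have [c Hc] := grid_poincare (g f); exists c; apply: le_trans Hc _.
apply: (@le_trans _ _ (d%:R * (M ^ 2)%:R * \sum_(k < d) \sum_B
  24 * Sd * kap ^+ 2 * (blk_energy f h B + blk_energy f h (shift k B)))).
  rewrite ler_wpM2l ?mulr_ge0 //; apply: ler_sum => k _; apply: ler_sum => B _.
  exact: rep_step.
rewrite (eq_bigr (fun=> 48 * Sd * kap ^+ 2 * tot f h)); last first.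
  move=> k _; rewrite -mulr_sumr big_split /= sum_blk.
  have -> : \sum_B blk_energy f h (shift k B) = tot f h.
    rewrite -sum_blk [RHS](reindex (shift k)) //=.
    exists (fun B => upd B k (ord_pred (B k))) => B _;
    by rewrite /shift upd_same upd_upd ?ordSK ?ord_predK upd_id.
  ring.
rewrite sumr_const card_ord -[X in _ * X]mulr_natl expnS expn1 natrM.
by rewrite le_eqVlt; apply/orP; left; apply/eqP; ring.
Qed.

Let linked_rep f h x : linked x -> (f x - g f (bl x)) ^+ 2 <=
  12 * kap * energy e f h x + 36 * Sd * kap ^+ 2 * blk_energy f h (bl x).
Proof.
case/andP => gx cx; apply: le_trans (sqr_split _ (avg f (cl x)) _) _.
have H1 := node_avg k0_ge3 core_adj f h gx (cadjxx _).
have H2 := cells_connect f h (Q := pred1 (bl x)) (eqxx _) cx.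
rewrite card1 mul1r big_pred1_eq in H2.
have H3 := cell_le_blk f h (cl x); have H4 := cell_energy_ge0 e cl f h (cl x).
have H5 := blk_energy_ge0 f h (bl x).
rewrite -/(g f (bl x)) -/kap in H1 H2 *.
set a := (f x - _) ^+ 2 in H1 *; set b := (_ - _) ^+ 2 in H2 *.
set bE := blk_energy _ _ _ in H2 H3 H5 *; set cE := cell_energy _ _ _ _ _ in H1 H3 H4.
have H6 : kap ^+ 2 * cE <= Sd * kap ^+ 2 * bE.
  apply: (@le_trans _ _ (kap ^+ 2 * bE)); first by rewrite ler_wpM2l.
  by rewrite -mulrA ler_peMl // mulr_ge0.
have -> : 36 * Sd * kap ^+ 2 * bE = 36 * (Sd * kap ^+ 2 * bE) by ring.
have -> : 12 * kap * energy e f h x = 12 * (kap * energy e f h x) by ring.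
have E1 : 6 * kap * (energy e f h x + kap * cE) =
  6 * (kap * energy e f h x) + 6 * (kap ^+ 2 * cE) by ring.
have E2 : 2 * Sd * (6 * kap ^+ 2) * bE = 12 * (Sd * kap ^+ 2 * bE) by ring.
rewrite E1 in H1; rewrite E2 in H2; lra.
Qed.

Let rep_swap f h B : (g f B - g h B) ^+ 2 <= 2 * kap ^+ 2 * blk_energy f h B.
Proof.
apply: le_trans (avg_swap k0_ge3 core_adj f h (good_rep B)) _.
rewrite ler_wpM2l ?mulr_ge0 //; have := cell_le_blk f h (rep B).
by rewrite blk_rep.
Qed.

Let blk_le_win f h B C : (bdist B C <= R2)%N -> blk_energy f h C <= win_energy f h B.
Proof. by move=> BC; rewrite /win_energy (bigD1 C) //= lerDl sumr_ge0. Qed.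

Let energy_le_blk f h x : energy e f h x <= blk_energy f h (bl x).
Proof.
rewrite /blk_energy (bigD1 x) //= lerDl sumr_ge0 // => z _; exact: energy_ge0.
Qed.

(** The path of blocks stays in the window, so only window energy is spent. This bound may be crude:
    [kap ^ 2] is replaced by 1/9. *)
Let win_connect f h B C : (bdist B C <= R2)%N ->
  (g f B - g f C) ^+ 2 <= 6 * w%:R * Sd * win_energy f h B.
Proof.
move=> BC; have H := connect_energy (F := g f)
  (eps := fun C => 24 * Sd * kap ^+ 2 * blk_energy f h C)
  (P := [pred C | bdist B C <= R2]%N) _ _ _ (ball_connect BC) _.
apply: le_trans (H _ _ _ _) _.
- by move=> U; rewrite !mulr_ge0.
- move=> U V /and3P[/existsP[k /orP[/eqP ->|/eqP ->]] _ _].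
    by rewrite -mulrDr; exact: rep_step.
  by rewrite -sqrrN opprB [leRHS]addrC -mulrDr; exact: rep_step.
- by move=> U V /and3P[_ /= -> ->].
- by rewrite /= bdistxx.
rewrite -mulr_sumr mulrA -/(win_energy f h B) ler_wpM2r //.
apply: (@le_trans _ _ (2 * w%:R * (24 * Sd * 9^-1))).
  by apply: ler_pM; rewrite ?mulr_ge0 ?ler_wpM2l ?ler_nat ?ball_w // ?mulr_ge0.
have : 0 <= w%:R * Sd by rewrite mulr_ge0.
rewrite !mulrA; lra.
Qed.

Let win_nodes B : (#|[pred x | bdist B (bl x) <= R2]| <= w * D)%N.
Proof.
rewrite -sum1_card (partition_big (fun x => bl x) (fun C => bdist B C <= R2)%N) //=.
apply: (@leq_trans (\sum_(C | (bdist B C <= R2)%N) D)).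
  apply: leq_sum => C _; rewrite sum1dep_card; apply: leq_trans (few_in_block C).
  by apply: subset_leq_card; apply/fintype.subsetP => x; rewrite !inE => /andP[].
by rewrite sum_nat_const leq_mul2r ball_w orbT.
Qed.

(* Alternating between the two sides [f], [h] of the double cover turns a path of the
   graph into a path of the cover, whose endpoint may lie on either side. *)
Let path_cover f h x z : connect (near_adj e cl rho Rw x) x z ->
  exists b : bool, (f x - (if b then h z else f z)) ^+ 2 <=
    8 * (w * D)%:R * win_energy f h (bl x).
Proof.
move=> xz; pose W := [pred u | (bdist (bl x) (bl u) <= R2)%N].
pose r2 : rel ('I_n * bool) := fun p q =>
  near_adj e cl rho Rw x p.1 q.1 && (p.2 != q.2).
pose F (p : 'I_n * bool) := if p.2 then h p.1 else f p.1.
have [b cb] : exists b, connect r2 (x, false) (z, b).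
  have /connectP[p xp ->] := xz; elim/last_ind: p xp => [|p y IH]; first by exists false.
  rewrite rcons_path last_rcons => /andP[/IH[b cb] py]; exists (~~ b).
  apply: connect_trans cb _; apply: connect1; rewrite /r2 /= py.
  by case: (b).
exists b; have H := connect_energy (F := F) (eps := fun p => energy e f h p.1)
  (P := [pred p | W p.1]) _ _ _ cb _.
apply: le_trans (H _ _ _ _) _.
- by move=> p; exact: energy_ge0.
- move=> [u a] [v a'] /andP[/and3P[/= uv _ _] aa'].
  apply: (@le_trans _ _ (energy e f h u)); last by rewrite lerDl energy_ge0.
  rewrite /energy (bigD1 v) //= -[leLHS]addr0 lerD //; last first.
    by apply: sumr_ge0 => t _; rewrite addr_ge0 ?sqr_ge0.
  by case: a a' aa' => [] [] //= _; rewrite /F /= ?lerDl ?lerDr sqr_ge0.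
- by move=> [u a] [v a'] /andP[/and3P[/= _ -> ->] _].
- by rewrite /= bdistxx.
have cW : #|[pred p : 'I_n * bool | W p.1]| = (#|W| * 2)%N.
  rewrite -card_bool -cardX; apply: eq_card => -[u a].
  by rewrite !inE /= andbT.
have sW : \sum_(p : 'I_n * bool | W p.1) energy e f h p.1 = 2 * win_energy f h (bl x).
  rewrite big_mkcond -(pair_bigA _ (fun u (_ : bool) =>
    if W u then energy e f h u else 0)) /=.
  rewrite (eq_bigr (fun u => if W u then 2 * energy e f h u else 0)); last first.
    move=> u _; rewrite sumr_const card_bool /W /=; case: ifP => _; first by rewrite mulr_natl.
    by rewrite mul0rn.
  rewrite -big_mkcond.
  rewrite -mulr_sumr; congr (_ * _); rewrite /win_energy.
  rewrite (partition_big (fun u => bl u) (fun C => bdist (bl x) C <= R2)%N) //=.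
  by apply: eq_bigr => C QC; apply: eq_bigl => u; case: eqP => [->|]; rewrite ?QC ?andbF.
rewrite cW sW natrM.
have cle : #|W|%:R <= (w * D)%:R :> R by rewrite ler_nat win_nodes.
have : #|W|%:R * win_energy f h (bl x) <= (w * D)%:R * win_energy f h (bl x).
  by rewrite ler_wpM2r.
have -> : 2 * (#|W|%:R * 2) * (2 * win_energy f h (bl x)) =
  8 * (#|W|%:R * win_energy f h (bl x)) by ring.
by move=> H1; rewrite -mulrA ler_wpM2l.
Qed.

Let linked_win f h x z : linked z -> (bdist (bl x) (bl z) <= R2)%N ->
  (f z - g f (bl z)) ^+ 2 <= 8 * Sd * win_energy f h (bl x).
Proof.
move=> lz xz; apply: le_trans (linked_rep f h lz) _.
have H1 := le_trans (energy_le_blk f h z) (blk_le_win f h xz).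
have H2 := blk_le_win f h xz; have H3 := energy_ge0 e f h z.
have H4 := blk_energy_ge0 f h (bl z).
set E := win_energy f h (bl x) in H1 H2 *.
have Q1 : kap * energy e f h z <= 3^-1 * E by rewrite ler_pM.
have Q2 : kap ^+ 2 * blk_energy f h (bl z) <= 9^-1 * E by rewrite ler_pM.
have Q3 : Sd * (kap ^+ 2 * blk_energy f h (bl z)) <= Sd * (9^-1 * E) by rewrite ler_wpM2l.
have Q4 : E <= Sd * E by rewrite ler_peMl //; exact: win_energy_ge0.
rewrite -!mulrA; lra.
Qed.

(** The route goes from [x] to a linked [z] nearby, possibly arriving on the side of [h]; then to
    the representative of [z], with [rep_swap] if needed; then to that of [x] inside the window. The
    constant is 112 = 2 * 8 + 2 * (2 * 18 + 2 * 6). *)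
Let node_win f h x : (0 < w)%N -> (0 < D)%N ->
  (f x - g f (bl x)) ^+ 2 <= 112 * (w * D)%:R * Sd * win_energy f h (bl x).
Proof.
move=> w0 D0.
have k00 : (0 < k0)%N by apply: leq_trans k0_ge3.
have [z [lz xz]] := linked_nearby k00 J_gt0 conn blk_rep good_rep rep_full heavy_adj
  light_near adj_near few_bad JRw x.
have zW : (bdist (bl x) (bl z) <= R2)%N.
  have /connectP[p xp ->] := xz; case/lastP: p xp => [_|p y] /=; first by rewrite bdistxx.
  by rewrite rcons_path last_rcons => /andP[_ /and3P[]].
have [b Hb] := path_cover f h xz.
have Hf := linked_win f h lz zW.
have Hh := linked_win h f lz zW.
rewrite win_energyC in Hh.
have Hs := le_trans (rep_swap f h (bl z))
  (ler_wpM2l (mulr_ge0 (ler0n _ 2) kap2_ge0) (blk_le_win f h zW)).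
have Hw := win_connect f h zW.
set E := win_energy f h (bl x) in Hb Hf Hh Hs Hw *.
have E0 : 0 <= E by apply: win_energy_ge0.
have Hz : ((if b then h z else f z) - g f (bl z)) ^+ 2 <= 18 * Sd * E.
  case: b {Hb}; last by rewrite -!mulrA in Hf *; have := mulr_ge0 Sd_ge0 E0; lra.
  apply: le_trans (sqr_split _ (g h (bl z)) _) _.
  rewrite -[(g h _ - _) ^+ 2]sqrrN opprB.
  have Q : kap ^+ 2 * E <= 9^-1 * E by rewrite ler_wpM2r.
  have Q4 : E <= Sd * E by rewrite ler_peMl.
  rewrite -!mulrA in Hh Hs *; lra.
have wD1 : 1 <= (w * D)%:R :> R by rewrite ler1n muln_gt0 w0.
have w1 : w%:R <= (w * D)%:R :> R by rewrite ler_nat leq_pmulr.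
set y := (if b then _ else _) in Hb Hz.
apply: le_trans (sqr_split _ y _) _.
have := sqr_split y (g f (bl z)) (g f (bl x)).
rewrite -[(g f (bl z) - _) ^+ 2]sqrrN opprB.
have SE : 0 <= Sd * E by rewrite mulr_ge0.
have P1 : (w * D)%:R * E <= (w * D)%:R * (Sd * E).
  by rewrite ler_wpM2l // ler_peMl.
have P2 : Sd * E <= (w * D)%:R * (Sd * E) by rewrite ler_peMl.
have P3 : w%:R * (Sd * E) <= (w * D)%:R * (Sd * E) by rewrite ler_wpM2r.
rewrite -!mulrA in Hb Hz Hw *; lra.
Qed.

Let Q1 : R := 12 * kap + 36 * Sd * kap ^+ 2 * D%:R +
  112 * Sd * (w ^ 2)%:R * (D ^ 2)%:R.

Let sum_rep f h : \sum_x (f x - g f (bl x)) ^+ 2 <= Q1 * tot f h.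
Proof.
(* The case without nodes is set aside; a node forces [w] and [D] to be positive. *)
have [x0|n0] := pickP (fun _ : 'I_n => true); last first.
  rewrite big1 ?mulr_ge0 ?tot_ge0 // => [|x _]; last by have := n0 x.
  by rewrite !addr_ge0 ?mulr_ge0.
move=> _.
have w0 : (0 < w)%N.
  apply: leq_trans (ball_w (bl x0)); apply/card_gt0P; exists (bl x0).
  by rewrite inE bdistxx.
have D0 : (0 < D)%N.
  by apply: leq_trans (few_in_block (bl x0)); apply/card_gt0P; exists x0; rewrite inE eqxx.
apply: (@le_trans _ _ (\sum_x 112 * (w * D)%:R * Sd * win_energy f h (bl x))).
  by apply: ler_sum => x _; exact: node_win.
rewrite -mulr_sumr; apply: (@le_trans _ _ (112 * Sd * (w ^ 2)%:R * (D ^ 2)%:R * tot f h)).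
  apply: (@le_trans _ _ (112 * (w * D)%:R * Sd * (D%:R * (w%:R * tot f h)))).
    rewrite ler_wpM2l ?mulr_ge0 //; apply: le_trans (sum_nodes _) _ => //.
    by rewrite ler_wpM2l.
  rewrite natrM !natrX.
  by rewrite le_eqVlt; apply/orP; left; apply/eqP; ring.
by rewrite ler_wpM2r ?tot_ge0 // lerDr addr_ge0 ?mulr_ge0.
Qed.

(** A degree is a sum over arcs. At most [D] arcs of a node lead to nodes at least as heavy. On an
    arc to a lighter [z], [f x] is replaced by [h z] at the price of its Dirichlet term, and [z] is
    charged by at most [D] heavier nodes. No bound on the degrees themselves enters. *)
Let charge_low f h (c : R) : \sum_x (deg e x)%:R * (f x - c) ^+ 2 <=
  2 * dirichlet e f h + D%:R * \sum_x (f x - c) ^+ 2 + 2 * D%:R * \sum_x (h x - c) ^+ 2.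
Proof.
pose up x z := e x z && (lv x <= lv z)%N.
pose dn x z := e x z && (lv z < lv x)%N.
have split1 (F : 'I_n -> 'I_n -> R) :
    \sum_x \sum_(z | e x z) F x z = \sum_x \sum_(z | up x z) F x z
      + \sum_x \sum_(z | dn x z) F x z.
  rewrite -big_split /=; apply: eq_bigr => x _.
  rewrite (bigID (fun z => lv x <= lv z)%N) /=; congr (_ + _).
  by apply: eq_bigl => z; rewrite -ltnNge.
have upD x (v : R) : 0 <= v -> \sum_(z | up x z) v <= D%:R * v.
  by move=> v0; rewrite sumr_const mulr_natl; apply: ler_wpMn2l => //; exact: (few_up x).
have -> : \sum_x (deg e x)%:R * (f x - c) ^+ 2 =
    \sum_x \sum_(z | e x z) (f x - c) ^+ 2.
  by apply: eq_bigr => x _; rewrite sumr_const -degE mulr_natl.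
rewrite split1 -addrA [2 * _ + _]addrC -addrA; apply: lerD.
  by rewrite mulr_sumr; apply: ler_sum => x _; apply: upD; exact: sqr_ge0.
apply: (@le_trans _ _ (\sum_x \sum_(z | dn x z)
    (2 * (f x - h z) ^+ 2 + 2 * (h z - c) ^+ 2))).
  by apply: ler_sum => x _; apply: ler_sum => z _; exact: sqr_split.
under eq_bigr do rewrite big_split /=; rewrite big_split /= addrC; apply: lerD.
  rewrite (exchange_big_dep xpredT) //= mulr_sumr; apply: ler_sum => z _.
  apply: (@le_trans _ _ (\sum_(x | up z x) 2 * (h z - c) ^+ 2)).
    rewrite [leLHS]big_mkcond [leRHS]big_mkcond; apply: ler_sum => x _.
    rewrite /dn /up esym; case: ifP => [/andP[-> /ltnW ->] //|_].
    by case: ifP => // _; rewrite mulr_ge0 ?sqr_ge0.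
  rewrite [leRHS](_ : _ = D%:R * (2 * (h z - c) ^+ 2)); last by ring.
  by apply: upD; rewrite mulr_ge0 ?sqr_ge0.
rewrite /dirichlet mulr_sumr; apply: ler_sum => x _; rewrite mulr_sumr.
rewrite [leLHS]big_mkcond [leRHS]big_mkcond; apply: ler_sum => z _.
rewrite /dn; case: ifP => [/andP[-> _] //|_].
by case: ifP => // _; rewrite mulr_ge0 ?sqr_ge0.
Qed.

Let X : R := (d ^ 2)%:R * Sd * (M ^ 2)%:R * kap ^+ 2.

Lemma poincare_of_rep : poincare e poincare_const.
Proof.
rewrite /poincare_const -/Q1 -/X => f h; have [c Hc] := block_poincare f h; exists c.
have tE : tot f h = 2 * dirichlet e f h by rewrite /tot sum_energy.
have T0 := tot_ge0 f h.
apply: le_trans (charge_low f h c) _.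
have Hc' : \sum_B (g f B - c) ^+ 2 <= 48 * (X * tot f h).
  apply: le_trans Hc _; rewrite le_eqVlt; apply/orP; left; apply/eqP.
  rewrite /X; ring.
have D0 : 0 <= D%:R :> R by [].
have Df : D%:R * \sum_B (g f B - c) ^+ 2 <= D%:R * (48 * (X * tot f h)).
  by rewrite ler_wpM2l.
have Hf : \sum_x (f x - c) ^+ 2 <=
    2 * (Q1 * tot f h) + 2 * (D%:R * (48 * (X * tot f h))).
  apply: (@le_trans _ _ (\sum_x (2 * (f x - g f (bl x)) ^+ 2
       + 2 * (g f (bl x) - c) ^+ 2))).
    by apply: ler_sum => x _; exact: sqr_split.
  rewrite big_split /= -!mulr_sumr; apply: lerD; rewrite ler_wpM2l ?sum_rep //.
  apply: le_trans Df; apply: (sum_nodes (F := fun B => (g f B - c) ^+ 2)) => B.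
  exact: sqr_ge0.
(* The centre [c] belongs to the block values of [f]; those of [h] reach it through [rep_swap],
   whence the factors 4. *)
have Hh : \sum_x (h x - c) ^+ 2 <=
    2 * (Q1 * tot f h) + 4 * (D%:R * (2 * kap ^+ 2 * tot f h))
     + 4 * (D%:R * (48 * (X * tot f h))).
  apply: (@le_trans _ _ (\sum_x (2 * (h x - g h (bl x)) ^+ 2 +
       (4 * (g f (bl x) - g h (bl x)) ^+ 2 + 4 * (g f (bl x) - c) ^+ 2)))).
    apply: ler_sum => x _; apply: le_trans (sqr_split _ (g h (bl x)) _) _.
    have := sqr_split (g h (bl x)) (g f (bl x)) c.
    rewrite -[X in 2 * X + _]sqrrN opprB; lra.
  rewrite !big_split /= -!mulr_sumr -addrA; apply: lerD.
    rewrite ler_wpM2l //; apply: le_trans (sum_rep h f) _.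
    by rewrite /tot (eq_bigr (energy e f h)) // => x _; rewrite energyC.
  apply: lerD; rewrite ler_wpM2l //.
    apply: le_trans (sum_nodes (F := fun B => (g f B - g h B) ^+ 2) _) _.
      by move=> B; exact: sqr_ge0.
    rewrite ler_wpM2l // -sum_blk mulr_sumr; apply: ler_sum => B _; exact: rep_swap.
  apply: le_trans Df; apply: (sum_nodes (F := fun B => (g f B - c) ^+ 2)) => B.
  exact: sqr_ge0.
have {}Hf := ler_wpM2l D0 Hf.
have {}Hh := ler_wpM2l D0 Hh.
have -> : 2 * (1 + 8 * D%:R * Q1 + 16 * D%:R ^+ 2 * kap ^+ 2 + 480 * D%:R ^+ 2 * X)
    * dirichlet e f h =
  tot f h + 8 * (D%:R * (Q1 * tot f h)) + 16 * (D%:R * (D%:R * (kap ^+ 2 * tot f h)))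
  + 480 * (D%:R * (D%:R * (X * tot f h))).
  by rewrite tE; ring.
have Y1 : 0 <= D%:R * (Q1 * tot f h).
  by rewrite !mulr_ge0 // !addr_ge0 // !mulr_ge0.
have Y2 : 0 <= D%:R * (D%:R * (kap ^+ 2 * tot f h)) by rewrite !mulr_ge0.
have Y3 : 0 <= D%:R * (D%:R * (X * tot f h)) by rewrite !mulr_ge0.
have e1 : D%:R * (2 * (Q1 * tot f h) + 2 * (D%:R * (48 * (X * tot f h)))) =
   2 * (D%:R * (Q1 * tot f h)) + 96 * (D%:R * (D%:R * (X * tot f h))) by ring.
have e2 : D%:R * (2 * (Q1 * tot f h) + 4 * (D%:R * (2 * kap ^+ 2 * tot f h))
     + 4 * (D%:R * (48 * (X * tot f h)))) =
   2 * (D%:R * (Q1 * tot f h)) + 8 * (D%:R * (D%:R * (kap ^+ 2 * tot f h)))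
   + 192 * (D%:R * (D%:R * (X * tot f h))) by ring.
rewrite e1 in Hf; rewrite e2 in Hh; rewrite -tE -mulrA; lra.
Qed.

End WithRepresentatives.

Lemma cell_poincare : (0 < Rw)%N -> poincare e poincare_const.
Proof.
move=> Rw0.
have few_bad2 B k :
    (#|[pred A | ~~ good A && ((blk A == B) || (blk A == shift k B))]| <= L)%N.
  apply: leq_trans (few_bad B); apply: subset_leq_card; apply/fintype.subsetP => A.
  rewrite !inE => /andP[-> /orP[/eqP ->|/eqP ->]] /=; first by rewrite bdistxx.
  by apply: leq_trans Rw0; exact: bdist_shift.
have [rep [r1 r2 r3 r4]] := representatives i01 LS few_bad2.
exact: (poincare_of_rep r1 r2 r4 r3).
Qed.

End CellPoincare.

(** * Chernoff bounds for product weights *)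

Section ProductWeights.
Variables (R : realType) (n : nat) (Z : finType) (p : Z -> R).
Notation conf := {ffun 'I_n -> Z}.
Implicit Types (E : pred conf) (A : pred Z).

(* [p] may have total mass less than one: the levels above the cap are left out. *)
Definition prodw E : R := \sum_(z : conf | E z) \prod_i p (z i).

Definition hits A (z : conf) : nat := #|[pred i | A (z i)]|.

Hypothesis p_ge0 : forall a, 0 <= p a.
Hypothesis p_le1 : \sum_a p a <= 1.

Let prod_ge0 (z : conf) : 0 <= \prod_i p (z i).
Proof. by apply: prodr_ge0. Qed.

Lemma prodw_total : prodw predT = (\sum_a p a) ^+ n.
Proof.
rewrite /prodw -(bigA_distr_bigA (fun (_ : 'I_n) a => p a)) /=.
by rewrite prodr_const card_ord.
Qed.

Lemma prodw_union (I : finType) (Q : pred I) E (F : I -> pred conf) :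
  (forall z, E z -> exists2 i, Q i & F i z) ->
  prodw E <= \sum_(i | Q i) prodw (F i).
Proof.
move=> EF; rewrite /prodw.
under [leRHS]eq_bigr do rewrite big_mkcond.
rewrite [leRHS]exchange_big [leLHS]big_mkcond /=; apply: ler_sum => z _.
case: ifP => [/EF[i Qi Fi]|_].
  rewrite (bigD1 i) //= Fi lerDl; apply: sumr_ge0 => j _; by case: ifP.
by apply: sumr_ge0 => j _; case: ifP.
Qed.

Lemma prodw_split E E' : prodw predT <= prodw [pred z | E z && E' z]
  + prodw (predC E) + prodw (predC E').
Proof.
rewrite /prodw (bigID [pred z | E z && E' z]) /= -addrA lerD2l.
rewrite big_mkcond [X in _ <= X + _]big_mkcond [X in _ <= _ + X]big_mkcond /= -big_split /=.
apply: ler_sum => z _; case: (E z); case: (E' z) => //=;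
by rewrite ?addr0 ?add0r ?lerDl.
Qed.

Let exp_hits A (a : R) : \sum_(z : conf) \prod_i p (z i) * expR (a * (hits A z)%:R)
  = (\sum_b p b * (if A b then expR a else 1)) ^+ n.
Proof.
rewrite -[X in _ = _ ^+ X]card_ord -prodr_const.
rewrite (bigA_distr_bigA (fun (_ : 'I_n) b => p b * (if A b then expR a else 1))) /=.
apply: eq_bigr => z _; rewrite big_split /=; congr (_ * _).
rewrite -big_mkcond /= prodr_const mulrC expRM_natl; congr (_ ^+ _).
Qed.

Let mass A := \sum_(b | A b) p b.

Let sum_if A (x : R) : \sum_b p b * (if A b then x else 1) =
  \sum_b p b + (x - 1) * mass A.
Proof.
rewrite /mass [\sum_(b | A b) _]big_mkcond mulr_sumr -big_split /=.
by apply: eq_bigr => b _; case: ifP => _; rewrite ?mulr0 ?addr0 ?mulr1 //; ring.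
Qed.

Lemma expR1_le4 : expR 1 <= 4 :> R.
Proof.
have h : 2^-1 <= expR (- 2^-1) :> R by have := expR_ge1Dx (- 2^-1 : R); lra.
have e2 : expR (2^-1) <= 2 :> R.
  rewrite -[leRHS]invrK -[leLHS]invrK -expRN lef_pV2 ?posrE ?expR_gt0 //.
have -> : expR 1 = expR (2^-1) ^+ 2 :> R.
  by rewrite -expRM_natl divff.
have -> : 4 = 2 ^+ 2 :> R by rewrite expr2; lra.
by rewrite lerXn2r ?nnegrE ?expR_ge0.
Qed.

Let pow_exp (x y : R) : 0 <= x -> x <= 1 + y -> x ^+ n <= expR (n%:R * y).
Proof.
move=> x0 xy; rewrite expRM_natl lerXn2r ?nnegrE ?expR_ge0 //.
exact: le_trans xy (expR_ge1Dx _).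
Qed.

Lemma mass_ge0 A : 0 <= mass A. Proof. exact: sumr_ge0. Qed.

(** Exponential Markov inequality at parameter 1, with [expR 1 - 1 <= 3]. *)
Lemma chernoff_upper A (q t : R) : mass A <= q ->
  prodw [pred z | t <= (hits A z)%:R] <= expR (3 * n%:R * q - t).
Proof.
move=> Aq; apply: (@le_trans _ _ (expR (- t) *
   \sum_(z : conf) \prod_i p (z i) * expR (1 * (hits A z)%:R))).
  rewrite /prodw mulr_sumr big_mkcond /=; apply: ler_sum => z _.
  case: ifP => [th|_]; last by rewrite !mulr_ge0 ?expR_ge0.
  rewrite mulrCA ler_peMr // -expRD -[leLHS]expR0 ler_expR mul1r; lra.
rewrite exp_hits sum_if [_ - t]addrC expRD ler_wpM2l ?expR_ge0 //.
have m0 := mass_ge0 A; have e4 := expR1_le4.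
have e1 : 1 <= expR 1 :> R by have := expR_ge1Dx (1 : R); lra.
rewrite -mulrA mulrCA; apply: pow_exp.
  rewrite addr_ge0 ?mulr_ge0 ?sumr_ge0 //; lra.
apply: lerD => //; apply: (@le_trans _ _ (3 * mass A)); first by rewrite ler_wpM2r //; lra.
by rewrite ler_wpM2l.
Qed.

(** Exponential Markov inequality at parameter -1, with [1 - expR (-1) >= 2^-1]; a total mass below
    one only helps. *)
Lemma chernoff_lower A (q t : R) : q <= mass A ->
  prodw [pred z | (hits A z)%:R <= t] <= expR (t - n%:R * (q / 2)).
Proof.
move=> Aq; apply: (@le_trans _ _ (expR t *
   \sum_(z : conf) \prod_i p (z i) * expR (- 1 * (hits A z)%:R))).
  rewrite /prodw mulr_sumr big_mkcond /=; apply: ler_sum => z _.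
  case: ifP => [th|_]; last by rewrite !mulr_ge0 ?expR_ge0.
  rewrite mulrCA ler_peMr // -expRD -[leLHS]expR0 ler_expR mulN1r; lra.
rewrite exp_hits sum_if expRD ler_wpM2l ?expR_ge0 // -mulrN.
have m0 := mass_ge0 A.
have e0 := expR_ge0 (-1 : R).
have e2 : expR (-1) <= 2^-1 :> R.
  rewrite expRN lef_pV2 ?posrE ?expR_gt0 //; have := expR_ge1Dx (1 : R); lra.
have mA : mass A <= \sum_b p b.
  by rewrite [leRHS](bigID A) /= lerDl sumr_ge0.
apply: pow_exp.
  have : 0 <= expR (-1) * mass A by rewrite mulr_ge0.
  lra.
have : expR (-1) * mass A <= 2^-1 * mass A by rewrite ler_wpM2r.
rewrite mulrBl mul1r; move: p_le1 Aq; set x := expR _ * _; set s := \sum_b _; set m := mass A; lra.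
Qed.

End ProductWeights.

Section SmallBalls.
Variables (d M : nat).
Notation block := {ffun 'I_d -> 'I_M}.

(** The [.-1] accounts for rounding to blocks. If the largest distance [r] is at least 2, then 2r +
    1 <= 5(r - 1) bounds the ball by [5 ^ d * y]; otherwise there are at most 3^d blocks. *)
Lemma card_power_ball (R : realType) (B : block) (y : R) : 0 <= y ->
  #|[pred C : block | ((bdist B C).-1 ^ d)%:R <= y]|%:R <= 5%:R ^+ d * (1 + y).
Proof.
move=> y0; set P := [pred C : block | _].
have [C0 PC0|P0] := pickP P; last first.
  rewrite eq_card0 // mulr_ge0 ?exprn_ge0 // addr_ge0 //.
have pw (m a b : nat) : (a <= b -> a ^ m <= b ^ m)%N.
  by case: m => // m ab; rewrite leq_exp2r.
have P1 : (0 < #|P|)%N by apply/card_gt0P; exists C0.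
pose r := (\max_(C in P) bdist B C)%N.
have [C PC rE] := eq_bigmax_cond (bdist B) P1.
have cP : (#|P| <= r.*2.+1 ^ d)%N.
  apply: leq_trans (card_ball B r); apply: subset_leq_card.
  by apply/fintype.subsetP => D PD; rewrite inE; apply: leq_bigmax_cond.
have cPR : #|P|%:R <= (r.*2.+1 ^ d)%:R :> R by rewrite ler_nat.
apply: le_trans cPR _.
have [r1|r1] := leqP r 1.
  apply: (@le_trans _ _ (5%:R ^+ d)); last by rewrite ler_peMr ?exprn_ge0 // lerDl.
  by rewrite -natrX ler_nat; apply: pw; lia.
apply: (@le_trans _ _ ((5 * r.-1) ^ d)%:R).
  rewrite ler_nat; apply: pw; lia.
rewrite expnMn natrM natrX ler_wpM2l ?exprn_ge0 //.
by move: PC; rewrite inE -rE => /le_trans; apply; rewrite lerDr.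
Qed.

End SmallBalls.

Section GoodConfigurations.
Variables (R : realType) (n d M S Lev : nat).
Notation block := {ffun 'I_d -> 'I_M}.
Notation cell := {ffun 'I_d -> 'I_M * 'I_S}.
Notation state := (cell * 'I_Lev)%type.
Variables (pl : 'I_Lev -> R) (k0 L Rw D : nat) (kappa : R).
Implicit Types (z : {ffun 'I_n -> state}) (A : cell) (B : block).

Definition state_weight (a : state) : R := ((M * S) ^ d)%:R^-1 * pl a.2.

Definition cell_of z i : cell := (z i).1.
Definition level_of z i : nat := (z i).2.

Definition sparse_bad z : bool := [forall B,
  #|[pred A | ~~ good (cell_of z) (level_of z) k0 A && (bdist B (blk A) <= Rw)]| <= L]%N.

Definition in_reach B (a : state) : bool :=
  ((bdist B (blk a.1)).-1 ^ d)%:R <= kappa * (2 * (a.2 : nat)%:R + 2).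

Definition bounded_reach z : bool :=
  [forall B, #|[pred i | in_reach B (z i)]| <= D]%N.

Hypothesis pl_ge0 : forall l, 0 <= pl l.
Hypothesis pl_le1 : \sum_l pl l <= 1.
Hypothesis MS_gt0 : (0 < M * S)%N.
Hypothesis kappa_ge0 : 0 <= kappa.

Let Nd : R := ((M * S) ^ d)%:R.

Let Nd_gt0 : 0 < Nd. Proof. by rewrite ltr0n expn_gt0 MS_gt0. Qed.

Let card_cell : #|{: cell}|%:R = Nd.
Proof. by rewrite card_ffun card_prod !card_ord. Qed.

Lemma state_weight_ge0 a : 0 <= state_weight a.
Proof. by rewrite mulr_ge0 // invr_ge0. Qed.

Let sum_pair (P : cell -> 'I_Lev -> bool) :
  \sum_(a : state | P a.1 a.2) state_weight a =
  \sum_l Nd^-1 * pl l * #|[pred A | P A l]|%:R.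
Proof.
rewrite big_mkcond -(pair_bigA _ (fun A l => if P A l then state_weight (A, l) else 0)) /=.
rewrite exchange_big /=; apply: eq_bigr => l _.
by rewrite -big_mkcond /state_weight /= sumr_const mulr_natr.
Qed.

Lemma sum_state_weight : \sum_a state_weight a = \sum_l pl l.
Proof.
apply: etrans (sum_pair (fun _ _ => true)) _; apply: eq_bigr => l _.
rewrite (eq_card (B := predT)) ?card_cell //.
by rewrite mulrC mulrA divff ?mul1r // lt0r_neq0.
Qed.

Let sum_le1 : \sum_a state_weight a <= 1.
Proof. by rewrite sum_state_weight. Qed.

Definition core_mass : R := \sum_(l : 'I_Lev | (0 < l)%N) pl l.

Definition reach_mass : R :=
  5%:R ^+ d / (M ^ d)%:R * \sum_l pl l * (1 + kappa * (2 * (l : nat)%:R + 2)).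

Let core_weight (Q : {set cell}) :
  \sum_(a : state | (a.1 \in Q) && (0 < a.2)%N) state_weight a =
  #|Q|%:R * (Nd^-1 * core_mass).
Proof.
rewrite (sum_pair (fun A l => (A \in Q) && (0 < l)%N)) /core_mass 2!mulr_sumr.
rewrite [RHS]big_mkcond; apply: eq_bigr => l _; case: ifP => l0.
  rewrite mulrC; congr (_%:R * _); apply: eq_card => A; by rewrite !inE andbT.
by rewrite eq_card0 ?mulr0 // => A; rewrite !inE andbF.
Qed.

Let reach_weight B : \sum_(a | in_reach B a) state_weight a <= reach_mass.
Proof.
rewrite (sum_pair (fun A l => in_reach B (A, l))) /reach_mass mulr_sumr.
apply: ler_sum => l _; rewrite [leRHS]mulrCA [Nd^-1 * _]mulrC -mulrA ler_wpM2l //.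
set y := kappa * _.
have y0 : 0 <= y by rewrite mulr_ge0 // addr_ge0 // mulr_ge0.
have := card_power_ball B y0; set P := [pred C | _] => H.
have cA : (#|[pred A : cell | in_reach B (A, l)]| <= #|P| * S ^ d)%N.
  rewrite -sum1_card (partition_big (@blk d M S) P) //=.
  rewrite -sum_nat_const; apply: leq_sum => C _; rewrite sum1dep_card.
  apply: leq_trans (card_block S C).
  by apply: subset_leq_card; apply/fintype.subsetP => U; rewrite !inE => /andP[].
have : #|[pred A : cell | in_reach B (A, l)]|%:R <= 5%:R ^+ d * (1 + y) * (S ^ d)%:R.
  apply: (@le_trans _ _ (#|P| * S ^ d)%:R); first by rewrite ler_nat.
  by rewrite natrM ler_wpM2r.
have Ni : 0 <= Nd^-1 by rewrite invr_ge0 ltW.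
move=> /(ler_wpM2l Ni)/le_trans; apply.
rewrite /Nd expnMn natrM le_eqVlt; apply/orP; left; apply/eqP.
have M0 : (M ^ d)%:R != 0 :> R.
  by rewrite pnatr_eq0 -lt0n expn_gt0; move: MS_gt0; rewrite muln_gt0 => /andP[->].
have S0 : (S ^ d)%:R != 0 :> R.
  by rewrite pnatr_eq0 -lt0n expn_gt0; move: MS_gt0; rewrite muln_gt0 => /andP[_ ->].
by field; rewrite M0 S0.
Qed.

Let win_cells B : (#|[pred A : cell | bdist B (blk A) <= Rw]| <= Rw.*2.+1 ^ d * S ^ d)%N.
Proof.
rewrite -sum1_card (partition_big (@blk d M S) (fun C => bdist B C <= Rw)%N) //=.
apply: (@leq_trans (\sum_(C | (bdist B C <= Rw)%N) S ^ d)).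
  apply: leq_sum => C _; rewrite sum1dep_card; apply: leq_trans (card_block S C).
  by apply: subset_leq_card; apply/fintype.subsetP => U; rewrite !inE => /andP[].
by rewrite sum_nat_const leq_mul2r card_ball orbT.
Qed.

(** Half the expected number of core nodes in a cell, less the threshold: the Chernoff exponent that
    each bad cell contributes. *)
Let slack : R := n%:R * core_mass / (2 * Nd) - k0%:R.

(* The bad cells of a window form a set [Q] with too few core nodes; there are boundedly
   many candidates for [Q], so a Chernoff bound for each of them suffices. *)
Let dense_bad_prob : 0 <= slack ->
  prodw state_weight (predC sparse_bad) <=
  (M ^ d)%:R * (2 ^ (Rw.*2.+1 ^ d * S ^ d))%:R * expR (- L.+1%:R * slack).
Proof.
move=> s0.
pose win B : {set cell} := [set A | (bdist B (blk A) <= Rw)%N]%SET.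
pose QQ (b : block * {set cell}) := (b.2 \in powerset (win b.1)) && (L < #|b.2|)%N.
pose hit (Q : {set cell}) (a : state) := (a.1 \in Q) && (0 < a.2)%N.
pose few (b : block * {set cell}) : pred {ffun 'I_n -> state} :=
  [pred z | (hits (hit b.2) z)%:R <= (#|b.2|%:R * k0%:R : R)].
apply: le_trans (prodw_union state_weight_ge0 (Q := QQ) (F := few) _) _.
  move=> z /=; rewrite /sparse_bad negb_forall => /existsP[B]; rewrite -ltnNge => HB.
  pose Q : {set cell} :=
    [set A | ~~ good (cell_of z) (level_of z) k0 A && (bdist B (blk A) <= Rw)%N]%SET.
  exists (B, Q).
    rewrite /QQ /= cardsE HB andbT powersetE; apply/fintype.subsetP => A.
    by rewrite !inE => /andP[].
  rewrite /few /= -natrM ler_nat /hits -sum1_card.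
  rewrite (partition_big (fun i => cell_of z i) (mem Q)) /=; last first.
    by move=> i /andP[].
  rewrite -sum_nat_const; apply: leq_sum => A; rewrite inE => /andP[nA _].
  rewrite sum1dep_card; move: nA; rewrite /good /= -ltnNge => /ltnW; apply: leq_trans.
  apply: subset_leq_card; apply/fintype.subsetP => i; rewrite !inE /hit.
  by move=> /andP[/andP[_ ->] ->].
apply: (@le_trans _ _ (\sum_(b | QQ b) expR (- L.+1%:R * slack))).
  apply: ler_sum => -[B Q] /andP[/= _ LQ].
  have Hq : #|Q|%:R * (Nd^-1 * core_mass) <= \sum_(a | hit Q a) state_weight a.
    by rewrite core_weight.
  apply: le_trans (chernoff_lower n state_weight_ge0 sum_le1 _ Hq) _.
  rewrite ler_expR.
  have -> : #|Q|%:R * k0%:R - n%:R * (#|Q|%:R * (Nd^-1 * core_mass) / 2)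
      = - (#|Q|%:R * slack).
    by rewrite /slack; field; rewrite lt0r_neq0.
  by rewrite mulNr lerN2 ler_wpM2r // ler_nat.
rewrite sumr_const -[leLHS]mulr_natl ler_wpM2r ?expR_ge0 // -natrM ler_nat.
rewrite -sum1_card -(pair_big_dep predT (fun B Q => (Q \in powerset (win B)) && (L < #|Q|))%N
  (fun _ _ => 1%N)) /=.
have -> : (M ^ d)%N = #|{: block}| by rewrite card_ffun !card_ord.
rewrite -sum_nat_const; apply: leq_sum => B _; rewrite sum1dep_card.
apply: (@leq_trans #|powerset (win B)|).
  by apply: subset_leq_card; apply/fintype.subsetP => Q; rewrite inE => /andP[].
rewrite card_powerset leq_exp2l // cardsE; exact: win_cells.
Qed.

Let unbounded_reach_prob :
  prodw state_weight (predC bounded_reach) <=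
  (M ^ d)%:R * expR (3 * n%:R * reach_mass - D%:R).
Proof.
apply: le_trans (prodw_union state_weight_ge0 (Q := xpredT)
  (F := fun B => [pred z | D%:R <= (hits (in_reach B) z)%:R :> R]) _) _.
  move=> z /=; rewrite /bounded_reach negb_forall => /existsP[B]; rewrite -ltnNge => HB.
  by exists B => //=; rewrite ler_nat ltnW.
apply: (@le_trans _ _ (\sum_(B : block) expR (3 * n%:R * reach_mass - D%:R))).
  by apply: ler_sum => B _; apply: chernoff_upper => //; exact: state_weight_ge0.
by rewrite sumr_const -[leLHS]mulr_natl card_ffun !card_ord.
Qed.

(** The left side is the total weight of all configurations, in the application the probability that
    every weight stays below the cap. *)
Lemma good_configurations : 0 <= slack ->
  (\sum_l pl l) ^+ n <= prodw state_weight [pred z | sparse_bad z && bounded_reach z]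
   + (M ^ d)%:R * (2 ^ (Rw.*2.+1 ^ d * S ^ d))%:R * expR (- L.+1%:R * slack)
   + (M ^ d)%:R * expR (3 * n%:R * reach_mass - D%:R).
Proof.
move=> s0; rewrite -sum_state_weight -prodw_total.
apply: le_trans (prodw_split state_weight_ge0 sparse_bad bounded_reach) _.
by apply: lerD; [rewrite lerD2l dense_bad_prob|exact: unbounded_reach_prob].
Qed.

End GoodConfigurations.

(** * Toric geometry *)

Section Geometry.
Variable R : realType.

(** Rounding both points down to the grid changes their difference by at most one cell, and the
    distance on the circle is 1-Lipschitz in that difference. *)
Lemma tor_dist1_tdist (m a b : nat) (x y : R) : (a < m)%N -> (b < m)%N ->
  a%:R <= m%:R * x < a.+1%:R -> b%:R <= m%:R * y < b.+1%:R ->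
  (tdist m a b)%:R - 1 <= m%:R * tor_dist1 x y <= (tdist m a b)%:R + 1.
Proof.
move=> am bm; rewrite -!natr1 => /andP[ax1 ax2] /andP[by1 by2].
have m0 : 0 <= m%:R :> R by [].
have E : m%:R * `|x - y| = `|m%:R * x - m%:R * y|.
  by rewrite -mulrBr normrM ger0_norm.
pose h := (a - b + (b - a))%N.
have hm : (h <= m)%N by rewrite /h; lia.
have hE : h%:R = `|a%:R - b%:R| :> R.
  rewrite /h; case: (leqP a b) => ab.
    have -> : (a - b = 0)%N by apply/eqP; rewrite subn_eq0.
    by rewrite add0n distrC -natrB // ger0_norm.
  have -> : (b - a = 0)%N by apply/eqP; rewrite subn_eq0 ltnW.
  by rewrite addn0 -natrB ?ger0_norm // ltnW.
have tE : (tdist m a b)%:R = Num.min h%:R (m%:R - h%:R) :> R.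
  rewrite /tdist -/h -natrB // /minn /Num.min ltr_nat.
  by case: ifP.
have H : h%:R - 1 <= m%:R * `|x - y| <= h%:R + 1.
  rewrite E hE; apply/andP; split.
    have := ler_dist_dist (a%:R - b%:R) (m%:R * x - m%:R * y).
    have : `|a%:R - b%:R - (m%:R * x - m%:R * y)| <= 1.
      by rewrite ler_norml; apply/andP; split; lra.
    move=> h1 /le_trans/(_ h1); rewrite ler_norml => /andP[]; lra.
  have := ler_dist_dist (a%:R - b%:R) (m%:R * x - m%:R * y).
  have : `|a%:R - b%:R - (m%:R * x - m%:R * y)| <= 1.
    by rewrite ler_norml; apply/andP; split; lra.
  move=> h1 /le_trans/(_ h1); rewrite ler_norml => /andP[]; lra.
move: H; rewrite /tor_dist1 tE => /andP[H1 H2].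
have -> : m%:R * Num.min `|x - y| (1 - `|x - y|) =
    Num.min (m%:R * `|x - y|) (m%:R - m%:R * `|x - y|).
  by rewrite minr_pMr // mulrBr mulr1.
move: (m%:R * `|x - y|) H1 H2 => t H1 H2.
apply/andP; split.
  by rewrite le_min !lerBlDr !minElt; case: ifP => ?; apply/andP; split; lra.
by rewrite ge_min !minElt; case: ifP => ?; apply/orP; [left|right]; lra.
Qed.

Variable d : nat.

Lemma tor_dist_le (p1 p2 : 'I_d -> R) (r : R) : (0 < d)%N -> 0 <= r ->
  (forall k, `|tor_dist1 (p1 k) (p2 k)| <= r) -> tor_dist p1 p2 <= d%:R * r.
Proof.
move=> d0 r0 H; rewrite /tor_dist.
rewrite -[leRHS]ger0_norm ?mulr_ge0 // -sqrtr_sqr ler_wsqrtr //.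
apply: (@le_trans _ _ (\sum_(k < d) r ^+ 2)).
  apply: ler_sum => k _; rewrite -[leLHS]real_normK ?num_real //.
  by rewrite lerXn2r ?nnegrE.
rewrite sumr_const card_ord -[leLHS]mulr_natl exprMn ler_wpM2r ?sqr_ge0 //.
by rewrite expr2 ler_peMl // ler1n.
Qed.

Lemma tor_dist_ge (p1 p2 : 'I_d -> R) k : tor_dist1 (p1 k) (p2 k) <= tor_dist p1 p2.
Proof.
apply: le_trans (ler_norm _) _; rewrite /tor_dist -sqrtr_sqr ler_wsqrtr //.
by rewrite (bigD1 k) //= lerDl sumr_ge0 // => j _; rewrite sqr_ge0.
Qed.

End Geometry.

Section GeometricPoincare.
Variables (R : realType) (d n M S Lev : nat).
Notation block := {ffun 'I_d -> 'I_M}.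
Notation cell := {ffun 'I_d -> 'I_M * 'I_S}.
Variables (pos : 'I_n -> 'I_d -> R) (w : 'I_n -> R) (theta q : R).
Variables (z : {ffun 'I_n -> cell * 'I_Lev}).
Variables (k0 L K0 J rho Rw D wd : nat).

Local Notation e := (gtg_adj pos w theta).
Local Notation cl := (cell_of z).
Local Notation lv := (level_of z).

Hypothesis d_ge2 : (2 <= d)%N.
Hypothesis q_gt0 : 0 < q.
Hypothesis theta_gt0 : 0 < theta.
Hypothesis pos_bin : forall i k,
  (cellnum (cl i) k)%:R <= (M * S)%:R * pos i k < (cellnum (cl i) k).+1%:R.
Hypothesis w_bin : forall i, (lv i)%:R * q <= w i < (lv i).+1%:R * q.

Let kappa : R := q * (M ^ d)%:R / theta.

Hypothesis bad : sparse_bad k0 L Rw z.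
Hypothesis reach : bounded_reach D kappa z.
Hypothesis core_range : theta * (2 * d%:R / (M * S)%:R) ^+ d <= q.
Hypothesis heavy_range : theta * (d%:R / M%:R) ^+ d <= K0%:R * q.
Hypothesis light_range : kappa * (2 * K0%:R + 2) < (J ^ d)%:R.
Hypothesis max_range : kappa * (2 * Lev%:R + 2) < (rho ^ d)%:R.

Let d_gt0 : (0 < d)%N. Proof. exact: ltnW. Qed.

Let w_ge0 i : 0 <= w i.
Proof. by have /andP[H _] := w_bin i; apply: le_trans H; rewrite mulr_ge0 // ltW. Qed.

Let Mpos (i : 'I_n) (k : 'I_d) : (0 < M)%N /\ (0 < S)%N.
Proof.
have [u v] := cl i k; have := ltn_ord u; have := ltn_ord v.
by move=> /(leq_ltn_trans (leq0n _)) -> /(leq_ltn_trans (leq0n _)) ->.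
Qed.

Let cellnum_lt (A : cell) k : (cellnum A k < M * S)%N.
Proof.
rewrite /cellnum; have := ltn_ord (A k).1; have := ltn_ord (A k).2.
move: (nat_of_ord (A k).1) (nat_of_ord (A k).2) => a b bS aM.
apply: (@leq_trans (a.+1 * S)); last by rewrite leq_mul2r aM orbT.
by rewrite mulSn addnC ltn_add2r.
Qed.

Let blk_bin i k : (blk (cl i) k)%:R <= M%:R * pos i k < (blk (cl i) k).+1%:R.
Proof.
have [M0 S0] := Mpos i k; have /andP[h1 h2] := pos_bin i k.
have S0R : 0 < S%:R :> R by rewrite ltr0n.
have e1 : (M * S)%:R * pos i k = S%:R * (M%:R * pos i k).
  by rewrite natrM mulrAC mulrC.
rewrite e1 in h1 h2; rewrite ffunE.
have hs := ltn_ord (cl i k).2.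
apply/andP; split.
  rewrite -(ler_pM2l S0R); apply: le_trans h1.
  by rewrite -natrM ler_nat /cellnum mulnC leq_addr.
rewrite -(ltr_pM2l S0R); apply: lt_le_trans h2 _.
by rewrite -natrM ler_nat /cellnum mulnS mulnC [leqRHS]addnC ltn_add2l.
Qed.

Let near_dist i j (m : nat) (a : 'I_n -> 'I_d -> nat) (r : nat) : (0 < m)%N ->
  (forall (i : 'I_n) (k : 'I_d), a i k < m)%N ->
  (forall i k, (a i k)%:R <= m%:R * pos i k < (a i k).+1%:R) ->
  (forall k, tdist m (a i k) (a j k) <= r)%N ->
  tor_dist (pos i) (pos j) <= d%:R * (r.+1%:R / m%:R).
Proof.
move=> m0 am ab tr; have m0R : 0 < m%:R :> R by rewrite ltr0n.
apply: tor_dist_le => // k.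
have /andP[h1 h2] := tor_dist1_tdist (am i k) (am j k) (ab i k) (ab j k).
have : (tdist m (a i k) (a j k))%:R <= r%:R :> R by rewrite ler_nat.
have t0 : 0 <= (tdist m (a i k) (a j k))%:R :> R by [].
have r0 : 0 <= r%:R :> R by [].
move=> h3; rewrite ler_pdivlMr // mulrC -[X in X * _](ger0_norm (ltW m0R)) -normrM.
by rewrite ler_norml -natr1; apply/andP; split; lra.
Qed.

Let powd (x y : R) : 0 <= x -> x <= y -> x ^+ d <= y ^+ d.
Proof. by move=> x0 xy; rewrite lerXn2r ?nnegrE // (le_trans x0). Qed.

Let tor_ge0 i j : 0 <= tor_dist (pos i) (pos j).
Proof. by rewrite sqrtr_ge0. Qed.

Lemma gtg_adj_sym : symmetric e.
Proof.
move=> i j; rewrite /gtg_adj eq_sym [w i + w j]addrC; congr (_ && (_ * _ ^+ _ <= _)).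
rewrite /tor_dist; congr Num.sqrt; apply: eq_bigr => k _.
by rewrite /tor_dist1 distrC.
Qed.

Let core_adj i j : i != j -> cadj (cl i) (cl j) -> (0 < lv j)%N -> e i j.
Proof.
move=> ij /forallP cij lj; rewrite /gtg_adj ij /=.
have [M0 S0] := Mpos i (Ordinal d_gt0).
have H := near_dist (m := (M * S)%N) (a := fun i => cellnum (cl i)) (r := 1) _ _ _ cij.
apply: (@le_trans _ _ q).
  apply: le_trans core_range; rewrite ler_pM2l //.
  have -> : 2 * d%:R / (M * S)%:R = d%:R * (2%:R / (M * S)%:R) :> R by ring.
  by apply: powd => //; apply: H; rewrite ?muln_gt0 ?M0.
apply: (@le_trans _ _ (w j)); last by rewrite lerDr.
have /andP[h _] := w_bin j; apply: le_trans h; apply: ler_peMl; first exact: ltW.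
by rewrite ler1n.
Qed.

Let heavy_adj i j : i != j -> blk (cl i) = blk (cl j) -> (K0 <= lv i)%N -> e i j.
Proof.
move=> ij bij li; rewrite /gtg_adj ij /=.
have [M0 S0] := Mpos i (Ordinal d_gt0).
apply: (@le_trans _ _ (K0%:R * q)).
  apply: le_trans heavy_range; rewrite ler_pM2l //.
  apply: powd => //.
  have -> : d%:R / M%:R = d%:R * (1%:R / M%:R) :> R by rewrite div1r.
  apply: (near_dist (m := M) (a := fun i k => blk (cl i) k) (r := 0)) => // k.
  by rewrite bij /tdist subnn min0n.
apply: (@le_trans _ _ (w i)); last by rewrite lerDl.
have /andP[h _] := w_bin i; apply: le_trans h; rewrite ler_wpM2r ?ler_nat //.
exact: ltW.
Qed.

(** The edge rule with weights rounded up, hence [+ 2], and the distance rounded down, hence [.-1].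
    The factor [kappa] is the weight [q] expressed in block volumes. *)
Let adj_levels i j : e i j ->
  ((bdist (blk (cl i)) (blk (cl j))).-1 ^ d)%:R <= kappa * ((lv i)%:R + (lv j)%:R + 2).
Proof.
move=> /andP[_ H]; set B := blk _; set C := blk _.
have [->|b0] := posnP (bdist B C).
  by rewrite exp0n // !mulr_ge0 ?invr_ge0 ?addr_ge0 // ltW.
have [k bk] : exists k, (bdist B C <= tdist M (B k) (C k))%N.
  apply/existsP; apply: contraT => /existsPn H'.
  suff : (bdist B C <= (bdist B C).-1)%N by rewrite leqNgt prednK // leqnn.
  apply/bdist_leP => k; have := H' k; rewrite -ltnNge => h.
  by rewrite -ltnS prednK.
have [M0 S0] := Mpos i k; have M0R : 0 < M%:R :> R by rewrite ltr0n.
have /andP[h1 _] := tor_dist1_tdist (ltn_ord (B k)) (ltn_ord (C k)) (blk_bin i k) (blk_bin j k).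
have h2 := tor_dist_ge (pos i) (pos j) k.
have h3 : ((bdist B C).-1)%:R <= M%:R * tor_dist (pos i) (pos j).
  apply: (@le_trans _ _ (M%:R * tor_dist1 (pos i k) (pos j k))); last by rewrite ler_pM2l.
  apply: le_trans h1; have bkR : (bdist B C)%:R <= (tdist M (B k) (C k))%:R :> R by rewrite ler_nat.
  by rewrite lerBrDr natr1 prednK.
have h4 : theta * tor_dist (pos i) (pos j) ^+ d <= q * ((lv i)%:R + (lv j)%:R + 2).
  apply: le_trans H _; have /andP[_ /ltW wi] := w_bin i; have /andP[_ /ltW wj] := w_bin j.
  move: wi wj; rewrite -![_.+1%:R]natr1 => wi wj; have := lerD wi wj; lra.
have h5 : ((bdist B C).-1 ^ d)%:R <= (M ^ d)%:R * tor_dist (pos i) (pos j) ^+ d.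
  by rewrite !natrX -exprMn; apply: powd.
apply: le_trans h5 _.
rewrite /kappa -(ler_pM2l theta_gt0).
have -> : theta * (q * (M ^ d)%:R / theta * ((lv i)%:R + (lv j)%:R + 2)) =
  (M ^ d)%:R * (q * ((lv i)%:R + (lv j)%:R + 2)) by field; rewrite lt0r_neq0.
by rewrite mulrCA ler_wpM2l.
Qed.

Let kappa_ge0 : 0 <= kappa.
Proof. by rewrite /kappa !mulr_ge0 ?invr_ge0 // ltW. Qed.

Let range_bound i j (l r : nat) : e i j -> kappa * (2 * l%:R + 2) < (r ^ d)%:R ->
  (lv i <= l)%N -> (lv j <= l)%N -> (bdist (blk (cl i)) (blk (cl j)) <= r)%N.
Proof.
move=> ij lr li lj; have := adj_levels ij; set b := bdist _ _ => h.
have : (b.-1 ^ d)%:R < (r ^ d)%:R :> R.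
  apply: le_lt_trans lr; apply: le_trans h _; rewrite ler_wpM2l //.
  have : (lv i)%:R <= l%:R :> R by rewrite ler_nat.
  have : (lv j)%:R <= l%:R :> R by rewrite ler_nat.
  lra.
by rewrite ltr_nat ltn_exp2r //; lia.
Qed.

Lemma gtg_poincare : graph_connected e -> (3 <= k0)%N -> (0 < J)%N -> (L < S)%N ->
  (L.+1 * J <= Rw)%N -> (((Rw + rho.*2).*2.+1) ^ d <= wd)%N ->
  poincare e (poincare_const R d M S k0 D wd).
Proof.
move=> conn k03 J0 LS JRw Hw.
have d1 : (1 < d)%N by [].
apply: (@cell_poincare R n d M S e cl lv k0 L K0 J rho Rw D wd
  (Ordinal d_gt0) (Ordinal d1)) => //.
- exact: gtg_adj_sym.
- by move=> i j ij li lj; apply: (range_bound ij light_range); apply: ltnW.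
- move=> i j ij; apply: (range_bound ij max_range); rewrite /level_of; apply: ltnW; exact: ltn_ord.
(* For a neighbour at least as heavy, the sum of the levels is at most twice its own, as in
   [in_reach]. *)
- move=> i; have /forallP/(_ (blk (cl i))) := reach; apply: leq_trans.
  apply: subset_leq_card; apply/fintype.subsetP => j; rewrite !inE => /andP[ij lij].
  rewrite /in_reach; apply: le_trans (adj_levels ij) _; rewrite ler_wpM2l //.
  have : (lv i)%:R <= (lv j)%:R :> R by rewrite ler_nat.
  rewrite /level_of; lra.
- move=> B; have /forallP/(_ B) := reach; apply: leq_trans.
  apply: subset_leq_card; apply/fintype.subsetP => j; rewrite !inE => /eqP bj.
  rewrite /in_reach bj bdistxx exp0n //; apply: mulr_ge0 => //; exact: kappa_ge0.
- by move=> B; have /forallP/(_ B) := bad.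
- by move=> B; apply: leq_trans (card_ball _ _) _.
- by apply: leq_trans JRw; rewrite muln_gt0.
Qed.

End GeometricPoincare.

(** * Choice of the scales *)

Section ScaleChoice.
Variables (R : realType) (d : nat) (c q p0 mu beta : R) (n : nat).
Hypothesis d_ge2 : (2 <= d)%N.
Hypothesis c_gt0 : 0 < c.
Hypothesis q_gt0 : 0 < q.
Hypothesis p0_gt0 : 0 < p0.
Hypothesis mu_ge0 : 0 <= mu.

(* [scale] is, up to a constant, the inverse of the connection radius of light nodes.
   Weight levels are capped at [levels], which keeps every edge shorter than [reach_radius]
   blocks; [beta] is taken just below [1 / d], so that the cap is exceeded with probability
   tending to zero while the windows of [win_size] blocks stay small enough for
   [base_small]. *)
Definition cell_const : R := c / q * (2 * d%:R) ^+ d.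
(** There are at most [(2 * (1 + cell_const)) ^ d * (n / lnn)] cells; with core mass at least
    [p0 / 2], half the expected core of a cell is then at least [occ_rate * lnn]. *)
Definition occ_rate : R := p0 / (4 * (2 * (1 + cell_const)) ^+ d).
(** Makes [L + 1] bad cells cost at most n^-2, enough for a union over O(n) blocks. Taking [side]
    larger afterwards is not circular: [blk_const] is divided by it, so the cell size behind
    [occ_rate] does not depend on [side]. *)
Definition bad_bound : nat := Num.truncn (4 / occ_rate).
Definition side : nat := bad_bound.+1.
Definition blk_const : R := (1 + cell_const) / side%:R.
Definition kap_max : R := q * (2 * blk_const) ^+ d / c.
Definition heavy_lvl : nat := (Num.truncn (c * d%:R ^+ d / (blk_const ^+ d * q))).+1.
Definition jump : nat := (Num.truncn (kap_max * (2 * heavy_lvl%:R + 2))).+1.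
(** Room for the [L + 1] annuli of width [jump] in [isolated_confined]. *)
Definition win_radius : nat := (bad_bound.+1 * jump)%N.
(** Bounds, per unit of [lnn], three times the expected number of nodes in reach of a block; the 3
    is that of [chernoff_upper], and [mu] bounds the mean level. *)
Definition reach_rate : R :=
  3 * (5%:R ^+ d * (1 + kap_max * (2 * mu + 2))) / blk_const ^+ d.

Definition lnn : R := ln n%:R.
Definition scale : R := (n%:R / lnn) `^ (d%:R^-1).
Definition blocks : nat := (Num.truncn (blk_const * scale)).+1.
Definition core_min : nat := Num.truncn (occ_rate * lnn / 2).
(** The surplus 2 over [reach_rate] becomes the factor n^-2 of the Chernoff bound. *)
Definition deg_bound : nat := (Num.truncn ((reach_rate + 2) * lnn)).+1.
Definition range_base : R := n%:R `^ (beta / d%:R).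
Definition reach_radius : nat := (Num.truncn range_base).+1.
Definition levels : nat := Num.truncn (reach_radius%:R ^+ d / (4 * kap_max)).
Definition win_size : nat := ((win_radius + reach_radius.*2).*2.+1 ^ d)%N.
Definition theta_n : R := c * n%:R / lnn.
Definition kap_n : R := q * (blocks ^ d)%:R / theta_n.

Let d_gt0 : (0 < d)%N. Proof. exact: ltnW. Qed.
Let dR_gt0 : 0 < d%:R :> R. Proof. by rewrite ltr0n. Qed.

Lemma cell_const_gt0 : 0 < cell_const.
Proof. by rewrite /cell_const mulr_gt0 ?divr_gt0 // exprn_gt0 // mulr_gt0. Qed.

Let a1_gt0 : 0 < 1 + cell_const. Proof. by have := cell_const_gt0; lra. Qed.

Lemma occ_rate_gt0 : 0 < occ_rate.
Proof. by rewrite /occ_rate divr_gt0 // mulr_gt0 // exprn_gt0 // mulr_gt0. Qed.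

Lemma blk_const_gt0 : 0 < blk_const. Proof. by rewrite divr_gt0. Qed.

Lemma kap_max_gt0 : 0 < kap_max.
Proof.
by rewrite divr_gt0 // mulr_gt0 // exprn_gt0 // mulr_gt0 // blk_const_gt0.
Qed.

Lemma reach_rate_ge0 : 0 <= reach_rate.
Proof.
rewrite divr_ge0 ?exprn_ge0 ?(ltW blk_const_gt0) // mulr_ge0 // mulr_ge0 ?exprn_ge0 //.
have : 0 <= kap_max * (2 * mu + 2).
  by rewrite mulr_ge0 ?(ltW kap_max_gt0) //; have := mu_ge0; lra.
lra.
Qed.

Hypothesis n_gt0 : (0 < n)%N.
Hypothesis lnn_ge1 : 1 <= lnn.
Hypothesis scale_big : 1 <= blk_const * scale.
Hypothesis scale_ge1 : 1 <= scale.
Hypothesis occ_big : 16 <= occ_rate * lnn.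
Hypothesis base_ge1 : 1 <= range_base.
Hypothesis base_big : 8 * kap_max <= range_base ^+ d.
Hypothesis base_small : (range_base ^+ d) ^+ 2 * lnn ^+ 4 <= n%:R `^ (2 / d%:R).

Let lnn_gt0 : 0 < lnn. Proof. exact: lt_le_trans lnn_ge1. Qed.
Let nR_gt0 : 0 < n%:R :> R. Proof. by rewrite ltr0n. Qed.
Let t : R := n%:R / lnn.
Let t_gt0 : 0 < t. Proof. by rewrite divr_gt0. Qed.
Let scale_gt0 : 0 < scale. Proof. exact: lt_le_trans scale_ge1. Qed.
Let theta_gt0 : 0 < theta_n. Proof. by rewrite divr_gt0 // mulr_gt0. Qed.
Let theta_t : theta_n = c * t. Proof. by rewrite /theta_n /t mulrA. Qed.

Lemma scale_pow : scale ^+ d = n%:R / lnn.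
Proof.
rewrite /scale -powR_mulrn ?powR_ge0 // -powRrM mulVf ?lt0r_neq0 //.
by rewrite powRr1 // ltW.
Qed.

Let scale_t : scale ^+ d = t. Proof. exact: scale_pow. Qed.

Let blocks_ge : blk_const * scale <= blocks%:R.
Proof. by apply: ltW; exact: truncnS_gt. Qed.

Let blocks_le : blocks%:R <= 2 * blk_const * scale.
Proof.
have sb := scale_big; have h0 : 0 <= blk_const * scale by lra.
rewrite /blocks -natr1; have /andP[h _] := truncn_itv h0.
rewrite -mulrA; lra.
Qed.

Let powd (x y : R) : 0 <= x -> x <= y -> x ^+ d <= y ^+ d.
Proof. by move=> x0 xy; rewrite lerXn2r ?nnegrE // (le_trans x0). Qed.

Let le_powd (x : R) : 1 <= x -> x <= x ^+ d.
Proof. by move=> x1; rewrite -[leLHS]expr1 ler_weXn2l. Qed.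

Let b_gt0 := blk_const_gt0.

Let blocks_pow_ge : blk_const ^+ d * t <= (blocks ^ d)%:R.
Proof. by rewrite natrX -scale_t -exprMn; apply: powd => //; rewrite mulr_ge0 // ltW. Qed.

Let blocks_pow_le : (blocks ^ d)%:R <= (2 * blk_const) ^+ d * t.
Proof. by rewrite natrX -scale_t -exprMn; apply: powd. Qed.

Let side_blk : side%:R * blk_const = 1 + cell_const.
Proof. by rewrite /blk_const mulrC divfK // lt0r_neq0. Qed.

Let cells_pow_ge : cell_const * t <= (blocks * side)%:R ^+ d.
Proof.
rewrite natrM exprMn [blocks%:R ^+ d * _]mulrC -[blocks%:R ^+ d]natrX.
apply: (@le_trans _ _ (side%:R ^+ d * (blk_const ^+ d * t))); last first.
  by rewrite ler_wpM2l // exprn_ge0.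
rewrite mulrA -exprMn side_blk ler_wpM2r ?(ltW t_gt0) //.
apply: (@le_trans _ _ (1 + cell_const)); first by rewrite lerDr.
by apply: le_powd; have := cell_const_gt0; lra.
Qed.

Let cells_pow_le : (blocks * side)%:R ^+ d <= (2 * (1 + cell_const)) ^+ d * t.
Proof.
rewrite natrM exprMn [blocks%:R ^+ d * _]mulrC -[blocks%:R ^+ d]natrX.
apply: (@le_trans _ _ (side%:R ^+ d * ((2 * blk_const) ^+ d * t))).
  by rewrite ler_wpM2l // exprn_ge0.
rewrite mulrA -exprMn (_ : side%:R * (2 * blk_const) = 2 * (1 + cell_const)) //.
by rewrite mulrCA side_blk.
Qed.

Lemma core_range_ok : theta_n * (2 * d%:R / (blocks * side)%:R) ^+ d <= q.
Proof.
rewrite expr_div_n mulrA ler_pdivrMr ?exprn_gt0 //.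
apply: (@le_trans _ _ (q * (cell_const * t))); last by rewrite ler_wpM2l // ltW.
rewrite theta_t /cell_const le_eqVlt; apply/orP; left; apply/eqP.
by field; rewrite lt0r_neq0.
Qed.

Lemma heavy_range_ok : theta_n * (d%:R / blocks%:R) ^+ d <= heavy_lvl%:R * q.
Proof.
rewrite expr_div_n mulrA ler_pdivrMr ?exprn_gt0 ?ltr0n // -[blocks%:R ^+ d]natrX.
have h : c * d%:R ^+ d / (blk_const ^+ d * q) <= heavy_lvl%:R.
  by apply: ltW; exact: truncnS_gt.
apply: (@le_trans _ _ (heavy_lvl%:R * q * (blk_const ^+ d * t))); last first.
  by rewrite ler_wpM2l // mulr_ge0 // ltW.
move: h; rewrite ler_pdivrMr ?mulr_gt0 ?exprn_gt0 // => h.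
have -> : theta_n * d%:R ^+ d = c * d%:R ^+ d * t by rewrite theta_t; ring.
have -> : heavy_lvl%:R * q * (blk_const ^+ d * t) =
  heavy_lvl%:R * (blk_const ^+ d * q) * t by ring.
by rewrite ler_wpM2r // ltW.
Qed.

Lemma kap_n_ge0 : 0 <= kap_n.
Proof. by apply: divr_ge0; [rewrite mulr_ge0 // ltW | exact: ltW]. Qed.

Lemma kap_n_le : kap_n <= kap_max.
Proof.
rewrite /kap_n /kap_max ler_pdivrMr ?theta_gt0 // theta_t.
have -> : q * (2 * blk_const) ^+ d / c * (c * t) = q * ((2 * blk_const) ^+ d * t).
  by field; rewrite lt0r_neq0.
by rewrite ler_wpM2l // ltW.
Qed.

Lemma light_range_ok : kap_n * (2 * heavy_lvl%:R + 2) < (jump ^ d)%:R.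
Proof.
apply: (@le_lt_trans _ _ (kap_max * (2 * heavy_lvl%:R + 2))).
  by rewrite ler_wpM2r ?kap_n_le // addr_ge0 // mulr_ge0.
apply: (@lt_le_trans _ _ jump%:R); first exact: truncnS_gt.
by rewrite natrX; apply: le_powd; rewrite ler1n.
Qed.

Let range_ge : range_base <= reach_radius%:R. Proof. by apply: ltW; exact: truncnS_gt. Qed.

Let range_le : reach_radius%:R <= 2 * range_base.
Proof.
have rb := base_ge1; have h0 : 0 <= range_base by lra.
by rewrite /reach_radius -natr1; have /andP[h _] := truncn_itv h0; lra.
Qed.

Let base_pow_le : range_base ^+ d <= reach_radius%:R ^+ d.
Proof. by apply: powd => //; have := base_ge1; lra. Qed.

Let kp4 : 0 < 4 * kap_max.
Proof. by rewrite mulr_gt0 // kap_max_gt0. Qed.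

Let levels_arg : 2 <= reach_radius%:R ^+ d / (4 * kap_max).
Proof.
rewrite ler_pdivlMr ?kp4 //.
have kp := kap_max_gt0; apply: le_trans base_pow_le; apply: le_trans base_big; lra.
Qed.

Lemma max_range_ok : kap_n * (2 * levels%:R + 2) < (reach_radius ^ d)%:R.
Proof.
have kp := kap_max_gt0; have kn := kap_n_le; have k0 := kap_n_ge0.
apply: (@le_lt_trans _ _ (kap_max * (2 * levels%:R + 2))).
  by rewrite ler_wpM2r // addr_ge0 // mulr_ge0.
have h0 : 0 <= reach_radius%:R ^+ d / (4 * kap_max) by have := levels_arg; lra.
have /andP[h _] := truncn_itv h0; rewrite -/levels in h.
have : levels%:R * (4 * kap_max) <= reach_radius%:R ^+ d by rewrite -ler_pdivlMr ?kp4.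
rewrite natrX; have := base_pow_le; have := base_big; lra.
Qed.

Lemma levels_ge : range_base ^+ d <= 8 * kap_max * levels%:R.
Proof.
have kp := kap_max_gt0; have la := levels_arg.
have h0 : 0 <= reach_radius%:R ^+ d / (4 * kap_max) by lra.
have /andP[_ h] := truncn_itv h0; rewrite -/levels -[levels.+1%:R]natr1 in h.
have : reach_radius%:R ^+ d / (4 * kap_max) <= 2 * levels%:R by lra.
rewrite ler_pdivrMr ?kp4 // => h2.
apply: le_trans base_pow_le _; apply: le_trans h2 _; lra.
Qed.

Let core_min_arg : 0 <= occ_rate * lnn / 2.
Proof. by have := occ_big; lra. Qed.

Let core_min_le : core_min%:R <= occ_rate * lnn / 2.
Proof. by have /andP[] := truncn_itv core_min_arg. Qed.

Let core_min_ge : occ_rate * lnn / 4 <= core_min%:R.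
Proof.
have /andP[_] := truncn_itv core_min_arg; rewrite -/core_min -[core_min.+1%:R]natr1.
have := occ_big; lra.
Qed.

Lemma core_min_ge3 : (3 <= core_min)%N.
Proof. by rewrite -(ler_nat R); have := core_min_ge; have := occ_big; lra. Qed.

Lemma slack_ge (cm : R) : p0 / 2 <= cm ->
  occ_rate * lnn / 2 <= n%:R * cm / (2 * ((blocks * side) ^ d)%:R) - core_min%:R.
Proof.
move=> cmp; rewrite lerBrDr.
apply: (@le_trans _ _ (occ_rate * lnn)); first by have := core_min_le; lra.
rewrite natrX ler_pdivlMr ?mulr_gt0 ?exprn_gt0 //.
have oc := occ_rate_gt0.
apply: (@le_trans _ _ (occ_rate * lnn * (2 * ((2 * (1 + cell_const)) ^+ d * t)))).
  apply: ler_wpM2l; last by rewrite ler_wpM2l.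
  by apply: mulr_ge0; apply: ltW; [exact: oc | exact: lnn_gt0].
apply: (@le_trans _ _ (n%:R * (p0 / 2))); last by rewrite ler_wpM2l.
rewrite /t /occ_rate le_eqVlt; apply/orP; left; apply/eqP.
by field; rewrite !lt0r_neq0 ?exprn_gt0 // mulr_gt0.
Qed.

Let exp_ln2 : expR (- (2 * lnn)) = (n%:R ^+ 2)^-1 :> R.
Proof. by rewrite expRN expRM_natl /lnn lnK ?posrE. Qed.

Let t_le : t <= n%:R.
Proof. by rewrite ler_pdivrMr // ler_peMr. Qed.

Let blocks_err (y : R) : y <= - (2 * lnn) ->
  (blocks ^ d)%:R * expR y <= (2 * blk_const) ^+ d / n%:R.
Proof.
move=> hy; apply: (@le_trans _ _ ((2 * blk_const) ^+ d * n%:R * (n%:R ^+ 2)^-1)).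
  apply: ler_pM => //; rewrite ?expR_ge0 //.
    apply: le_trans blocks_pow_le _; rewrite ler_wpM2l // exprn_ge0 // mulr_ge0 //.
    exact: ltW.
  by rewrite -exp_ln2 ler_expR.
by rewrite le_eqVlt; apply/orP; left; apply/eqP; field; rewrite lt0r_neq0.
Qed.

Lemma bad_error (cm : R) : p0 / 2 <= cm ->
  (blocks ^ d)%:R * (2 ^ (win_radius.*2.+1 ^ d * side ^ d))%:R *
   expR (- bad_bound.+1%:R * (n%:R * cm / (2 * ((blocks * side) ^ d)%:R) - core_min%:R))
  <= (2 ^ (win_radius.*2.+1 ^ d * side ^ d))%:R * ((2 * blk_const) ^+ d / n%:R).
Proof.
move=> /slack_ge h; rewrite -mulrA mulrCA ler_wpM2l //; apply: blocks_err.
rewrite mulNr lerN2; have oc := occ_rate_gt0.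
apply: (@le_trans _ _ (bad_bound.+1%:R * (occ_rate * lnn / 2))); last by rewrite ler_wpM2l.
have : 4 / occ_rate < bad_bound.+1%:R by exact: truncnS_gt.
rewrite ltr_pdivrMr // => /ltW h2.
have : 4 * lnn <= bad_bound.+1%:R * occ_rate * lnn by rewrite ler_wpM2r // ltW.
lra.
Qed.

Lemma reach_error (rm : R) :
  rm <= 5%:R ^+ d / (blocks ^ d)%:R * (1 + kap_max * (2 * mu + 2)) ->
  (blocks ^ d)%:R * expR (3 * n%:R * rm - deg_bound%:R) <= (2 * blk_const) ^+ d / n%:R.
Proof.
move=> h; apply: blocks_err.
have hD : (reach_rate + 2) * lnn < deg_bound%:R by exact: truncnS_gt.
suff : 3 * n%:R * rm <= reach_rate * lnn by lra.
have B0 : 0 < (blocks ^ d)%:R :> R by rewrite ltr0n expn_gt0.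
apply: (@le_trans _ _ (3 * n%:R * (5%:R ^+ d / (blocks ^ d)%:R *
    (1 + kap_max * (2 * mu + 2))))); first by rewrite ler_wpM2l // mulr_ge0.
have bd : 0 < blk_const ^+ d by rewrite exprn_gt0.
have -> : 3 * n%:R * (5%:R ^+ d / (blocks ^ d)%:R * (1 + kap_max * (2 * mu + 2))) =
   3 * (5%:R ^+ d * (1 + kap_max * (2 * mu + 2))) * n%:R / (blocks ^ d)%:R.
  by field; rewrite lt0r_neq0.
rewrite ler_pdivrMr // /reach_rate.
set Y := 3 * (5%:R ^+ d * _).
have Y0 : 0 <= Y.
  rewrite mulr_ge0 // mulr_ge0 ?exprn_ge0 //.
  have : 0 <= kap_max * (2 * mu + 2).
    by rewrite mulr_ge0 ?(ltW kap_max_gt0) //; have := mu_ge0; lra.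
  lra.
apply: (@le_trans _ _ (Y / blk_const ^+ d * lnn * (blk_const ^+ d * t))).
  rewrite /t le_eqVlt; apply/orP; left; apply/eqP.
  by field; rewrite !lt0r_neq0.
apply: ler_wpM2l; last exact: blocks_pow_ge.
by apply: mulr_ge0; [apply: divr_ge0 => //; exact: ltW | exact: (ltW lnn_gt0)].
Qed.

(** Bound for [deg_bound / core_min], where the logarithms cancel. *)
Definition ratio_const : R := 4 * (reach_rate + 3) / occ_rate.
Definition win_const : R := (2 * (2 * win_radius%:R + 5)) ^+ d.
Definition gap_const : R :=
  2 * (1 + 8 * (12 * ratio_const + 36 * side%:R ^+ d * ratio_const ^+ 2 +
                112 * side%:R ^+ d * (win_const ^+ 2 * (reach_rate + 3) ^+ 3))
         + 16 * ratio_const ^+ 2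
         + 480 * ((d ^ 2)%:R * side%:R ^+ d * (4 * blk_const ^+ 2) * ratio_const ^+ 2)).

Let deg_le : deg_bound%:R <= (reach_rate + 3) * lnn.
Proof.
have h0 : 0 <= (reach_rate + 2) * lnn.
  by rewrite mulr_ge0 ?(ltW lnn_gt0) // addr_ge0 // reach_rate_ge0.
have l1 := lnn_ge1; rewrite /deg_bound -[leLHS]natr1.
by have /andP[h _] := truncn_itv h0; lra.
Qed.

Let deg_ratio : deg_bound%:R / core_min%:R <= ratio_const.
Proof.
have oc := occ_rate_gt0.
have k0 : 0 < core_min%:R :> R by rewrite ltr0n (leq_trans _ core_min_ge3).
rewrite ler_pdivrMr //; apply: le_trans deg_le _.
apply: (@le_trans _ _ (ratio_const * (occ_rate * lnn / 4))).
  rewrite /ratio_const le_eqVlt; apply/orP; left; apply/eqP.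
  by field; rewrite lt0r_neq0.
rewrite ler_wpM2l // /ratio_const divr_ge0 ?(ltW oc) // mulr_ge0 // addr_ge0 //.
exact: reach_rate_ge0.
Qed.

Let win_le : win_size%:R <= win_const * range_base ^+ d.
Proof.
rewrite /win_size /win_const natrX -exprMn; apply: powd => //.
apply: (@le_trans _ _ ((2 * win_radius%:R + 5) * reach_radius%:R)).
  have r1 : 1 <= reach_radius%:R :> R by rewrite ler1n.
  have -> : (win_radius + reach_radius.*2).*2.+1%:R =
      2 * win_radius%:R + 4 * reach_radius%:R + 1 :> R.
    move: win_radius reach_radius => a u'; rewrite -[LHS]natr1 -!mul2n !natrM natrD natrM; ring.
  have : 2 * win_radius%:R * 1 <= 2 * win_radius%:R * reach_radius%:R :> R.
    by rewrite ler_wpM2l // mulr_ge0.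
  lra.
have -> : 2 * (2 * win_radius%:R + 5) * range_base = (2 * win_radius%:R + 5) * (2 * range_base).
  by ring.
by rewrite ler_wpM2l // addr_ge0 // mulr_ge0.
Qed.

Lemma scale_sqr : scale ^+ 2 = n%:R `^ (2 / d%:R) / lnn `^ (2 / d%:R).
Proof.
rewrite /scale -powR_mulrn ?powR_ge0 // -powRrM [d%:R^-1 * _]mulrC.
rewrite powRM ?invr_ge0 ?ltW //; congr (_ * _).
by rewrite -powR_inv1 ?(ltW lnn_gt0) // -powRrM mulN1r powRN.
Qed.

Let scale_sqr_ge : n%:R `^ (2 / d%:R) <= scale ^+ 2 * lnn.
Proof.
rewrite scale_sqr -mulrA ler_peMr ?powR_ge0 // mulrC ler_pdivlMr ?powR_gt0 // mul1r.
rewrite -[leRHS](powRr1 (ltW lnn_gt0)) ler_powR // ler_pdivrMr // mul1r ler_nat.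
exact: d_ge2.
Qed.

(** The term of the crude window comparison. In [base_small], three powers of [lnn] pay for the
    degrees and the fourth for the loss in [scale_sqr_ge]. *)
Let win_deg : (win_size%:R ^+ 2) * deg_bound%:R ^+ 3 <=
  win_const ^+ 2 * (reach_rate + 3) ^+ 3 * scale ^+ 2.
Proof.
have rr := reach_rate_ge0.
apply: (@le_trans _ _ ((win_const * range_base ^+ d) ^+ 2 * ((reach_rate + 3) * lnn) ^+ 3)).
  apply: ler_pM; rewrite ?exprn_ge0 ?lerXn2r ?nnegrE //.
  - by apply: le_trans win_le.
  - by apply: le_trans deg_le.
have wc : 0 <= win_const ^+ 2 * (reach_rate + 3) ^+ 3.
  by rewrite mulr_ge0 ?sqr_ge0 // exprn_ge0 // addr_ge0.
have -> : (win_const * range_base ^+ d) ^+ 2 * ((reach_rate + 3) * lnn) ^+ 3 =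
  win_const ^+ 2 * (reach_rate + 3) ^+ 3 * ((range_base ^+ d) ^+ 2 * lnn ^+ 3) by ring.
rewrite ler_wpM2l // -(ler_pM2r lnn_gt0); apply: le_trans scale_sqr_ge.
by apply: le_trans base_small; rewrite -mulrA -exprSr.
Qed.

(** Outside the window term every power of [D] comes with the same power of [K], so it is bounded by
    a power of [ratio_const]. *)
Lemma poincare_const_le :
  poincare_const R d blocks side core_min deg_bound win_size <= gap_const * scale ^+ 2.
Proof.
rewrite /poincare_const /gap_const [(win_size ^ 2)%:R]natrX [(deg_bound ^ 2)%:R]natrX.
rewrite [(side ^ d)%:R]natrX [(blocks ^ 2)%:R]natrX ![(d ^ 2)%:R]natrX.
set K := core_min%:R^-1; set D := deg_bound%:R; set Sd := side%:R ^+ d; set r2 := scale ^+ 2.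
set w2 := win_size%:R ^+ 2.
have hDK : D * K <= ratio_const by exact: deg_ratio.
have K0 : 0 <= K by rewrite invr_ge0.
have D0 : 0 <= D by [].
have Sd0 : 0 <= Sd by rewrite exprn_ge0.
have r21 : 1 <= r2 by rewrite exprn_ege1.
have hW : w2 * D ^+ 3 <= win_const ^+ 2 * (reach_rate + 3) ^+ 3 * r2 by exact: win_deg.
have DK0 : 0 <= D * K by rewrite mulr_ge0.
have rc0 : 0 <= ratio_const by apply: le_trans hDK.
have sq : (D * K) ^+ 2 <= ratio_const ^+ 2 by rewrite lerXn2r ?nnegrE.
have up (x y : R) : x <= y -> 0 <= y -> x <= y * r2.
  by move=> xy y0; apply: le_trans xy _; rewrite ler_peMr.
have M2 : blocks%:R ^+ 2 <= 4 * blk_const ^+ 2 * r2.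
  have -> : 4 * blk_const ^+ 2 * r2 = (2 * blk_const * scale) ^+ 2 by rewrite /r2; ring.
  by rewrite lerXn2r ?nnegrE // mulr_ge0 ?mulr_ge0 // ltW.
have T1 : D * K <= ratio_const * r2 by apply: up.
have T2 : Sd * (D * K) ^+ 2 <= Sd * ratio_const ^+ 2 * r2.
  by apply: up; rewrite ?ler_wpM2l // mulr_ge0 // sqr_ge0.
have T3 : Sd * (w2 * D ^+ 3) <= Sd * (win_const ^+ 2 * (reach_rate + 3) ^+ 3) * r2.
  by rewrite -mulrA ler_wpM2l.
have T4 : (D * K) ^+ 2 <= ratio_const ^+ 2 * r2 by apply: up; rewrite // sqr_ge0.
have T5 : d%:R ^+ 2 * Sd * (blocks%:R ^+ 2 * (D * K) ^+ 2) <=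
   d%:R ^+ 2 * Sd * ((4 * blk_const ^+ 2 * r2) * ratio_const ^+ 2).
  by rewrite ler_wpM2l ?mulr_ge0 ?sqr_ge0 // ler_pM ?sqr_ge0.
have -> : 2 * (1 + 8 * D * (12 * K + 36 * Sd * K ^+ 2 * D + 112 * Sd * w2 * D ^+ 2) +
  16 * D ^+ 2 * K ^+ 2 + 480 * D ^+ 2 * (d%:R ^+ 2 * Sd * blocks%:R ^+ 2 * K ^+ 2)) =
  2 + 192 * (D * K) + 576 * (Sd * (D * K) ^+ 2) + 1792 * (Sd * (w2 * D ^+ 3)) +
  32 * (D * K) ^+ 2 + 960 * (d%:R ^+ 2 * Sd * (blocks%:R ^+ 2 * (D * K) ^+ 2)) by ring.
have -> : 2 * (1 + 8 * (12 * ratio_const + 36 * Sd * ratio_const ^+ 2 +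
      112 * Sd * (win_const ^+ 2 * (reach_rate + 3) ^+ 3)) + 16 * ratio_const ^+ 2 +
      480 * (d%:R ^+ 2 * Sd * (4 * blk_const ^+ 2) * ratio_const ^+ 2)) * r2 =
  2 * r2 + 192 * (ratio_const * r2) + 576 * (Sd * ratio_const ^+ 2 * r2) +
  1792 * (Sd * (win_const ^+ 2 * (reach_rate + 3) ^+ 3) * r2) +
  32 * (ratio_const ^+ 2 * r2) +
  960 * (d%:R ^+ 2 * Sd * (4 * blk_const ^+ 2 * r2 * ratio_const ^+ 2)) by ring.
lra.
Qed.

Lemma time_scale : scale ^+ 2 * lnn =
  n%:R `^ (2 / d%:R) * lnn `^ ((d%:R - 2) / d%:R).
Proof.
rewrite scale_sqr -mulrA; congr (_ * _).
have -> : (d%:R - 2) / d%:R = 1 - 2 / d%:R :> R by field; rewrite lt0r_neq0.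
rewrite powRB; last by rewrite lt0r_neq0 ?implybT.
by rewrite powRr1 ?(ltW lnn_gt0) // mulrC.
Qed.

Lemma gap_const_ge2 : 2 <= gap_const.
Proof.
have rr := reach_rate_ge0; have oc := occ_rate_gt0.
have rc0 : 0 <= ratio_const.
  by rewrite /ratio_const divr_ge0 ?(ltW oc) // mulr_ge0 // addr_ge0.
have Sd0 : 0 <= side%:R ^+ d :> R by rewrite exprn_ge0.
have X1 : 0 <= 36 * side%:R ^+ d * ratio_const ^+ 2.
  by apply: mulr_ge0; [exact: mulr_ge0 | exact: sqr_ge0].
have X2 : 0 <= 112 * side%:R ^+ d * (win_const ^+ 2 * (reach_rate + 3) ^+ 3).
  apply: mulr_ge0; first exact: mulr_ge0.
  by apply: mulr_ge0; [exact: sqr_ge0 | apply: exprn_ge0; rewrite addr_ge0].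
have X3 : 0 <= ratio_const ^+ 2 by rewrite sqr_ge0.
have X4 : 0 <= (d ^ 2)%:R * side%:R ^+ d * (4 * blk_const ^+ 2) * ratio_const ^+ 2.
  apply: mulr_ge0; last exact: sqr_ge0.
  by apply: mulr_ge0; [exact: mulr_ge0 | apply: mulr_ge0 => //; exact: sqr_ge0].
rewrite /gap_const; lra.
Qed.

End ScaleChoice.

Local Open Scope classical_set_scope.
Local Open Scope ring_scope.

(** * Probability of the good configurations *)

Lemma bigsetU_witness (T : Type) (I : finType) (G : pred I) (E : I -> set T) :
  \big[setU/set0]_(i | G i) E i `<=` [set x | exists2 i, G i & E i x].
Proof.
apply: (big_ind (fun S => S `<=` [set x | exists2 i, G i & E i x])) => //.
- by move=> A B HA HB x [/HA|/HB].
- by move=> i Gi x Ex; exists i.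
Qed.

Lemma probability_bigU (R : realType) (d0 : measure_display) (T : measurableType d0)
  (P : probability T R) (I : finType) (G : pred I) (E : I -> set T) :
  (forall i, measurable (E i)) -> (forall i j x, E i x -> E j x -> i = j) ->
  P (\big[setU/set0]_(i | G i) E i) = (\sum_(i | G i) P (E i))%E.
Proof.
move=> mE dE; elim: (index_enum I) (index_enum_uniq I) => [|i s IH] /=.
  by rewrite !big_nil measure0.
case/andP => nis us; rewrite !big_cons; case: ifP => Gi; last exact: IH.
have mU : measurable (\big[setU/set0]_(j <- s | G j) E j).
  by apply: bigsetU_measurable => j _; exact: mE.
have dU : E i `&` \big[setU/set0]_(j <- s | G j) E j = set0.
  rewrite -subset0 => x [Eix]; rewrite big_seq_cond.
  apply: (big_ind (fun S : set T => S x -> False)) => //.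
    by move=> A B HA HB [/HA|/HB].
  by move=> j /andP[js _] Ejx; move: nis; rewrite (dE _ _ _ Eix Ejx) js.
by rewrite measureU //; congr (_ + _)%E; exact: IH.
Qed.

Section ConfigurationEvents.
Variables (R : realType) (d0 : measure_display) (T : measurableType d0).
Variables (P : probability T R) (f : R -> R) (d n : nat).
Variables (X : nat -> nat -> T -> R) (W : nat -> T -> R).
Variables (M S Lev : nat) (q : R).
Notation cell := {ffun 'I_d -> 'I_M * 'I_S}.
Notation conf := {ffun 'I_n -> cell * 'I_Lev}.
Implicit Types (z : conf).

Definition grid_bin (m a : nat) : set R := `[a%:R / m%:R, a.+1%:R / m%:R[.

Definition level_bin (l : nat) : set R := `[l%:R * q, l.+1%:R * q[.

Definition level_prob (l : nat) : R := fine (\int[@lebR R]_(x in level_bin l `&` @Rnn R) (f x)%:E).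

Definition bins z (a : ('I_n * 'I_d) + 'I_n) : set R :=
  match a with
  | inl ik => grid_bin (M * S) (cellnum (cell_of z ik.1) ik.2)
  | inr i => level_bin (level_of z i)
  end.

(** Half-open bins make the events of distinct configurations disjoint. Weights at or above the cap
    lie in none of them, so their union may have probability less than one. *)
Definition conf_event z : set T := \bigcap_a (gtg_var X W a @^-1` bins z a).

Hypothesis model : gtg_model P f d n X W.
Hypothesis MS_gt0 : (0 < M * S)%N.
Hypothesis q_gt0 : 0 < q.

Let N0 : 0 < (M * S)%:R :> R. Proof. by rewrite ltr0n. Qed.

Let measurable_bins z a : measurable (bins z a).
Proof. by case: a => a /=; rewrite ?/grid_bin ?/level_bin; apply: measurable_itv. Qed.

Lemma measurable_conf_event z : measurable (conf_event z).
Proof.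
have [[mY _] _] := model.
apply: fin_bigcap_measurable => [|a _]; first exact: finite_finset.
by rewrite -[_ @^-1` _]setTI; apply: mY.
Qed.

Lemma grid_binP m a x : (0 < m)%N -> grid_bin m a x -> a%:R <= m%:R * x < a.+1%:R.
Proof.
move=> m0; rewrite /grid_bin /= in_itv /= => /andP[h1 h2].
have m0R : 0 < m%:R :> R by rewrite ltr0n.
by rewrite -ler_pdivrMl // -ltr_pdivlMl // ![_^-1 * _]mulrC h1.
Qed.

Lemma conf_eventP z om : conf_event z om ->
  (forall i k, (cellnum (cell_of z i) k)%:R <= (M * S)%:R * X i k om
     < (cellnum (cell_of z i) k).+1%:R) /\
  (forall i, (level_of z i)%:R * q <= W i om < (level_of z i).+1%:R * q).
Proof.
move=> H; split=> [i k|i].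
  by have := H (inl (i, k)) I; apply: grid_binP.
by have := H (inr i) I; rewrite /preimage /= /level_bin /= in_itv.
Qed.

Let nat_bin_inj (a b : nat) (y : R) : a%:R <= y < a.+1%:R -> b%:R <= y < b.+1%:R -> a = b.
Proof.
move=> /andP[a1 a2] /andP[b1 b2].
have := le_lt_trans a1 b2; have := le_lt_trans b1 a2; rewrite !ltr_nat; lia.
Qed.

Lemma cellnum_inj (A C : cell) : (forall k, cellnum A k = cellnum C k) -> A = C.
Proof.
move=> H; apply/ffunP => k; have := H k; rewrite /cellnum.
case: (A k) (C k) => a l [b m] /= E.
have S0 : (0 < S)%N by apply: leq_ltn_trans (ltn_ord l).
have ab : a = b.
  apply: val_inj; have := congr1 (divn^~ S) E.
  by rewrite /= !divnMDl // !divn_small // !addn0.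
have lm : l = m by apply: val_inj => /=; move: E; rewrite ab; lia.
by rewrite ab lm.
Qed.

Lemma conf_event_inj z z' om : conf_event z om -> conf_event z' om -> z = z'.
Proof.
move=> /conf_eventP[h1 h2] /conf_eventP[h3 h4]; apply/ffunP => i.
rewrite [LHS]surjective_pairing [RHS]surjective_pairing; congr (_, _).
  by apply: cellnum_inj => k; apply: nat_bin_inj (h1 i k) (h3 i k).
apply: val_inj => /=; apply: (@nat_bin_inj _ _ (W i om / q)).
  by have := h2 i; rewrite ler_pdivlMr // ltr_pdivrMr.
by have := h4 i; rewrite ler_pdivlMr // ltr_pdivrMr.
Qed.

Let grid_prob (i : 'I_n) (k : 'I_d) z :
  fine (P (X i k @^-1` grid_bin (M * S) (cellnum (cell_of z i) k))) = (M * S)%:R^-1.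
Proof.
have [_ [HX _]] := model; rewrite HX; last exact: measurable_itv.
set a := cellnum _ _.
have aN : (a < M * S)%N.
  rewrite /a /cellnum; have := ltn_ord (cell_of z i k).1; have := ltn_ord (cell_of z i k).2.
  move: (nat_of_ord (cell_of z i k).1) (nat_of_ord (cell_of z i k).2) => b l lS bM.
  apply: (@leq_trans (b.+1 * S)); last by rewrite leq_mul2r bM orbT.
  by rewrite mulSn addnC ltn_add2r.
rewrite setIidl; last first.
  move=> x; rewrite /grid_bin /= !in_itv /= => /andP[h1 /ltW h2]; apply/andP; split.
    by apply: le_trans h1; rewrite divr_ge0.
  by apply: le_trans h2 _; rewrite ler_pdivrMr // mul1r ler_nat.
rewrite /lebR /grid_bin lebesgue_measure_itv /= lte_fin ltr_pM2r ?invr_gt0 // ltr_nat ltnSn.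
by rewrite -EFinB /= -mulrBl -natr1 addrAC subrr add0r mul1r.
Qed.

(** By independence each of the [d] coordinates of a node contributes [(M * S)^-1]: its cell is
    uniform and independent of its level. *)
Lemma conf_event_prob z :
  P (conf_event z) = (\prod_i state_weight (fun l : 'I_Lev => level_prob l) (z i))%:E.
Proof.
have [[_ HI] [_ HW]] := model; rewrite HI //; congr EFin.
rewrite big_sumType /= -(pair_bigA _ (fun (i : 'I_n) (k : 'I_d) =>
  fine (P (X i k @^-1` grid_bin (M * S) (cellnum (cell_of z i) k))))) /=.
rewrite -big_split /=; apply: eq_bigr => i _; rewrite /state_weight; congr (_ * _).
  rewrite (eq_bigr (fun=> (M * S)%:R^-1)); last by move=> k _; exact: grid_prob.
  by rewrite prodr_const card_ord natrX exprVn.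
by rewrite HW //; exact: measurable_itv.
Qed.

Lemma level_prob_ge0 l : (forall x, 0 <= f x) -> 0 <= level_prob l.
Proof. by move=> f0; rewrite fine_ge0 // integral_ge0 // => x _; rewrite lee_fin. Qed.

Definition config_event (G : pred conf) : set T := \big[setU/set0]_(z | G z) conf_event z.

Lemma measurable_config_event G : measurable (config_event G).
Proof. by apply: bigsetU_measurable => z _; exact: measurable_conf_event. Qed.

Lemma config_event_prob G : P (config_event G) =
  (prodw (state_weight (M := M) (S := S) (d := d) (fun l : 'I_Lev => level_prob l)) G)%:E.
Proof.
rewrite /config_event probability_bigU; last 2 first.
- exact: measurable_conf_event.
- exact: conf_event_inj.
by rewrite /prodw -sumEFin; apply: eq_bigr => z _; exact: conf_event_prob.
Qed.

End ConfigurationEvents.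

(** * Tails, levels and mean of the weights *)

Section WeightLaw.
Variables (R : realType) (d0 : measure_display) (T : measurableType d0).
Variables (P : probability T R) (f : R -> R) (Y : T -> R).
Hypothesis f_dens : weight_density f.
Hypothesis mY : measurable_fun setT Y.
Hypothesis law : forall B : set R, measurable B ->
  P (Y @^-1` B) = (\int[@lebR R]_(x in B `&` @Rnn R) (f x)%:E)%E.

Let f_ge0 x : 0 <= f x. Proof. by case: f_dens. Qed.
Let mf : measurable_fun setT f. Proof. by case: f_dens => _ []. Qed.

Let mRnn : measurable (@Rnn R). Proof. exact: measurable_itv. Qed.

Let mpre (B : set R) : measurable B -> measurable (Y @^-1` B).
Proof. by move=> mB; rewrite -[_ @^-1` _]setTI; exact: mY. Qed.

Let mfE (D : set R) : measurable_fun D (fun x => (f x)%:E).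
Proof. by apply/measurable_EFinP; apply: measurable_funTS. Qed.

Let integral_tail x : 0 <= x ->
  P (Y @^-1` `[x, +oo[%classic) = (\int[@lebR R]_(y in `[x, +oo[) (f y)%:E)%E.
Proof.
move=> x0; rewrite law; last exact: measurable_itv.
rewrite setIidl // => y; rewrite /Rnn /= !in_itv /= !andbT; exact: le_trans.
Qed.

Lemma tail_prob x : 0 <= x -> (tail f x)%:E = P (Y @^-1` `[x, +oo[%classic).
Proof.
move=> x0; rewrite /tail -integral_tail // fineK //; apply: fin_num_measure.
by apply: mpre; exact: measurable_itv.
Qed.

Lemma tail0 : tail f 0 = 1.
Proof.
apply: EFin_inj; rewrite tail_prob // integral_tail //.
have := law measurableT; rewrite preimage_setT probability_setT setTI => <-.
by [].
Qed.

Variable q : R.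
Hypothesis q_gt0 : 0 < q.

Let level_split (l : nat) :
  (`[l%:R * q, +oo[ = level_bin q l `|` `[l.+1%:R * q, +oo[)%classic.
Proof.
have h : l%:R * q <= l.+1%:R * q by rewrite ler_wpM2r ?ler_nat // ltW.
apply/seteqP; split => [x|x [|]]; rewrite /level_bin /= !in_itv /= ?andbT.
- by move=> lx; case: (ltP x (l.+1%:R * q)) => ?; [left; rewrite lx|right].
- by case/andP.
- exact: le_trans.
Qed.

Let level_disj (l : nat) : [disjoint level_bin q l & `[l.+1%:R * q, +oo[%classic]%classic.
Proof.
apply/disj_setPS => x [] /=; rewrite /level_bin /= !in_itv /= andbT => /andP[_ h1] h2.
by have := lt_le_trans h1 h2; rewrite ltxx.
Qed.

Let mlevel l : measurable (level_bin q l). Proof. exact: measurable_itv. Qed.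

Let level_sub l : level_bin q l `<=` @Rnn R.
Proof.
move=> x; rewrite /level_bin /Rnn /= !in_itv /= andbT => /andP[h _].
by apply: le_trans h; rewrite mulr_ge0 // ltW.
Qed.

Let level_probE l : (level_prob f q l)%:E = P (Y @^-1` level_bin q l).
Proof. by rewrite /level_prob -law // fineK // fin_num_measure //; exact: mpre. Qed.

Let lq_ge0 (l : nat) : 0 <= l%:R * q. Proof. by rewrite mulr_ge0 // ltW. Qed.

Lemma tail_step l : tail f (l%:R * q) = level_prob f q l + tail f (l.+1%:R * q).
Proof.
apply: EFin_inj; rewrite EFinD !tail_prob // level_probE level_split preimage_setU.
rewrite measureU //.
- by apply: mpre.
- by apply: mpre; exact: measurable_itv.
- rewrite -preimage_setI; have /disj_setPS := level_disj l; rewrite subset0 => ->.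
  exact: preimage_set0.
Qed.

Lemma sum_level_prob (m n : nat) : (m <= n)%N ->
  \sum_(m <= l < n) level_prob f q l = tail f (m%:R * q) - tail f (n%:R * q).
Proof.
move=> mn; rewrite (@telescope_sumr_eq _ _ _ (fun l => - tail f (l%:R * q)) _ mn).
  by rewrite opprK addrC.
by move=> l _; rewrite opprK (tail_step l) addrC addrK.
Qed.

Let wf_int : (@lebR R).-integrable (@Rnn R) (fun w => (w * f w)%:E).
Proof. by case: f_dens => _ [_ []]. Qed.

Let mom (D : set R) : R := fine (\int[@lebR R]_(x in D) (x * f x)%:E).

Let momE (D : set R) : measurable D -> D `<=` @Rnn R ->
  (mom D)%:E = (\int[@lebR R]_(x in D) (x * f x)%:E)%E.
Proof.
move=> mD DR; rewrite fineK //; apply: integrable_fin_num => //.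
exact: integrableS wf_int.
Qed.

Let mwf (D : set R) : measurable_fun D (fun x => (x * f x)%:E).
Proof.
apply/measurable_EFinP; apply: measurable_funTS; apply: measurable_funM => //.
Qed.

Let tail_sub (l : nat) : (`[l%:R * q, +oo[ `<=` @Rnn R)%classic.
Proof. by move=> x; rewrite /Rnn /= !in_itv /= !andbT; exact: le_trans. Qed.

Let mom_step l : l%:R * q * level_prob f q l <=
  mom `[l%:R * q, +oo[%classic - mom `[l.+1%:R * q, +oo[%classic.
Proof.
have -> : mom `[l%:R * q, +oo[%classic = mom (level_bin q l) + mom `[l.+1%:R * q, +oo[%classic.
  apply: EFin_inj; rewrite EFinD !momE; try (by exact: measurable_itv);
    try (by exact: tail_sub); try (by exact: level_sub).
    rewrite level_split; apply: ge0_integral_setU.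
    - exact: mlevel.
    - exact: measurable_itv.
    - exact: mwf.
    - move=> x; rewrite -level_split => Hx; have := tail_sub Hx.
      by rewrite /Rnn /= in_itv /= andbT lee_fin => x0; rewrite mulr_ge0.
    - exact: level_disj.
rewrite addrK -lee_fin momE // EFinM.
have -> : ((level_prob f q l)%:E = \int[@lebR R]_(x in level_bin q l) (f x)%:E)%E.
  by rewrite level_probE law // setIidl.
have Rx x : level_bin q l x -> 0 <= x.
  by move=> /level_sub; rewrite /Rnn /= in_itv /= andbT.
have f0E x : level_bin q l x -> (0%R <= (f x)%:E)%E by rewrite lee_fin.
rewrite /lebR -(ge0_integralZl_EFin (@lebesgue_measure R) (mlevel l) f0E
  (@mfE (level_bin q l)) (lq_ge0 l)).
apply: ge0_le_integral.
- exact: mlevel.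
- by move=> x _; rewrite -EFinM lee_fin mulr_ge0.
- under eq_fun do rewrite -EFinM; apply/measurable_EFinP; apply: measurable_funTS.
  by apply: measurable_funM.
- exact: mwf.
- move=> x; rewrite /level_bin /= in_itv /= => /andP[h _].
  by rewrite -EFinM lee_fin ler_wpM2r.
Qed.

Let mom_ge0 l : 0 <= mom `[l%:R * q, +oo[%classic.
Proof.
apply: fine_ge0; apply: integral_ge0 => x Hx.
have := tail_sub Hx; rewrite /Rnn /= in_itv /= andbT => x0.
by rewrite lee_fin mulr_ge0.
Qed.

(** On level [l] the weight is at least [l * q], so [q] times the sum is bounded by a telescoping
    sum of tail moments, hence by the mean of the weights, whatever the number of levels. *)
Lemma mean_level_prob : exists2 mu : R, 0 <= mu &
  forall n, \sum_(0 <= l < n) l%:R * level_prob f q l <= mu.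
Proof.
exists (mom `[0%:R * q, +oo[%classic / q); first by rewrite divr_ge0 // ltW.
move=> n; rewrite ler_pdivlMr // mulr_suml.
pose m (l : nat) := mom `[l%:R * q, +oo[%classic.
apply: (@le_trans _ _ (\sum_(0 <= l < n) (m l - m l.+1))).
  by apply: ler_sum => l _; rewrite mulrAC; exact: mom_step.
rewrite (@telescope_sumr_eq _ _ _ (fun l => - m l)) //; last first.
  by move=> l _; rewrite opprK addrC.
by rewrite opprK addrC lerBlDr lerDl; exact: mom_ge0.
Qed.

End WeightLaw.

(** If all tails at [k.+1%:R^-1] vanished, the weight would be 0 almost surely; a law with a density
    has no such atom. *)
Lemma tail_pos (R : realType) (d0 : measure_display) (T : measurableType d0)
  (P : probability T R) (f : R -> R) (Y : T -> R) :
  weight_density f -> measurable_fun setT Y ->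
  (forall B : set R, measurable B ->
    P (Y @^-1` B) = (\int[@lebR R]_(x in B `&` @Rnn R) (f x)%:E)%E) ->
  exists2 q : R, 0 < q & 0 < tail f q.
Proof.
move=> fd mY law; apply: contrapT => H.
have mpre (B : set R) : measurable B -> measurable (Y @^-1` B).
  by move=> mB; rewrite -[_ @^-1` _]setTI; exact: mY.
have t0 (k : nat) : P (Y @^-1` `[k.+1%:R^-1, +oo[%classic) = 0%E.
  rewrite -(tail_prob mY law) ?invr_ge0 //; congr EFin.
  apply/eqP; rewrite eq_le; apply/andP; split.
    rewrite leNgt; apply/negP => t0.
    by apply: H; exists k.+1%:R^-1.
  by rewrite -lee_fin (tail_prob mY law) ?invr_ge0.
have pos0 : P (Y @^-1` `]0, +oo[%classic) = 0%E.
  have nb : P.-negligible (\bigcup_k (Y @^-1` `[k.+1%:R^-1, +oo[%classic)).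
    apply: negligible_bigcup => k; apply/negligibleP; last exact: t0.
    by apply: mpre; exact: measurable_itv.
  apply/(negligibleP P); first by apply: mpre; exact: measurable_itv.
  apply: negligibleS nb => om; rewrite /= in_itv /= andbT => Y0.
  have [k _ Hk] := @near_infty_natSinv_lt R (PosNum Y0).
  by exists k => //=; rewrite in_itv /= andbT; apply/ltW/(Hk k); rewrite /=.
have zero0 : P (Y @^-1` [set 0]) = 0%E.
  rewrite law // setIidl; first exact: integral_set1.
  by move=> x ->; rewrite /Rnn /= in_itv /= lexx.
have : P (Y @^-1` `[0, +oo[%classic) = 1%E by rewrite -(tail_prob mY law) // (tail0 mY law).
have -> : (`[0, +oo[ = [set 0] `|` `]0, +oo[ :> set R)%classic.
  apply/seteqP; split => [x|x [->|]]; rewrite /= !in_itv /= ?andbT.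
  - by rewrite le_eqVlt => /orP[/eqP <-|]; [left|right].
  - exact: lexx.
  - exact: ltW.
rewrite preimage_setU (_ : P _ = (P (Y @^-1` [set 0%R]) + P (Y @^-1` `]0%R, +oo[%classic))%E).
  by rewrite zero0 pos0 adde0 => -[] /esym/eqP; rewrite oner_eq0.
apply: measureU.
- exact: mpre.
- by apply: mpre; exact: measurable_itv.
- rewrite -preimage_setI (_ : _ `&` _ = set0) ?preimage_set0 //.
  by rewrite -subset0 => x [-> /=]; rewrite in_itv /= ltxx.
Qed.

(** * Asymptotics *)

Section Growth.
Variable R : realType.

Lemma near_powR_ge (a B : R) : 0 < a -> \forall n \near \oo, B <= n%:R `^ a.
Proof.
move=> a0; have [N HN] : exists N : nat, (Num.max B 1) `^ a^-1 <= N%:R.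
  exists (Num.truncn ((Num.max B 1) `^ a^-1)).+1; apply: ltW; exact: truncnS_gt.
exists N => // n /= Nn; have B1 : 0 <= Num.max B 1 by rewrite le_max ler01 orbT.
apply: (@le_trans _ _ (Num.max B 1)); first by rewrite le_max lexx.
have -> : Num.max B 1 = ((Num.max B 1) `^ a^-1) `^ a.
  by rewrite -powRrM mulVf ?lt0r_neq0 // powRr1.
apply: (ge0_ler_powR (ltW a0)); rewrite ?nnegrE ?powR_ge0 //.
by apply: le_trans HN _; rewrite ler_nat.
Qed.

Lemma near_ln_ge (B : R) : \forall n \near \oo, B <= ln (n%:R : R).
Proof.
exists (Num.truncn (expR B)).+1 => // n /= Nn.
rewrite -[B]expRK ler_ln ?posrE ?expR_gt0 ?ltr0n //; last by apply: leq_trans Nn.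
apply: ltW; apply: lt_le_trans (truncnS_gt _) _; by rewrite ler_nat.
Qed.

Lemma near_ln_pow_le (a B : R) k : 0 < a ->
  \forall n \near \oo, B * ln (n%:R : R) ^+ k <= n%:R `^ a.
Proof.
move=> a0; pose s := a / (2 * k.+1%:R).
have s0 : 0 < s by rewrite divr_gt0 // mulr_gt0.
near=> n.
have n0 : 0 < n%:R :> R by rewrite ltr0n; near: n; exists 1%N.
have l1 : 1 <= ln (n%:R : R) by near: n; exact: near_ln_ge.
have l0 : 0 <= ln (n%:R : R) by lra.
have lns : ln n%:R <= s^-1 * n%:R `^ s.
  rewrite -ler_pdivrMl ?invr_gt0 // invrK -ln_powR.
  by apply/ltW/ln_sublinear; exact: powR_gt0.
apply: (@le_trans _ _ (`|B| * ln n%:R ^+ k.+1)).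
  apply: (@le_trans _ _ (`|B| * ln n%:R ^+ k)).
    by rewrite ler_wpM2r ?exprn_ge0 // ler_norm.
  by rewrite ler_wpM2l // ler_weXn2l.
apply: (@le_trans _ _ (`|B| * (s^-1 * n%:R `^ s) ^+ k.+1)).
  by rewrite ler_wpM2l // lerXn2r ?nnegrE // (le_trans l0).
have -> : (s^-1 * n%:R `^ s) ^+ k.+1 = s^-1 ^+ k.+1 * n%:R `^ (a / 2).
  rewrite exprMn -[(n%:R `^ s) ^+ _]powR_mulrn ?powR_ge0 // -powRrM; congr (_ * _ `^ _).
  have : k.+1%:R != 0 :> R by rewrite pnatr_eq0.
  by rewrite /s; move: (k.+1%:R : R) => K K0; field.
have -> : n%:R `^ a = n%:R `^ (a / 2) * n%:R `^ (a / 2) :> R.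
  by rewrite -powRD; [congr (_ `^ _); field | rewrite lt0r_neq0 // implybT].
rewrite mulrA ler_wpM2r ?powR_ge0 //.
by near: n; apply: near_powR_ge; rewrite divr_gt0.
Unshelve. all: by end_near.
Qed.

End Growth.

Section Eventually.
Variables (R : realType) (d : nat) (c q p0 beta : R).
Hypothesis d_ge2 : (2 <= d)%N.
Hypothesis c_gt0 : 0 < c.
Hypothesis q_gt0 : 0 < q.
Hypothesis p0_gt0 : 0 < p0.
Hypothesis beta_gt0 : 0 < beta.
Hypothesis beta_lt : beta < d%:R^-1.

Let dR_gt0 : 0 < d%:R :> R. Proof. by rewrite ltr0n ltnW. Qed.

Lemma near_scale_ge (B : R) : \forall n \near \oo, B <= scale R d n.
Proof.
near=> n.
have n0 : 0 < n%:R :> R by rewrite ltr0n; near: n; exists 1%N.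
have l1 : 1 <= lnn R n by near: n; exact: near_ln_ge.
have l0 : 0 < lnn R n by lra.
have nN : (0 < n)%N by rewrite -(ltr_nat R).
apply: le_trans (ler_norm B) _.
rewrite -(@ler_pXn2r _ d) ?nnegrE ?powR_ge0 // ?(ltnW d_ge2) //.
rewrite (scale_pow d_ge2 nN l1) ler_pdivlMr //.
have : `|B| ^+ d * ln (n%:R : R) ^+ 1 <= n%:R `^ 1 by near: n; exact: near_ln_pow_le.
by rewrite expr1 powRr1 // ltW.
Unshelve. all: by end_near.
Qed.

Lemma range_base_pow n : range_base d beta n ^+ d = n%:R `^ beta.
Proof.
rewrite /range_base -powR_mulrn ?powR_ge0 // -powRrM divfK //.
exact: lt0r_neq0.
Qed.

Lemma near_scales : \forall n \near \oo,
  [/\ (2 < n)%N, 1 <= lnn R n, 1 <= blk_const d c q p0 * scale R d n & 1 <= scale R d n] /\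
  [/\ 16 <= occ_rate d c q p0 * lnn R n, 1 <= range_base d beta n,
      8 * kap_max d c q p0 <= range_base d beta n ^+ d &
      (range_base d beta n ^+ d) ^+ 2 * lnn R n ^+ 4 <= n%:R `^ (2 / d%:R)].
Proof.
have b0 := blk_const_gt0 p0 d_ge2 c_gt0 q_gt0.
have o0 := occ_rate_gt0 d_ge2 c_gt0 q_gt0 p0_gt0.
near=> n; split; split.
- by near: n; exists 3%N.
- by near: n; exact: near_ln_ge.
- by rewrite -ler_pdivrMl //; near: n; exact: near_scale_ge.
- by near: n; exact: near_scale_ge.
- by rewrite -ler_pdivrMl //; near: n; exact: near_ln_ge.
- by near: n; apply: near_powR_ge; rewrite divr_gt0.
- by rewrite range_base_pow; near: n; exact: near_powR_ge.
- rewrite range_base_pow.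
  have n0 : 0 < n%:R :> R by rewrite ltr0n; near: n; exists 1%N.
  (* As [beta < d%:R^-1], a positive power of [n] is left over to beat the logarithms. *)
  have -> : n%:R `^ (2 / d%:R) = (n%:R `^ beta) ^+ 2 * n%:R `^ (2 / d%:R - 2 * beta) :> R.
    rewrite -powR_mulrn ?powR_ge0 // -powRrM -powRD; last by rewrite lt0r_neq0 // implybT.
    by congr (_ `^ _); ring.
  rewrite ler_wpM2l ?sqr_ge0 // -[leLHS]mul1r.
  near: n; apply: near_ln_pow_le; have := beta_lt; lra.
Unshelve. all: by end_near.
Qed.

End Eventually.

Lemma poincare_mono (R : realType) n (e : rel 'I_n) (K K' : R) :
  K <= K' -> poincare e K -> poincare e K'.
Proof.
move=> KK H f h; have [a Ha] := H f h; exists a; apply: le_trans Ha _.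
by rewrite ler_wpM2r // sumr_ge0 // => x _; rewrite sumr_ge0 // => z _; rewrite sqr_ge0.
Qed.

Lemma connected_deg_gt0 n (e : rel 'I_n) i : (1 < n)%N -> graph_connected e ->
  (0 < deg e i)%N.
Proof.
move=> n1 conn; have [j ij] : exists j, j != i.
  have n0 : (0 < n)%N by apply: ltnW.
  have [i0|i0] := eqVneq (i : nat) 0%N.
    by exists (Ordinal n1); rewrite -val_eqE /= i0.
  by exists (Ordinal n0); rewrite -val_eqE /= eq_sym.
have /connectP[[|k p] /=] := conn i j; first by move=> _ ji; rewrite ji eqxx in ij.
by move=> /andP[ik _] _; rewrite degE; apply/card_gt0P; exists k; rewrite inE.
Qed.

(** Serves [c <= 0]. Two nodes are compared through their [n - 2] or more common neighbours; two
    nodes alone would form a bipartite graph. *)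
Lemma complete_poincare (R : realType) n (e : rel 'I_n) : (2 < n)%N ->
  (forall i j, e i j = (i != j)) -> poincare e (8 : R).
Proof.
move=> n2 eE f h; pose nn : R := n%:R; have n3 : 3 <= nn by rewrite ler_nat.
pose s := \sum_x f x; exists (s / nn).
have sc (x : R) : \sum_(y < n) x = nn * x by rewrite sumr_const card_ord mulr_natl.
have pairs : \sum_x \sum_y (f x - f y) ^+ 2 = 2 * nn * \sum_x (f x - s / nn) ^+ 2.
  by rewrite sum_sqr_pairs card_ord // (ltn_trans _ n2).
have D0 : 0 <= dirichlet e f h.
  by rewrite sumr_ge0 // => x _; rewrite sumr_ge0 // => z _; rewrite sqr_ge0.
have bound : (nn - 2) * \sum_x \sum_y (f x - f y) ^+ 2 <= 4 * nn * dirichlet e f h.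
  apply: (@le_trans _ _ (\sum_x \sum_(y < n) (2 * \sum_(z | e x z) (f x - h z) ^+ 2 +
      2 * \sum_(z | e y z) (f y - h z) ^+ 2))).
    rewrite mulr_sumr; apply: ler_sum => x _; rewrite mulr_sumr; apply: ler_sum => y _.
    pose Q := [predC pred2 x y].
    have cQ : nn - 2 <= #|Q|%:R.
      rewrite lerBlDl -natrD ler_nat -[leqLHS]card_ord -(cardC (pred2 x y)) leq_add2r.
      by rewrite card2; case: eqP.
    apply: (@le_trans _ _ (#|Q|%:R * (f x - f y) ^+ 2)); first by rewrite ler_wpM2r ?sqr_ge0.
    rewrite mulr_natl -sumr_const.
    apply: (@le_trans _ _ (\sum_(z in Q) (2 * (f x - h z) ^+ 2 + 2 * (f y - h z) ^+ 2))).
      apply: ler_sum => z _; have := sqr_split (f x) (h z) (f y).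
      by rewrite -[(h z - _) ^+ 2]sqrrN opprB.
    have aux u (F : 'I_n -> R) : (forall v, v \in Q -> e u v) -> (forall v, 0 <= F v) ->
        \sum_(v in Q) F v <= \sum_(v | e u v) F v.
      move=> Qe F0; rewrite [leLHS]big_mkcond [leRHS]big_mkcond; apply: ler_sum => v _.
      by case: ifP => [/Qe -> //|_]; case: ifP.
    rewrite big_split /= -!mulr_sumr; apply: lerD; rewrite ler_wpM2l //; apply: aux => v;
      rewrite ?sqr_ge0 // !inE negb_or => /andP[vx vy]; by rewrite eE eq_sym.
  rewrite (eq_bigr (fun x => nn * (2 * \sum_(z | e x z) (f x - h z) ^+ 2) +
      2 * dirichlet e f h)); last by move=> x _; rewrite big_split /= sc -mulr_sumr.
  rewrite big_split /= sc -!mulr_sumr -/(dirichlet e f h); lra.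
have degn x : (deg e x)%:R <= nn :> R.
  by rewrite ler_nat degE -[leqRHS]card_ord max_card.
set V := \sum_x (f x - s / nn) ^+ 2 in pairs.
apply: (@le_trans _ _ (nn * V)).
  by rewrite mulr_sumr; apply: ler_sum => x _; rewrite ler_wpM2r ?sqr_ge0.
have V0 : 0 <= V by rewrite sumr_ge0 // => x _; rewrite sqr_ge0.
rewrite pairs in bound.
have k0 : 0 < nn - 2 by lra.
have nn0 : 0 < 2 * nn by lra.
have b2 : (nn - 2) * V <= 2 * dirichlet e f h.
  rewrite -(ler_pM2l nn0); apply: le_trans (_ : (nn - 2) * (2 * nn * V) <= _); first by lra.
  lra.
have : nn * V <= 3 * ((nn - 2) * V) by rewrite mulrA ler_wpM2r //; lra.
lra.
Qed.

Lemma bernoulli_le (R : realFieldType) (a : R) n : 0 <= a <= 1 ->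
  1 - n%:R * a <= (1 - a) ^+ n.
Proof.
move=> /andP[a0 a1]; elim: n => [|n IH]; first by rewrite mul0r subr0 expr0.
rewrite exprS; apply: (@le_trans _ _ ((1 - a) * (1 - n%:R * a))).
  have : 0 <= n%:R * a * a by rewrite !mulr_ge0.
  rewrite -[n.+1%:R]natr1; nra.
by rewrite ler_wpM2l // subr_ge0.
Qed.

(** * Assembly into a bound with high probability *)

Section WithHighProbability.
Variables (R : realType) (d0 : measure_display) (T : measurableType d0).
Variables (P : probability T R) (d : nat) (f : R -> R) (nu c : R).
Variables (X : nat -> nat -> nat -> T -> R) (W : nat -> nat -> T -> R).
Hypothesis d_ge2 : (2 <= d)%N.
Hypothesis f_dens : weight_density f.
Hypothesis nu_gt0 : 0 < nu.
Hypothesis f_tail : tail_bound f (d%:R + nu).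
Hypothesis model : forall n : nat, gtg_model P f d n (X n) (W n).

Let graph n om : rel 'I_n :=
  @gtg_graph R T d n (X n) (W n) (c * n%:R / ln n%:R) om.

Definition mixes (C : R) (n : nat) : set T := [set om |
  graph_connected (@graph n om) -> (mixing_time (@graph n om) (n%:R^-1)
    <= (C * n%:R `^ (2 / d%:R) * ln n%:R `^ ((d%:R - 2) / d%:R))%:E)%E].

Let dR_gt0 : 0 < d%:R :> R. Proof. by rewrite ltr0n ltnW. Qed.

Let graph_sym n om : symmetric (@graph n om).
Proof. exact: gtg_adj_sym. Qed.

Let whp_cvg (C E s : R) : 0 < s -> 0 <= E ->
  (\forall n \near \oo, exists A, [/\ measurable A, A `<=` mixes C n &
    ((1 - E / n%:R `^ s)%:E <= P A)%E]) ->
  exists A : nat -> set T, (forall n, measurable (A n) /\ A n `<=` mixes C n) /\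
    (fun n => P (A n)) @ \oo --> 1%E.
Proof.
move=> s0 E0 [N _ HN].
have ex n : exists A : set T, [/\ measurable A, A `<=` mixes C n &
    (N <= n)%N -> ((1 - E / n%:R `^ s)%:E <= P A)%E].
  have [Nn|nN] := leqP N n; first by have [A [a1 a2 a3]] := HN n Nn; exists A.
  by exists set0; split.
have [A HA] := choice ex.
exists A; split; first by move=> n; have [a1 a2 _] := HA n.
apply: (@squeeze_cvge _ _ _ _ (fun n => (1 - E / n%:R `^ s)%:E) _ (fun=> 1%E)); last 2 first.
- apply: cvg_EFin; first by near=> n.
  apply/cvgrPdist_le => e e0; near=> n => /=.
  have n0 : 0 < n%:R `^ s :> R.
    by apply: powR_gt0; rewrite ltr0n; near: n; exists 1%N.
  rewrite opprB addrC subrK ger0_norm; last by rewrite divr_ge0 // ltW.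
  rewrite ler_pdivrMr // -ler_pdivrMl //; near: n; exact: near_powR_ge.
- exact: cvg_cst.
exists N => // n /= Nn; have [a1 _ a3] := HA n; rewrite a3 //=.
exact: probability_le1.
Unshelve. all: by end_near.
Qed.

Let time_bound n (om : T) (K C : R) : (2 < n)%N -> 1 <= lnn R n -> 1 <= scale R d n ->
  2 <= K -> graph_connected (@graph n om) ->
  poincare (@graph n om) (K * scale R d n ^+ 2) -> 4 * K + 1 <= C ->
  (mixing_time (@graph n om) (n%:R^-1)
    <= (C * n%:R `^ (2 / d%:R) * ln n%:R `^ ((d%:R - 2) / d%:R))%:E)%E.
Proof.
move=> n2 l1 s1 K2 conn HP KC.
have n0 : (0 < n)%N by apply: leq_trans n2.
have s2 : 1 <= scale R d n ^+ 2 by rewrite exprn_ege1.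
have sl : 1 <= scale R d n ^+ 2 * lnn R n.
  by apply: le_trans s2 _; apply: ler_peMr; [exact: sqr_ge0 | exact: l1].
apply: (mixing_time_poincare (@graph_sym n om) _ _ HP).
- by move=> x; apply: connected_deg_gt0 => //; apply: ltnW.
- by apply: le_trans s2 _; apply: ler_peMl; [exact: sqr_ge0 | lra].
- rewrite -[leRHS]mulrA -/(lnn R n) -time_scale //.
  have -> : 4 * (K * scale R d n ^+ 2) * lnn R n = 4 * K * (scale R d n ^+ 2 * lnn R n).
    by ring.
  set y := scale R d n ^+ 2 * lnn R n in sl *.
  have : (4 * K + 1) * y <= C * y by rewrite ler_wpM2r //; lra.
  lra.
Qed.

(** With a nonpositive threshold the graph is complete once all weights are nonnegative, which has
    probability one; 33 = 4 * 8 + 1 comes from [time_bound]. *)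
Let whp_nonpos : c <= 0 -> exists C E s : R, [/\ 0 < C, 0 < s, 0 <= E &
  \forall n \near \oo, exists A, [/\ measurable A, A `<=` mixes C n &
    ((1 - E / n%:R `^ s)%:E <= P A)%E]].
Proof.
move=> c0; exists 33, 0, 1; split => //; near=> n.
have n2 : (2 < n)%N by near: n; exists 3%N.
have l1 : 1 <= lnn R n by near: n; exact: near_ln_ge.
have s1 : 1 <= scale R d n by near: n; exact: near_scale_ge.
have [[mY HI] [_ HW]] := model n.
pose B (a : ('I_n * 'I_d) + 'I_n) : set R := if a is inl _ then setT else @Rnn R.
have mB a : measurable (B a) by case: a => a //=; exact: measurable_itv.
exists (\bigcap_a (gtg_var (X n) (W n) a @^-1` B a)); split.
- apply: fin_bigcap_measurable => [|a _]; first exact: finite_finset.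
  by rewrite -[_ @^-1` _]setTI; apply: mY.
- move=> om Hom conn; apply: (time_bound (K := 8)) => //; try lra.
  have wpos (i : 'I_n) : 0 <= W n i om.
    by have := Hom (inr i) I; rewrite /= /Rnn /= in_itv /= andbT.
  apply: (@poincare_mono _ _ _ 8); first by rewrite ler_peMr // exprn_ege1.
  apply: complete_poincare => // i j; rewrite /graph /gtg_graph /gtg_adj.
  case: (i != j) => //=; apply: (@le_trans _ _ 0); last by rewrite addr_ge0.
  rewrite mulr_le0_ge0 ?exprn_ge0 ?sqrtr_ge0 // mulr_le0_ge0 ?mulr_le0_ge0 //.
  by rewrite invr_ge0 (le_trans _ l1).
- rewrite mul0r subr0 HI // lee_fin big1 // => -[a|i] _ /=.
    by rewrite preimage_setT probability_setT.
  rewrite HW; last exact: measurable_itv.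
  have := HW i setT measurableT; rewrite preimage_setT probability_setT setTI setIid => <-.
  by [].
Unshelve. all: by end_near.
Qed.

(** The weight in the model with a single node, used to read integrals of [f] as probabilities. *)
Let Y : T -> R := W 1 0%N.

Let mY : measurable_fun setT Y.
Proof. by have [[H _] _] := model 1%N; exact: (H (inr ord0)). Qed.

Let law (B : set R) : measurable B ->
  P (Y @^-1` B) = (\int[@lebR R]_(x in B `&` @Rnn R) (f x)%:E)%E.
Proof. by move=> mB; have [_ [_ H]] := model 1%N; exact: (H ord0). Qed.

Let f_ge0 x : 0 <= f x. Proof. by case: f_dens. Qed.

Section Positive.
Hypothesis c_gt0 : 0 < c.
Variables (q mu W0 C0 : R).
Hypothesis q_gt0 : 0 < q.
Hypothesis tq_gt0 : 0 < tail f q.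
Hypothesis mu_ge0 : 0 <= mu.
Hypothesis mean_le : forall n, \sum_(0 <= l < n) l%:R * level_prob f q l <= mu.
Hypothesis tail_le : forall x, W0 <= x -> tail f x <= C0 * x `^ (- (d%:R + nu)).

Let p0 := tail f q.
(** Strictly between [(d%:R + nu)^-1] and [d%:R^-1]: the lower bound makes [sigma] positive, the
    upper one keeps the windows small. *)
Let beta : R := (d%:R + nu / 2)^-1.

Let beta_gt0 : 0 < beta.
Proof. by rewrite invr_gt0; have := nu_gt0; have := dR_gt0; lra. Qed.

Let beta_lt : beta < d%:R^-1.
Proof.
rewrite /beta ltf_pV2 ?posrE //; first by have := nu_gt0; lra.
by have := nu_gt0; have := dR_gt0; lra.
Qed.

Let sigma : R := beta * (d%:R + nu) - 1.

Let sigma_E : sigma = beta * (nu / 2).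
Proof.
rewrite /sigma /beta; field.
by apply: lt0r_neq0; have := nu_gt0; have := dR_gt0; lra.
Qed.

Let sigma_gt0 : 0 < sigma.
Proof. by rewrite sigma_E mulr_gt0 // divr_gt0. Qed.

Let sigma_le1 : sigma <= 1.
Proof.
rewrite sigma_E /beta mulrC ler_pdivrMr ?mul1r.
  by have := dR_gt0; lra.
by have := nu_gt0; have := dR_gt0; lra.
Qed.

Let tail_ge0 x : 0 <= x -> 0 <= tail f x.
Proof. by move=> x0; rewrite -lee_fin (tail_prob mY law). Qed.

Let lev_rate : R := q / (8 * kap_max d c q p0).

Let kp_gt0 : 0 < kap_max d c q p0.
Proof. exact: kap_max_gt0. Qed.

Let lev_rate_gt0 : 0 < lev_rate.
Proof. by rewrite /lev_rate divr_gt0 // mulr_gt0 // kp_gt0. Qed.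

Let err_const : R :=
  `|C0| * lev_rate `^ (- (d%:R + nu)) +
  ((2 ^ ((win_radius d c q p0).*2.+1 ^ d * side d c q p0 ^ d))%:R + 1) *
   (2 * blk_const d c q p0) ^+ d.

Let blk_pow_ge0 : 0 <= (2 * blk_const d c q p0) ^+ d.
Proof. by rewrite exprn_ge0 // mulr_ge0 // ltW // blk_const_gt0. Qed.

(** The cap is at least of order n^beta, so the union bound over the nodes is of order n^(1 - beta
    (d + nu)), that is n^(- sigma). *)
Let cap_tail n : (0 < n)%N -> 1 <= range_base d beta n ->
  8 * kap_max d c q p0 <= range_base d beta n ^+ d ->
  W0 <= lev_rate * n%:R `^ beta ->
  n%:R * tail f ((levels d c q p0 beta n)%:R * q) <=
    `|C0| * lev_rate `^ (- (d%:R + nu)) / n%:R `^ sigma.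
Proof.
move=> n0 h1 h2 h3; set Lev := levels d c q p0 beta n.
have n0R : 0 < n%:R :> R by rewrite ltr0n.
have nb : 0 < n%:R `^ beta by apply: powR_gt0.
have key : lev_rate * n%:R `^ beta <= Lev%:R * q.
  have := levels_ge d_ge2 c_gt0 q_gt0 h1 h2; rewrite (range_base_pow _ d_ge2) -/Lev => h.
  have kp8 : 0 < 8 * kap_max d c q p0 by rewrite mulr_gt0 // kp_gt0.
  rewrite /lev_rate mulrAC ler_pdivrMr //.
  have -> : Lev%:R * q * (8 * kap_max d c q p0) = q * (8 * kap_max d c q p0 * Lev%:R) by ring.
  by rewrite ler_wpM2l // ltW.
have lp : 0 < lev_rate * n%:R `^ beta by rewrite mulr_gt0.
have Lq : 0 < Lev%:R * q by apply: lt_le_trans key.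
apply: (@le_trans _ _ (n%:R * (`|C0| * (lev_rate * n%:R `^ beta) `^ (- (d%:R + nu))))).
  rewrite ler_wpM2l //; apply: le_trans (tail_le (le_trans h3 key)) _.
  apply: (@le_trans _ _ (`|C0| * (Lev%:R * q) `^ (- (d%:R + nu)))).
    by rewrite ler_wpM2r ?powR_ge0 // ler_norm.
  rewrite ler_wpM2l // !powRN lef_pV2 ?posrE ?powR_gt0 //.
  apply: ge0_ler_powR; rewrite ?nnegrE ?(ltW Lq) ?(ltW lp) //.
  by have := nu_gt0; have := dR_gt0; lra.
rewrite powRM ?(ltW lev_rate_gt0) ?(ltW nb) //.
have -> : (n%:R `^ beta) `^ (- (d%:R + nu)) = (n%:R * n%:R `^ sigma)^-1 :> R.
  rewrite -powRrM mulrN powRN; congr (_^-1).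
  rewrite -{2}(powRr1 (ltW n0R)) -powRD; last by rewrite lt0r_neq0 // implybT.
  by congr (_ `^ _); rewrite /sigma; ring.
have ns : 0 < n%:R `^ sigma by apply: powR_gt0.
rewrite le_eqVlt; apply/orP; left; apply/eqP.
by field; rewrite !lt0r_neq0.
Qed.

Let whp_pos : \forall n \near \oo, exists A,
  [/\ measurable A, A `<=` mixes (4 * gap_const d c q p0 mu + 1) n &
    ((1 - err_const / n%:R `^ sigma)%:E <= P A)%E].
Proof.
near=> n.
have [[n2 l1 bs1 s1] [occ rb1 rb2 rb3]] :
  [/\ (2 < n)%N, 1 <= lnn R n, 1 <= blk_const d c q p0 * scale R d n & 1 <= scale R d n] /\
  [/\ 16 <= occ_rate d c q p0 * lnn R n, 1 <= range_base d beta n,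
      8 * kap_max d c q p0 <= range_base d beta n ^+ d &
      (range_base d beta n ^+ d) ^+ 2 * lnn R n ^+ 4 <= n%:R `^ (2 / d%:R)].
  by near: n; exact: near_scales.
have w1 : W0 <= lev_rate * n%:R `^ beta.
  by rewrite -ler_pdivrMl //; near: n; exact: near_powR_ge.
have tsmall : `|C0| * lev_rate `^ (- (d%:R + nu)) * (2 / p0) <= n%:R `^ sigma.
  by near: n; exact: near_powR_ge.
have n0 : (0 < n)%N by apply: leq_trans n2.
have n0R : 0 < n%:R :> R by rewrite ltr0n.
have ns : 0 < n%:R `^ sigma by apply: powR_gt0.
have ct := cap_tail n0 rb1 rb2 w1.
pose M := blocks d c q p0 n; pose S := side d c q p0; pose Lev := levels d c q p0 beta n.
pose pl (l : 'I_Lev) := level_prob f q l.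
have MS0 : (0 < M * S)%N by [].
have theta0 : 0 < theta_n c n by rewrite divr_gt0 ?mulr_gt0 //; apply: lt_le_trans l1.
have Lev0 : (0 < Lev)%N.
  rewrite -(ltr_nat R) lt0r ler0n andbT; apply/eqP => L0.
  have b1 : 1 <= range_base d beta n ^+ d by rewrite exprn_ege1.
  by have := levels_ge d_ge2 c_gt0 q_gt0 rb1 rb2; rewrite -/Lev L0 mulr0; lra.
pose a := tail f (Lev%:R * q).
have a0 : 0 <= a by apply: tail_ge0; rewrite mulr_ge0 // ltW.
have sum_pl : \sum_l pl l = 1 - a.
  rewrite -(big_mkord xpredT (fun l => level_prob f q l)) (sum_level_prob mY law q_gt0) //.
  by rewrite mul0r (tail0 mY law).
have pl0 l : 0 <= pl l by apply: level_prob_ge0.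
have a1 : a <= 1.
  have : 0 <= \sum_l pl l by rewrite sumr_ge0.
  by rewrite sum_pl; lra.
(* [a] is the probability that one weight reaches the cap. The levels from 1 up to the cap have mass
   [p0 - a], hence at least half of [p0]. *)
have a_p0 : a <= p0 / 2.
  have n1 : a <= n%:R * a by rewrite ler_peMl // ler1n.
  apply: le_trans n1 (le_trans ct _).
  have p0p : 0 < p0 by [].
  rewrite ler_pdivrMr //; move: tsmall; rewrite mulrA ler_pdivrMr //.
  by lra.
have core_ge : p0 / 2 <= core_mass pl.
  have E : \sum_l pl l = level_prob f q 0 + core_mass pl.
    rewrite (bigD1 (Ordinal Lev0)) //=; congr (_ + _); rewrite /core_mass.
    by apply: eq_bigl => l; rewrite -val_eqE /= lt0n.
  have := tail_step mY law q_gt0 0; rewrite mul0r (tail0 mY law) mul1r -/p0.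
  move: E; rewrite sum_pl; lra.
have reach_le : reach_mass d M pl (kap_n d c q p0 n) <=
    5%:R ^+ d / (M ^ d)%:R * (1 + kap_max d c q p0 * (2 * mu + 2)).
  rewrite /reach_mass; apply: ler_wpM2l; first by rewrite divr_ge0 // exprn_ge0.
  have kn := kap_n_le d_ge2 c_gt0 q_gt0 n0 l1 bs1.
  have kn0 := kap_n_ge0 d p0 c_gt0 q_gt0 n0 l1.
  set k := kap_n _ _ _ _ _ in kn kn0 *; set km := kap_max _ _ _ _ in kn *.
  have -> : \sum_l pl l * (1 + k * (2 * (l : nat)%:R + 2)) =
      (1 + 2 * k) * (\sum_l pl l) + 2 * k * \sum_(l < Lev) (l : nat)%:R * pl l.
    rewrite !mulr_sumr -big_split /=; apply: eq_bigr => l _; ring.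
  have ml : \sum_(l < Lev) (l : nat)%:R * pl l <= mu.
    by rewrite -(big_mkord xpredT (fun l => l%:R * level_prob f q l)).
  have ml0 : 0 <= \sum_(l < Lev) (l : nat)%:R * pl l.
    by rewrite sumr_ge0 // => l _; rewrite mulr_ge0.
  move: (\sum_(l < Lev) (l : nat)%:R * pl l) ml ml0 => m ml ml0.
  rewrite sum_pl.
  have h1 : k * m <= km * mu by rewrite ler_pM.
  have h2 : 0 <= k * a by rewrite mulr_ge0.
  lra.
have slack0 : 0 <= n%:R * core_mass pl / (2 * ((M * S) ^ d)%:R) - (core_min d c q p0 n)%:R.
  apply: le_trans (slack_ge d_ge2 c_gt0 q_gt0 tq_gt0 n0 l1 bs1 occ core_ge).
  by move: occ; rewrite -/p0; lra.
have sum_le1 : \sum_l pl l <= 1 by rewrite sum_pl; lra.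
have gc := good_configurations (bad_bound d c q p0) (win_radius d c q p0)
  (deg_bound d c q p0 mu n) pl0 sum_le1 MS0 (kap_n_ge0 d p0 c_gt0 q_gt0 n0 l1) slack0.
set G := [pred z | _] in gc.
exists (config_event (X n) (W n) q G); split.
- exact: (measurable_config_event q (model n)).
- move=> om Hom conn; have [z /andP[bad reach] Hz] := bigsetU_witness Hom.
  have [posz wz] := conf_eventP MS0 Hz.
  have K2 := gap_const_ge2 d_ge2 c_gt0 q_gt0 tq_gt0 mu_ge0.
  apply: (time_bound n2 l1 s1 K2 conn _ (lexx _)).
  apply: poincare_mono
    (poincare_const_le d_ge2 c_gt0 q_gt0 tq_gt0 mu_ge0 n0 l1 bs1 s1 occ rb1 rb3) _.
  apply: (gtg_poincare d_ge2 q_gt0 theta0 posz wz bad reach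
    (core_range_ok p0 d_ge2 c_gt0 q_gt0 n0 l1 s1)
    (heavy_range_ok p0 d_ge2 c_gt0 q_gt0 n0 l1 s1)
    (light_range_ok d_ge2 c_gt0 q_gt0 n0 l1 bs1)
    (max_range_ok d_ge2 c_gt0 q_gt0 n0 l1 bs1 rb1 rb2) conn) => //.
  exact: core_min_ge3 occ.
rewrite (config_event_prob (model n) MS0 q_gt0) lee_fin.
have e1 := bad_error d_ge2 c_gt0 q_gt0 tq_gt0 n0 l1 bs1 occ core_ge.
have e2 := reach_error d_ge2 c_gt0 q_gt0 mu_ge0 n0 l1 bs1 s1 reach_le.
(* All weights stay below the cap with probability [(1 - a) ^+ n]. *)
have e3 : 1 - n%:R * a <= (\sum_l pl l) ^+ n by rewrite sum_pl; apply: bernoulli_le; rewrite a0.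
(* As [sigma <= 1], the Chernoff errors of order 1/n are absorbed into the error of the cap. *)
have e4 : n%:R^-1 <= (n%:R `^ sigma)^-1 :> R.
  rewrite lef_pV2 ?posrE //.
  by rewrite -[leRHS](powRr1 (ltW n0R)) ler_powR // ler1n.
rewrite /err_const mulrDl.
have e5 : ((2 ^ ((win_radius d c q p0).*2.+1 ^ d * side d c q p0 ^ d))%:R + 1) *
   (2 * blk_const d c q p0) ^+ d / n%:R <=
   ((2 ^ ((win_radius d c q p0).*2.+1 ^ d * side d c q p0 ^ d))%:R + 1) *
   (2 * blk_const d c q p0) ^+ d / n%:R `^ sigma.
  by rewrite ler_wpM2l // mulr_ge0 // addr_ge0.
move: e1 e2 e3 e5 ct gc; rewrite -/p0 -/M -/S -/Lev -/a.
set b := (2 * blk_const _ _ _ _) ^+ d; set V := (2 ^ _)%:R.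
clearbody b V; have -> : (V + 1) * b / n%:R = V * (b / n%:R) + b / n%:R.
  by rewrite mulrDl mulrDl mul1r mulrA.
lra.
Unshelve. all: by end_near.
Qed.

Lemma mixes_whp_pos : exists C E s : R, [/\ 0 < C, 0 < s, 0 <= E &
  \forall n \near \oo, exists A, [/\ measurable A, A `<=` mixes C n &
    ((1 - E / n%:R `^ s)%:E <= P A)%E]].
Proof.
exists (4 * gap_const d c q p0 mu + 1), err_const, sigma; split.
- by have := gap_const_ge2 d_ge2 c_gt0 q_gt0 tq_gt0 mu_ge0; rewrite -/p0; lra.
- exact: sigma_gt0.
- by rewrite /err_const addr_ge0 // mulr_ge0 ?powR_ge0 // addr_ge0.
- exact: whp_pos.
Qed.

End Positive.

Lemma mixes_whp : exists C : R, 0 < C /\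
  exists A : nat -> set T, (forall n, measurable (A n) /\ A n `<=` mixes C n) /\
    (fun n => P (A n)) @ \oo --> 1%E.
Proof.
have [C [E [s [C0 s0 E0 H]]]] : exists C E s : R, [/\ 0 < C, 0 < s, 0 <= E &
    \forall n \near \oo, exists A, [/\ measurable A, A `<=` mixes C n &
      ((1 - E / n%:R `^ s)%:E <= P A)%E]].
  have [c0|c0] := leP c 0; first exact: whp_nonpos.
  have [q q0 tq] := tail_pos f_dens mY law.
  have [mu mu0 Hmu] := mean_level_prob f_dens mY law q0.
  have [W0 [C0 [_ HC]]] := f_tail.
  have H := mixes_whp_pos c0 q0 tq mu0 Hmu.
  exact: H HC.
by exists C; split=> //; exact: whp_cvg H.
Qed.

End WithHighProbability.

Theorem theorem2 (R : realType) (d0 : measure_display) (T : measurableType d0)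
  (P : probability T R) (d : nat) (f : R -> R) (nu c : R)
  (X : nat -> nat -> nat -> T -> R) (W : nat -> nat -> T -> R) :
  (2 <= d)%N ->
  weight_density f ->
  0 < nu ->
  tail_bound f (d%:R + nu) ->
  c <= (d%:R + 3)^-1 *
       Num.min (sup [set a * quantile f a | a in `]0, 2^-1]])
               (sup [set (1 - a) * quantile f a | a in `]2^-1, 1[]) ->
  (forall n : nat, gtg_model P f d n (X n) (W n)) ->
  exists C : R, 0 < C /\
    exists A : nat -> set T,
      (forall n : nat, measurable (A n) /\
         A n `<=` [set om | graph_connected
                              (@gtg_graph R T d n (X n) (W n) (c * n%:R / ln n%:R) om) ->
                            (@mixing_time R n
                               (@gtg_graph R T d n (X n) (W n) (c * n%:R / ln n%:R) om)
                               (n%:R^-1)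
                             <= (C * n%:R `^ (2 / d%:R)
                                   * ln n%:R `^ ((d%:R - 2) / d%:R))%:E)%E]) /\
      (fun n => P (A n)) @ \oo --> 1%E.
Proof.
move=> d2 fd nu0 ft _ model.
exact: (mixes_whp c d2 fd nu0 ft model).
Qed.
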